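(* Assume $\lim_{n\to\infty}X'X/n=Q$ exists and is positive definite; partition $Q$ as $\begin{bmatrix}Q_{11}&Q_{12}\\Q_{21}&Q_{22}\end{bmatrix}$ conformably with $(k_1,k_2)$. (1) If $\beta^{(n)}$ is a sequence in $\mathbb{R}^k$ with $\|\sqrt n\beta_2^{(n)}\|\to\infty$, then the distribution of $\sqrt n(\tilde\beta-\beta^{(n)})$ under $\mathbb{P}_{n,\beta^{(n)},\sigma}$ converges weakly to $N(0,\sigma^2Q^{-1})$. (2) If $\sqrt n\beta_2^{(n)}\to\gamma\in\mathbb{R}^{k_2}$, then the distribution of $\sqrt n(\tilde\beta-\beta^{(n)})$ under $\mathbb{P}_{n,\beta^{(n)},\sigma}$ converges weakly to the distribution of $$B_\infty\gamma+C_\infty Z_1+\Big[1+\exp(2\alpha k_2)\exp\big(-\alpha\|Z_2+(Q_{22}-Q_{21}Q_{11}^{-1}Q_{12})^{1/2}\gamma\|^2/\sigma^2\big)\Big]^{-1}\{D_\infty Z_2-B_\infty\gamma\},$$ where $B_\infty=\begin{bmatrix}Q_{11}^{-1}Q_{12}\\-I_{k_2}\end{bmatrix}$, $C_\infty=\begin{bmatrix}Q_{11}^{-1/2}\\0_{k_2\times k_1}\end{bmatrix}$, $D_\infty=\begin{bmatrix}-Q_{11}^{-1}Q_{12}(Q_{22}-Q_{21}Q_{11}^{-1}Q_{12})^{-1/2}\\(Q_{22}-Q_{21}Q_{11}^{-1}Q_{12})^{-1/2}\end{bmatrix}$, and $Z_1\sim N(0,\sigma^2I_{k_1})$, $Z_2\sim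 N(0,\sigma^2I_{k_2})$ are independent. This limit distribution has Lebesgue density $f_{\infty,\gamma}$ given, for $t=(t_1',t_2')'$, by: with $D_{\infty2}=(Q_{22}-Q_{21}Q_{11}^{-1}Q_{12})^{-1/2}$, $w=D_{\infty2}^{-1}(t_2+\gamma)$, $G=g(\|w\|)$, $$f_{\infty,\gamma}(t)=(2\pi\sigma^2)^{-k/2}[\det Q]^{1/2}\exp\Big(-\tfrac1{2\sigma^2}\|Q_{11}^{1/2}t_1+Q_{11}^{-1/2}Q_{12}t_2\|^2\Big)\big[1+\exp(-\alpha\sigma^{-2}G^2+2\alpha k_2)\big]^{k_2}$$ $$\times\Big\{1+2\alpha\sigma^{-2}G^2\big[1+\exp(\alpha\sigma^{-2}G^2-2\alpha k_2)\big]^{-1}\Big\}^{-1}\exp\Big(-\tfrac1{2\sigma^2}\big\|G\,w/\|w\|-D_{\infty2}^{-1}\gamma\big\|^2\Big),$$ with the convention $G\,w/\|w\|=0$ when $w=0$.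
   Context: Setup: for each sample size $n$, $Y=X\beta+u$, where $Y$ is $n\times1$, $X$ is a non-stochastic $n\times k$ matrix of full column rank $k$ (so $n\ge k$), $k>1$, and $u\sim N(0,\sigma^2I_n)$ with $0<\sigma^2<\infty$ known. $\mathbb{P}_{n,\beta,\sigma}$ denotes the distribution of $Y$. Partition $X=[X_1:X_2]$ and $\beta=(\beta_1',\beta_2')'$ commensurably, with $X_i$ having $k_i\ge1$ columns. $\hat\beta(R)=\big(((X_1'X_1)^{-1}X_1'Y)',0_{1\times k_2}\big)'$, $\hat\beta(U)=(X'X)^{-1}X'Y$. For $\alpha>0$, $\tilde\beta=\hat\lambda\hat\beta(R)+(1-\hat\lambda)\hat\beta(U)$ with $\hat\lambda=\big[1+\exp(-2\alpha k_2)\exp(\alpha\|X\hat\beta(R)-X\hat\beta(U)\|^2/\sigma^2)\big]^{-1}$. $A^{1/2}$ is the symmetric positive definite root. Function $g$: with $a=\exp(2\alpha k_2)$, $b=\sigma^2/\alpha$, $h(\xi)=[1+a\exp(-\xi^2/b)]^{-1}\xi$ on $[0,\infty)$ is a continuous strictly increasing bijection of $[0,\infty)$, and $g$ is its inverse. *)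

(* Defs.v *)
From HB Require Import structures.
From mathcomp Require Import all_boot all_order all_algebra.
From mathcomp Require Import all_classical all_reals all_analysis.
Set Implicit Arguments. Unset Strict Implicit. Unset Printing Implicit Defensive.
Import Order.TTheory GRing.Theory Num.Theory.
Import numFieldNormedType.Exports.
Local Open Scope classical_set_scope.
Local Open Scope ring_scope.

Section Defs.
Variable R : realType.

Definition sqnorm k (v : 'cV[R]_k) : R := \sum_(i < k) v i 0 ^+ 2.
Definition vnorm k (v : 'cV[R]_k) : R := Num.sqrt (sqnorm v).

(* Lebesgue integral over R^k, written as an iterated one-dimensional
   Lebesgue integral (Fubini); the first coordinate is integrated outermost. *)
Fixpoint iint (k : nat) : ('cV[R]_k -> R) -> R :=
  match k with
  | 0%N => fun F => F 0
  | k'.+1 => fun F : 'cV[R]_k'.+1 -> R =>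
      Rintegral (@lebesgue_measure R) setT
        (fun x : R => iint (fun v : 'cV[R]_k' =>
           F (col_mx (const_mx x : 'cV[R]_1) v)))
  end.

Definition posdef k (A : 'M[R]_k) : Prop :=
  A^T = A /\ forall v : 'cV[R]_k, v != 0 -> 0 < (v^T *m A *m v) 0 0.

Definition mxsqrt k (A : 'M[R]_k) : 'M[R]_k :=
  get [set S : 'M[R]_k | posdef S /\ S *m S = A].
Definition mxisqrt k (A : 'M[R]_k) : 'M[R]_k := invmx (mxsqrt A).

Definition iso_normal_pdf m (s2 : R) (mu y : 'cV[R]_m) : R :=
  (2 * pi * s2) `^ (- (m%:R / 2)) * expR (- sqnorm (y - mu) / (2 * s2)).

Definition mvnormal_pdf m (Sigma : 'M[R]_m) (t : 'cV[R]_m) : R :=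
  (2 * pi) `^ (- (m%:R / 2)) * (Num.sqrt (\det Sigma))^-1 *
  expR (- (t^T *m invmx Sigma *m t) 0 0 / 2).

(* a probability law on R^m, represented by its expectation functional
   f |-> E f; weak convergence: E_n f -> E f for all bounded continuous f *)
Definition weak_cvg m (En : nat -> ('cV[R]_m -> R) -> R)
    (E : ('cV[R]_m -> R) -> R) : Prop :=
  forall f : 'cV[R]_m -> R, continuous f ->
    (exists M : R, forall x, `|f x| <= M) ->
    (fun n => En n f) @ \oo --> E f.

Section Estimator.
Variables (k1 k2 n : nat) (alpha sigma : R) (X : 'M[R]_(n, k1 + k2)).

Definition X1 : 'M[R]_(n, k1) := lsubmx X.

Definition betaR (Y : 'cV[R]_n) : 'cV[R]_(k1 + k2) :=
  col_mx (invmx (X1^T *m X1) *m X1^T *m Y) 0.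

Definition betaU (Y : 'cV[R]_n) : 'cV[R]_(k1 + k2) :=
  invmx (X^T *m X) *m X^T *m Y.

Definition lambda_hat (Y : 'cV[R]_n) : R :=
  (1 + expR (- (2 * alpha * k2%:R)) *
       expR (alpha * sqnorm (X *m betaR Y - X *m betaU Y) / sigma ^+ 2))^-1.

Definition beta_tilde (Y : 'cV[R]_n) : 'cV[R]_(k1 + k2) :=
  lambda_hat Y *: betaR Y + (1 - lambda_hat Y) *: betaU Y.

End Estimator.

Definition law_stat k1 k2 n (alpha sigma : R) (X : 'M[R]_(n, k1 + k2))
    (beta : 'cV[R]_(k1 + k2)) : ('cV[R]_(k1 + k2) -> R) -> R :=
  fun f => iint (fun Y : 'cV[R]_n =>
    f (Num.sqrt n%:R *: (beta_tilde alpha sigma X Y - beta)) *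
    iso_normal_pdf (sigma ^+ 2) (X *m beta) Y).

Definition h_fun (alpha sigma : R) (k2 : nat) (xi : R) : R :=
  (1 + expR (2 * alpha * k2%:R) * expR (- xi ^+ 2 / (sigma ^+ 2 / alpha)))^-1 * xi.

Definition g_fun (alpha sigma : R) (k2 : nat) (y : R) : R :=
  get [set xi : R | 0 <= xi /\ h_fun alpha sigma k2 xi = y].

End Defs.

(* Main.v *)
(** For every [n], the estimation error [sqrt n *: (beta_tilde - beta)] is one fixed
function [averaged A b y] of the Gram matrix [A = X^T X / n], the drift
[b = sqrt n *: beta_2] and the scaled error [y] of the unrestricted estimator, and
[y] is centred normal with precision [A / sigma^2].  When [A] tends to [Q] the
normal densities are eventually dominated by a fixed one, so that dominated
convergence gives the limit laws: if [|b|] tends to infinity, the weight of the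
restricted estimator vanishes and [averaged A b y] tends to [y]; if [b] tends to
[gamma], it tends to [averaged Q gamma y].

In a block triangular frame [W] with [W W^T = Q^-1], the second limit is the affine
image of [(z1, s v)], where [z1] and [v] are independent normal vectors and the
factor [s] depends on [|v|] only.  The map [v |-> s v] preserves rays and acts on
them by the increasing function [h], with inverse [g]; integrating along the rays
yields its Jacobian, hence the density. *)

Require Import Defs.
From HB Require Import structures.
From mathcomp Require Import all_boot all_order all_algebra.
From mathcomp Require Import all_classical all_reals all_analysis.
From mathcomp Require Import ring lra.
From mathcomp Require complex.
From mathcomp Require Import measurable_realfun.
Import Order.TTheory GRing.Theory Num.Theory.
Import numFieldNormedType.Exports.
Local Open Scope classical_set_scope.
Local Open Scope ring_scope.
Set Implicit Arguments. Unset Strict Implicit. Unset Printing Implicit Defensive.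

(** * Measurability and limits of matrices *)

(** The statement expresses every expectation by [iint], an iterated integral of real-valued slices;
    convergence and substitution theorems do not apply to it directly, and a slice that is not
    integrable yields a meaningless value. The measure [muV] is built by the same recursion, and
    [iintE] identifies the two on integrable functions. In between, identities are proved for
    nonnegative functions and [muV], where Tonelli's theorem asks for no integrability; signed test
    functions are handled through their positive and negative parts.

    The radial map is nonlinear, yet its change of variables is obtained from linear ones. An
    auxiliary scale [s], with a probability density depending on [w], is inserted into the integral;
    for fixed [s] the substitution [w = s v] is linear, and after exchanging the integrals there
    remains, for fixed [v], an integral over the line spanned by [v], to which substitution on the
    real line applies. That rule is used for continuous integrands, so the density is tested against
    continuous functions, as in the theorem. *)

Definition mx_display : measure_display.
Proof. exact: default_measure_display. Qed.

Section measurable_matrix.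
Variables (R : realType) (m n : nat).

(** The product sigma-algebra, generated by the entries, so that measurability into a matrix space
    can be checked entry by entry. That continuous functions are measurable for it then takes a
    proof ([continuous_measurable_matrix]). *)
Definition coord_sets : set (set 'M[R]_(m, n)) :=
  [set A | exists i j, exists2 B, measurable B &
    A = (fun M : 'M[R]_(m, n) => M i j) @^-1` B].

HB.instance Definition _ := @isMeasurable.Build mx_display 'M[R]_(m, n)
  <<s coord_sets >> (@sigma_algebra0 _ setT coord_sets)
  (@sigma_algebraC _ coord_sets) (@sigma_algebra_bigcup _ setT coord_sets).

Lemma measurable_coord i j :
  measurable_fun setT (fun M : 'M[R]_(m, n) => M i j).
Proof.
move=> _ B mB; rewrite setTI; apply: sub_sigma_algebra.
by exists i, j, B.
Qed.

Lemma measurable_matrixP d (T : measurableType d) (f : T -> 'M[R]_(m, n)) :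
  (forall i j, measurable_fun setT (fun x => f x i j)) -> measurable_fun setT f.
Proof.
move=> mf; apply: (@measurability _ _ _ _ _ _ coord_sets) => //.
move=> _ [_ [i [j [B mB ->]]]] <-.
exact: (mf i j).
Qed.

Lemma cvg_matrixP (I : Type) (F : set_system I) {FF : Filter F}
    (f : I -> 'M[R]_(m, n)) (l : 'M[R]_(m, n)) :
  (forall i j, f x i j @[x --> F] --> l i j) -> f @ F --> l.
Proof.
move=> fl; apply/cvgrPdist_le => e e0.
have H i j : \forall x \near F, `|l i j - f x i j| <= e.
  by move/cvgrPdist_le : (fl i j); apply.
have : \forall x \near F, forall ij : 'I_m * 'I_n,
    `|l ij.1 ij.2 - f x ij.1 ij.2| <= e.
  by apply: filter_forall => -[i j]; exact: H.
apply: filterS => x Hx; rewrite /Num.norm/= mx_normrE.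
apply/bigmax_leP; split; first exact: ltW.
by move=> ij _; rewrite !mxE; exact: Hx.
Qed.

Lemma cvg_coord (I : Type) (F : set_system I) {FF : Filter F}
    (f : I -> 'M[R]_(m, n)) (l : 'M[R]_(m, n)) i j :
  f @ F --> l -> f x i j @[x --> F] --> l i j.
Proof.
move=> fl; apply: (@continuous_cvg _ _ _ F FF f (fun M : 'M[R]_(m, n) => M i j) l) => //.
exact: coord_continuous.
Qed.

End measurable_matrix.

(* A continuous function is the pointwise limit of its compositions with the
   coordinatewise rounding maps, whose images are countable. *)
Lemma continuous_measurable_matrix (R : realType) m n (f : 'M[R]_(m, n) -> R) :
  continuous f -> measurable_fun setT f.
Proof.
move=> cf.
pose rd (N : nat) (M : 'M[R]_(m, n)) : 'M[int]_(m, n) :=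
  map_mx (fun x => Num.floor (N.+1%:R * x)) M.
pose back (N : nat) (Z : 'M[int]_(m, n)) : 'M[R]_(m, n) :=
  map_mx (fun z => z%:~R / N.+1%:R) Z.
apply: (@measurable_fun_cvg _ _ _ _ (fun N => f \o back N \o rd N)).
- move=> N _ B mB; rewrite setTI.
  rewrite (_ : _ @^-1` B = \bigcup_(Z : 'M[int]_(m, n))
    ([set M | B (f (back N Z))] `&` [set M | rd N M = Z])); last first.
    apply/seteqP; split=> [M BM|M [Z _ [/= BZ ZE]]]; last by rewrite /= ZE.
    by exists (rd N M).
  apply: countable_bigcupT_measurable; first exact: countableP.
  move=> Z.
  apply: measurableI.
    have [BZ|nBZ] := pselect (B (f (back N Z))).
      by rewrite (_ : [set _ | _] = setT)//; apply/seteqP; split.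
    by rewrite (_ : [set _ | _] = set0)//; apply/seteqP; split.
  rewrite (_ : [set _ | _] = \bigcap_(ij in [set: 'I_m * 'I_n])
     ((fun M : 'M[R]_(m, n) => M ij.1 ij.2) @^-1`
        [set x | Num.floor (N.+1%:R * x) = Z ij.1 ij.2])).
    apply: fin_bigcap_measurable => // ij _.
    rewrite -[X in measurable X]setTI; apply: measurable_coord => //.
    rewrite (_ : [set _ | _] = `[(Z ij.1 ij.2)%:~R / N.+1%:R,
        (Z ij.1 ij.2 + 1)%:~R / N.+1%:R[%classic) //.
    apply/seteqP; split=> [x/= zx|x/=].
      rewrite in_itv/= ler_pdivrMr// ltr_pdivlMr// ![x * _]mulrC -zx.
      exact: floor_itv.
    rewrite in_itv/= ler_pdivrMr// ltr_pdivlMr// ![x * _]mulrC => xz.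
    by apply/eqP; rewrite floor_eq.
  apply/seteqP; split=> [M/= <- ij _|M/= MZ]; first by rewrite mxE.
  by apply/matrixP => i j; rewrite mxE (MZ (i, j)).
- move=> M _; apply: (@continuous_cvg _ _ _ _ _ (fun N => back N (rd N M)) f M (cf M)).
  apply: cvg_matrixP => i j; apply/cvgrPdist_le => e e0.
  near=> N; rewrite !mxE.
  have N0 : 0 < N.+1%:R :> R by [].
  set x := N.+1%:R * _; have -> : M i j = x / N.+1%:R.
    by rewrite /x mulrC mulKf// gt_eqF.
  rewrite -mulrBl ger0_norm; last first.
    by rewrite divr_ge0// subr_ge0; have /andP[] := floor_itv x.
  have /andP[x1 x2] := floor_itv x.
  rewrite ler_pdivrMr//.
  apply: (@le_trans _ _ 1).
    by move: x2; rewrite intrD => /ltW; lra.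
  rewrite mulrC -ler_pdivrMr// mul1r.
  have : e^-1 <= N%:R by near: N; exact: nbhs_infty_ger.
  by move=> /le_trans; apply; rewrite ler_nat.
Unshelve. all: end_near.
Qed.

Section continuity_matrix.
Variables (R : realType).
Context (I : Type) (F : set_system I) {FF : Filter F}.

Lemma cvg_sum (J : Type) (r : seq J) (P : pred J) (f : J -> I -> R) (l : J -> R) :
  (forall j, P j -> f j x @[x --> F] --> l j) ->
  (\sum_(j <- r | P j) f j x) @[x --> F] --> \sum_(j <- r | P j) l j.
Proof. by move=> fl; apply: cvg_big => //; exact: add_continuous. Qed.

Lemma cvg_mulmx m n p (f : I -> 'M[R]_(m, n)) (g : I -> 'M[R]_(n, p))
    (A : 'M[R]_(m, n)) (B : 'M[R]_(n, p)) :
  f @ F --> A -> g @ F --> B -> (fun x => f x *m g x) @ F --> A *m B.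
Proof.
move=> fA gB; apply: cvg_matrixP => i j.
under eq_fun do rewrite mxE; rewrite mxE.
by apply: cvg_sum => k _; apply: cvgM; exact: cvg_coord.
Qed.

Lemma cvg_trmx m n (f : I -> 'M[R]_(m, n)) (A : 'M[R]_(m, n)) :
  f @ F --> A -> (fun x => (f x)^T) @ F --> A^T.
Proof.
move=> fA; apply: cvg_matrixP => i j; under eq_fun do rewrite mxE.
by rewrite mxE; exact: cvg_coord.
Qed.

Lemma cvg_usubmx m n p (f : I -> 'M[R]_(m + p, n)) (A : 'M[R]_(m + p, n)) :
  f @ F --> A -> (fun x => usubmx (f x)) @ F --> usubmx A.
Proof.
move=> fA; apply: cvg_matrixP => i j; under eq_fun do rewrite mxE.
by rewrite mxE; exact: cvg_coord.
Qed.

Lemma cvg_dsubmx m n p (f : I -> 'M[R]_(m + p, n)) (A : 'M[R]_(m + p, n)) :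
  f @ F --> A -> (fun x => dsubmx (f x)) @ F --> dsubmx A.
Proof.
move=> fA; apply: cvg_matrixP => i j; under eq_fun do rewrite mxE.
by rewrite mxE; exact: cvg_coord.
Qed.

Lemma cvg_col_mx m n p (f : I -> 'M[R]_(m, p)) (g : I -> 'M[R]_(n, p))
    (A : 'M[R]_(m, p)) (B : 'M[R]_(n, p)) :
  f @ F --> A -> g @ F --> B -> (fun x => col_mx (f x) (g x)) @ F --> col_mx A B.
Proof.
move=> fA gB; apply: cvg_matrixP => i j; under eq_fun do rewrite mxE; rewrite mxE.
by case: (fintype.split i) => k; exact: cvg_coord.
Qed.

Lemma cvg_det n (f : I -> 'M[R]_n) (A : 'M[R]_n) :
  f @ F --> A -> (fun x => \det (f x)) @ F --> \det A.
Proof.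
move=> fA; rewrite /determinant; apply: cvg_sum => s _; apply: cvgMr.
by apply: cvg_big => [|i _]; [exact: mul_continuous | exact: cvg_coord].
Qed.

(** [invmx] is the adjugate divided by the determinant on invertible matrices, and the identity map
    elsewhere; since the determinants tend to a nonzero number, the formula holds eventually, and it
    is continuous in the entries. *)
Lemma cvg_invmx n (f : I -> 'M[R]_n) (A : 'M[R]_n) :
  A \in unitmx -> f @ F --> A -> (fun x => invmx (f x)) @ F --> invmx A.
Proof.
move=> uA fA; apply: (@cvg_trans _ ((fun x => (\det (f x))^-1 *: \adj (f x)) @ F)).
  apply: near_eq_cvg.
  have : \forall x \near F, \det (f x) != 0.
    have /cvgrPdist_lt := cvg_det fA.
    have d0 : \det A != 0 by rewrite -unitfE -unitmxE.
    move=> /(_ `|\det A|); rewrite normr_gt0 => /(_ d0); apply: filterS => x.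
    by apply: contraTneq => ->; rewrite subr0 ltxx.
  by apply: filterS => x dx; rewrite /invmx unitmxE unitfE dx.
rewrite /invmx uA; apply: cvgZ.
  by apply: cvgV; [rewrite -unitfE -unitmxE | exact: cvg_det].
apply: cvg_matrixP => i j; under eq_fun do rewrite mxE; rewrite mxE.
rewrite /cofactor; apply: cvgMr; apply: cvg_det.
apply: cvg_matrixP => a b; under eq_fun do rewrite !mxE.
by rewrite !mxE; exact: cvg_coord.
Qed.

Lemma cvg_sqnorm k (f : I -> 'cV[R]_k) (l : 'cV[R]_k) :
  f @ F --> l -> (fun x => sqnorm (f x)) @ F --> sqnorm l.
Proof.
move=> fl; apply: cvg_sum => i _.
by under eq_fun do rewrite expr2; rewrite expr2; apply: cvgM; exact: cvg_coord.
Qed.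

End continuity_matrix.

Lemma continuous_measurable_matrix2 (R : realType) m n p q
    (f : 'M[R]_(m, n) -> 'M[R]_(p, q)) : continuous f -> measurable_fun setT f.
Proof.
move=> cf; apply: measurable_matrixP => i j.
apply: (@continuous_measurable_matrix _ _ _ (fun x => f x i j)) => x.
exact: (@cvg_coord _ _ _ _ (nbhs x) _ f (f x) i j (cf x)).
Qed.

(** * Lebesgue measure on column vectors *)

Section cons_measure.
Variables (R : realType) (k : nat).
Local Open Scope ereal_scope.

Definition consV (xv : R * 'cV[R]_k) : 'cV[R]_k.+1 :=
  col_mx (const_mx xv.1 : 'cV[R]_1) xv.2.

Definition unconsV (v : 'cV[R]_k.+1) : R * 'cV[R]_k :=
  (v 0%R 0%R, dsubmx (v : 'cV[R]_(1 + k))).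

Lemma consVK : cancel consV unconsV.
Proof.
move=> [x v]; rewrite /unconsV /consV col_mxKd; congr (_, _).
rewrite -[LHS](_ : usubmx (col_mx (const_mx x : 'cV[R]_1) v) 0%R 0%R = _).
  by rewrite col_mxKu mxE.
by rewrite mxE; congr (col_mx _ _ _ _); apply/val_inj.
Qed.

Lemma unconsVK : cancel unconsV consV.
Proof.
move=> v; rewrite /consV /unconsV /=; set a := const_mx _.
have -> : a = usubmx (v : 'cV[R]_(1 + k)).
  by apply/colP => i; rewrite !mxE ord1; congr (v _ _); exact/val_inj.
exact: (@vsubmxK _ 1 k 1 v).
Qed.

Lemma measurable_consV : measurable_fun setT consV.
Proof.
apply: measurable_matrixP => i j; rewrite /consV.
under eq_fun do rewrite mxE.
case: (fintype.split (i : 'I_(1 + k))) => l; last first.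
  exact: (measurableT_comp (measurable_coord l j)).
by apply: (eq_measurable_fun fst) => // x _; rewrite mxE.
Qed.

Lemma measurable_unconsV : measurable_fun setT unconsV.
Proof.
apply: measurable_fun_pair; first exact: measurable_coord.
apply: measurable_matrixP => i j; under eq_fun do rewrite mxE.
exact: measurable_coord.
Qed.

Variable mu : {sigma_finite_measure set 'cV[R]_k -> \bar R}.

Definition cons_measure : set 'cV[R]_k.+1 -> \bar R :=
  pushforward (@lebesgue_measure R \x mu) consV.

Let measurable_preimage_consV A : measurable A -> measurable (consV @^-1` A).
Proof. by move=> mA; rewrite -[X in measurable X]setTI; apply: measurable_consV. Qed.

Let cons_measure0 : cons_measure set0 = 0.
Proof. by rewrite /cons_measure /pushforward preimage_set0 measure0. Qed.

Let cons_measure_ge0 A : 0 <= cons_measure A.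
Proof. by apply: integral_ge0 => x _; exact: measure_ge0. Qed.

Let cons_measure_sigma_additive : semi_sigma_additive cons_measure.
Proof.
move=> F mF tF mUF; rewrite /cons_measure /pushforward preimage_bigcup.
apply: measure_semi_sigma_additive.
- by move=> n; exact: measurable_preimage_consV.
- apply/trivIsetP => /= i j _ _ ij; rewrite -preimage_setI.
  by move/trivIsetP : tF => /(_ _ _ _ _ ij) ->//; rewrite preimage_set0.
- by rewrite -preimage_bigcup; exact: measurable_preimage_consV.
Qed.

HB.instance Definition _ := isMeasure.Build _ _ _ cons_measure
  cons_measure0 cons_measure_ge0 cons_measure_sigma_additive.

(** Needed at every stage of the recursion that defines [muV], because Fubini's theorem asks for
    sigma-finite factors. Both exhausting sequences increase, so a point that enters them at
    different stages lies in the box of the later stage. *)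
Let cons_measure_sigma_finite : sigma_finite setT cons_measure.
Proof.
have /sigma_finiteP[F [UF ndF Foo]] := sigma_finiteT (@lebesgue_measure R).
have /sigma_finiteP[G [UG ndG Goo]] := sigma_finiteT mu.
exists (fun n => unconsV @^-1` (F n `*` G n)).
  apply/esym; rewrite -subTset => v _.
  have : (\bigcup_n F n) (unconsV v).1 by rewrite -UF.
  have : (\bigcup_n G n) (unconsV v).2 by rewrite -UG.
  move=> [j _ Gj] [i _ Fi]; exists (maxn i j) => //; split.
    by move: (unconsV v).1 Fi; exact/subsetPset/ndF/leq_maxl.
  by move: (unconsV v).2 Gj; exact/subsetPset/ndG/leq_maxr.
move=> n; have [mF Fny] := Foo n; have [mG Gny] := Goo n.
have mFG : measurable (F n `*` G n) by exact: measurableX.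
split.
  by rewrite -[X in measurable X]setTI; exact: measurable_unconsV.
rewrite /cons_measure /pushforward -comp_preimage.
rewrite (_ : unconsV \o consV = id); last by apply/funext => x /=; rewrite consVK.
by rewrite preimage_id product_measure1E// lte_mul_pinfty// ge0_fin_numE.
Qed.

HB.instance Definition _ := Measure_isSigmaFinite.Build _ _ _ cons_measure
  cons_measure_sigma_finite.

End cons_measure.

(** Lebesgue measure on R^k, following the recursion of [iint]; the point mass in dimension 0 makes
    integration there an evaluation, as in [iint]. *)
Fixpoint muV (R : realType) (k : nat) :
    {sigma_finite_measure set 'cV[R]_k -> \bar R} :=
  match k with
  | 0%N => [the {sigma_finite_measure set 'cV[R]_0 -> \bar R} of \d_(0 : 'cV[R]_0)]
  | k'.+1 => [the {sigma_finite_measure set 'cV[R]_k'.+1 -> \bar R} of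
               cons_measure (muV R k')]
  end.

Section integral_muV.
Variables (R : realType).
Local Open Scope ereal_scope.

Lemma ge0_integral_consV k (F : 'cV[R]_k.+1 -> \bar R) :
  measurable_fun setT F -> (forall v, 0 <= F v) ->
  \int[muV R k.+1]_v F v =
  \int[@lebesgue_measure R]_x \int[muV R k]_v F (consV (x, v)).
Proof.
move=> mF F0.
transitivity (\int[@lebesgue_measure R \x muV R k]_xv F (consV xv)).
  by rewrite /= /cons_measure ge0_integral_pushforward//; exact: measurable_consV.
rewrite fubini_tonelli1//.
by apply: measurableT_comp; last exact: measurable_consV.
Qed.

Lemma integral_consV k (F : 'cV[R]_k.+1 -> \bar R) :
  (muV R k.+1).-integrable setT F ->
  (@lebesgue_measure R \x muV R k).-integrable setT (F \o @consV R k).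
Proof.
move=> /integrableP[mF Fy]; apply/integrableP; split.
  by apply: measurableT_comp; last exact: measurable_consV.
apply: le_lt_trans Fy.
rewrite /= /cons_measure ge0_integral_pushforward//; first exact: measurable_consV.
exact: measurableT_comp.
Qed.

Lemma integral_muV0 (F : 'cV[R]_0 -> \bar R) : measurable_fun setT F ->
  \int[muV R 0]_v F v = F 0%R.
Proof. by move=> mF; rewrite /= integral_dirac// diracT mul1e. Qed.

(* The null sets of Fubini's theorem may not be ignored before the iterated
   integral is known to be a measurable function of the parameter. *)
Lemma measurable_iint d (T : measurableType d) k (G : T * 'cV[R]_k -> R) :
  measurable_fun setT G -> measurable_fun setT (fun t => iint (fun v => G (t, v))).
Proof.
elim: k d T G => [|k IH] d T G mG /=.
  by apply: measurableT_comp; last exact: measurable_pair2.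
have mH : measurable_fun setT
    (fun tx : T * R => iint (fun v : 'cV[R]_k => G (tx.1, consV (tx.2, v)))).
  apply: (IH _ _ (fun p => G (p.1.1, consV (p.1.2, p.2)))).
  apply: measurableT_comp => //; apply: measurable_fun_pair.
    by apply: measurableT_comp.
  apply: measurableT_comp; first exact: measurable_consV.
  by apply: measurable_fun_pair => //; apply: measurableT_comp.
apply: measurableT_comp => //.
set H := (fun tx : T * R => _) in mH.
rewrite (_ : (fun t => _) = (fun t =>
  \int[@lebesgue_measure R]_x (EFin \o H)^\+ (t, x) -
  \int[@lebesgue_measure R]_x (EFin \o H)^\- (t, x))); last first.
  apply/funext => t; rewrite integralE.
  by congr (_ - _); apply: eq_integral => x _; rewrite ?funeposE ?funenegE.
apply: emeasurable_funB; apply: measurable_fun_fubini_tonelli_F => //.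
  by apply: measurable_funepos; exact/measurable_EFinP.
by apply: measurable_funeneg; exact/measurable_EFinP.
Qed.

(** Induction through Fubini's theorem. The induction hypothesis applies to almost every slice only,
    so the two functions of the first coordinate agree almost everywhere; [measurable_iint] then
    makes their integrals equal. *)
Lemma iintE k (F : 'cV[R]_k -> R) :
  (muV R k).-integrable setT (EFin \o F) ->
  iint F = fine (\int[muV R k]_v (F v)%:E).
Proof.
elim: k F => [|k IH] F iF.
  by rewrite integral_muV0//; exact: measurable_int iF.
have iG := integral_consV iF.
have mF : measurable_fun setT F by apply/measurable_EFinP; exact: measurable_int iF.
have -> : \int[muV R k.+1]_v (F v)%:E =
    \int[@lebesgue_measure R]_x \int[muV R k]_v (F (consV (x, v)))%:E.
  rewrite [RHS](integral12_prod_meas1 iG).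
  rewrite /= /cons_measure integral_pushforward//.
    exact: measurable_consV.
  by apply/measurable_EFinP.
rewrite /= /Rintegral; congr fine.
apply: ae_eq_integral => //.
- apply/measurable_EFinP.
  apply: (@measurable_iint _ _ _ (fun xv => F (consV xv))).
  by apply: measurableT_comp; last exact: measurable_consV.
- exact: measurable_fubini_F iG.
have := ae_integrable1 iG; apply: filterS => x ix _ /=.
rewrite IH//= fineK//.
exact: integrable_fin_num ix.
Qed.

End integral_muV.

(** * Linear changes of variables *)

Section affine_line.
Variable R : realType.

Lemma preimage_affine_ocitv (a b c d : R) : (a != 0)%R -> (c < d)%R ->
  lebesgue_measure ((fun x => a * x + b) @^-1` `]c, d]%classic) =
  (`|a|^-1 * (d - c))%:E.
Proof.
move=> a0 cd; have [a_gt0|a_lt0|aE] := ltgtP 0%R a; last by rewrite -aE eqxx in a0.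
- rewrite (_ : _ @^-1` _ = `](c - b) / a, (d - b) / a]%classic).
    rewrite lebesgue_measure_itv/= lte_fin ltr_pM2r ?invr_gt0// ltrD2r cd.
    by rewrite -EFinB gtr0_norm//; congr _%:E; field.
  apply/seteqP; split=> x/=; rewrite !in_itv/= ltr_pdivrMr// ler_pdivlMr//;
    by rewrite ltrBlDr lerBrDr mulrC.
- rewrite (_ : _ @^-1` _ = `[(d - b) / a, (c - b) / a[%classic).
    rewrite lebesgue_measure_itv/= lte_fin ltr_nM2r ?invr_lt0// ltrD2r cd.
    by rewrite -EFinB ltr0_norm//; congr _%:E; field.
  apply/seteqP; split=> x/=; rewrite !in_itv/= ltr_ndivlMr// ler_ndivrMr//;
    by rewrite ltrBlDr lerBrDr mulrC andbC.
Qed.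

(** Uniqueness of Lebesgue measure: the image measure under the affine map, multiplied by |a|, gives
    half-open intervals their length. *)
Lemma ge0_integral_affine (a b : R) (f : R -> \bar R) : (a != 0)%R ->
  measurable_fun setT f -> (forall x, (0 <= f x)%E) ->
  (\int[lebesgue_measure]_x f (a * x + b)%R =
  (`|a|^-1)%:E * \int[lebesgue_measure]_x f x)%E.
Proof.
move=> a0 mf f0.
pose phi (x : measurableTypeR R) : measurableTypeR R := (a * x + b)%R.
have mphi : measurable_fun setT phi.
  by apply: measurable_funD => //; exact: measurable_funM.
have na0 : (0 <= `|a|)%R by [].
pose pf : {measure set (measurableTypeR R) -> \bar R} :=
  measure_function_pushforward__canonical__measure_function_Measure
    (@lebesgue_measure R) mphi.
pose nu : {measure set (measurableTypeR R) -> \bar R} := mscale (NngNum na0) pf.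
have nuE A : measurable A -> lebesgue_measure A = nu A.
  apply: lebesgue_measure_unique => _ /ocitvP[->|[[c d]/= cd ->]].
    by rewrite !measure0.
  rewrite /nu/= /mscale/= /pf/= /pushforward preimage_affine_ocitv//.
  rewrite lebesgue_measure_itv/= lte_fin cd -EFinB -EFinM; congr _%:E.
  by rewrite mulrA mulfV ?mul1r// normr_eq0.
rewrite [in RHS](eq_measure_integral nu); last by move=> A mA _; exact: nuE.
rewrite ge0_integral_mscale// muleA -EFinM mulVf ?normr_eq0// mul1e.
by rewrite /pf/= ge0_integral_pushforward.
Qed.

End affine_line.

Section linear_change.
Variable R : realType.

Lemma measurable_mulmx m n p (A : 'M[R]_(m, n)) :
  measurable_fun setT (fun v : 'M[R]_(n, p) => A *m v).
Proof.
apply: continuous_measurable_matrix2 => v.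
by apply: (@cvg_mulmx _ _ (nbhs v) _ _ _ _ (fun=> A) id) => //; exact: cvg_cst.
Qed.

Lemma measurable_addmx m n d (T : measurableType d) (f g : T -> 'M[R]_(m, n)) :
  measurable_fun setT f -> measurable_fun setT g ->
  measurable_fun setT (fun x => (f x + g x)%R).
Proof.
move=> mf mg; apply: measurable_matrixP => i j; under eq_fun do rewrite mxE.
by apply: measurable_funD; apply: (measurableT_comp (measurable_coord i j)).
Qed.

Lemma col_mx_consV k (a : 'cV[R]_1) (v : 'cV[R]_k) (x : R) :
  a 0 0 = x -> (col_mx a v : 'cV[R]_k.+1) = consV (x, v).
Proof.
move=> <-; rewrite /consV/=; suff -> : const_mx (a 0 0) = a by [].
by apply/colP => i; rewrite mxE ord1.
Qed.

Lemma measurable_translation m n (c : 'M[R]_(m, n)) :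
  measurable_fun setT (fun v : 'M[R]_(m, n) => (v + c)%R).
Proof. by apply: measurable_addmx => //; exact: measurable_cst. Qed.

Lemma measurable_slice k (F : 'cV[R]_k.+1 -> \bar R) (x : R) :
  measurable_fun setT F -> measurable_fun setT (fun v => F (consV (x, v))).
Proof.
move=> mF; apply: measurableT_comp => //.
by apply: measurableT_comp; [exact: measurable_consV | exact: measurable_pair1].
Qed.

Lemma ge0_integral_translation k (c : 'cV[R]_k) (F : 'cV[R]_k -> \bar R) :
  measurable_fun setT F -> (forall v, (0 <= F v)%E) ->
  (\int[muV R k]_v F (v + c)%R = \int[muV R k]_v F v)%E.
Proof.
elim: k c F => [|k IH] c F mF F0.
  by apply: eq_integral => v _; congr F; rewrite [RHS]flatmx0 [LHS]flatmx0.
have mFc : measurable_fun setT (fun v : 'cV[R]_k.+1 => F (v + c)).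
  by apply: measurableT_comp => //; exact: measurable_translation.
rewrite (ge0_integral_consV mFc) 1?(ge0_integral_consV mF); try by move=> v; exact: F0.
clear mFc.
rewrite -{1}(unconsVK c); case: (unconsV c) => c0 c'.
transitivity ((\int[lebesgue_measure]_x
    (fun y => \int[muV R k]_v F (consV (y, v))) (1 * x + c0)%R)%E).
  apply: eq_integral => x _ /=; rewrite -[RHS](IH c'); last 2 first.
  - exact: measurable_slice.
  - by move=> v; exact: F0.
  apply: eq_integral => v _; congr F; rewrite /consV/= [LHS](@add_col_mx _ 1 k 1).
  by apply: col_mx_consV; rewrite !mxE mul1r.
rewrite (@ge0_integral_affine _ _ _ (fun y => \int[muV R k]_v F (consV (y, v))))%E ?oner_eq0//.
- by rewrite normr1 invr1 mul1e.
- apply: (@measurable_fun_fubini_tonelli_F _ _ _ _ _ _ (fun xv => F (consV xv))) => //.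
  by apply: measurableT_comp => //; exact: measurable_consV.
- by move=> x; exact: integral_ge0.
Qed.

(** The substitution rule for [A] as a property closed under products, so that it needs checking
    only on the factors of an elimination. *)
Definition scales_muV k (A : 'M[R]_k) := forall F : 'cV[R]_k -> \bar R,
  measurable_fun setT F -> (forall v, (0 <= F v)%E) ->
  (\int[muV R k]_v F (A *m v) = (`|\det A|^-1)%:E * \int[muV R k]_v F v)%E.

Lemma scales_muV_mul k (A B : 'M[R]_k) :
  scales_muV A -> scales_muV B -> scales_muV (A *m B).
Proof.
move=> sA sB F mF F0; under eq_integral do rewrite -mulmxA.
rewrite (sB (fun v => F (A *m v)))//; last first.
  by apply: measurableT_comp => //; exact: measurable_mulmx.
by rewrite sA// muleA -EFinM det_mulmx normrM invfM mulrC.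
Qed.

Lemma scales_muV1 k : scales_muV (1%:M : 'M[R]_k).
Proof.
move=> F mF F0; rewrite det1 normr1 invr1 mul1e.
by apply: eq_integral => v _; rewrite mul1mx.
Qed.

(** With the last [k] coordinates [v] fixed, the first one undergoes an affine map of slope [a];
    Tonelli's theorem allows integrating over it first, before [D] acts on [v]. *)
Lemma scales_muV_ublock k (a : R) (b : 'rV[R]_k) (D : 'M[R]_k) :
  (a != 0)%R -> scales_muV D -> scales_muV (block_mx (a%:M : 'M[R]_1) b 0 D : 'M[R]_(k.+1)).
Proof.
move=> a0 sD F mF F0.
have mFc : measurable_fun setT (fun xv => F (@consV R k xv)).
  by apply: measurableT_comp => //; exact: measurable_consV.
have blockE x v : (block_mx (a%:M : 'M[R]_1) b 0 D : 'M[R]_(k.+1)) *m consV (x, v) =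
    consV (a * x + (b *m v) 0 0, D *m v)%R.
  rewrite /consV/= [LHS](@mul_block_col _ 1 k 1 k) mul0mx add0r.
  by apply: col_mx_consV; rewrite !mxE big_ord1 !mxE mulr1n.
have mblock : measurable_fun setT
    (fun v => F ((block_mx (a%:M : 'M[R]_1) b 0 D : 'M[R]_(k.+1)) *m v)).
  by apply: measurableT_comp => //; exact: measurable_mulmx.
rewrite !ge0_integral_consV//.
have mbc : measurable_fun setT
    (fun xv => F ((block_mx (a%:M : 'M[R]_1) b 0 D : 'M[R]_(k.+1)) *m consV xv)).
  by apply: measurableT_comp mblock _; exact: measurable_consV.
rewrite [LHS](@fubini_tonelli _ _ _ _ _ lebesgue_measure (muV R k) _ mbc)//.
under eq_integral => v _.
  under eq_integral => x _ do rewrite /= blockE.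
  rewrite (@ge0_integral_affine _ _ _ (fun y => F (consV (y, D *m v))))//; last first.
    by apply: measurableT_comp mFc _; exact: measurable_pair2.
  over.
have mG : measurable_fun setT (fun v => \int[lebesgue_measure]_x F (@consV R k (x, v)))%E.
  exact: (@measurable_fun_fubini_tonelli_G _ _ _ _ _ lebesgue_measure
    (fun xv => F (@consV R k xv)) mFc (fun=> F0 _)).
rewrite ge0_integralZl//; last 2 first.
- by apply: measurableT_comp mG _; exact: measurable_mulmx.
- by move=> v _; exact: integral_ge0.
rewrite (sD (fun v => \int[lebesgue_measure]_x F (@consV R k (x, v)))%E)//; last first.
  by move=> v; exact: integral_ge0.
rewrite muleA -EFinM (det_ublock (a%:M : 'M[R]_1)) det_scalar1 normrM invfM; congr (_ * _)%E.
exact/esym/(@fubini_tonelli _ _ _ _ _ lebesgue_measure (muV R k) _ mFc (fun=> F0 _)).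
Qed.

Lemma scales_muV_lblock k (c : 'cV[R]_k) :
  scales_muV (block_mx (1%:M : 'M[R]_1) 0 c 1%:M : 'M[R]_(k.+1)).
Proof.
move=> F mF F0.
rewrite (det_lblock (1%:M : 'M[R]_1)) !det1 mulr1 normr1 invr1 mul1e.
rewrite (ge0_integral_consV mF F0) ge0_integral_consV; last first.
- by move=> v; exact: F0.
- by apply: measurableT_comp mF _; exact: measurable_mulmx.
apply: eq_integral => x _.
rewrite -[RHS](ge0_integral_translation (x *: c)%R); last 2 first.
- exact: measurable_slice.
- by move=> v; exact: F0.
apply: eq_integral => v _; congr F; rewrite /consV/=.
rewrite [LHS](@mul_block_col _ 1 k 1 k) mul0mx !mul1mx addr0 addrC.
by rewrite (_ : c *m _ = x *: c)//; apply/colP => i; rewrite !mxE big_ord1 !mxE mulrC.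
Qed.

(** Gaussian elimination by blocks, by induction on the dimension. *)
Lemma unitmx_scales_muV k (A : 'M[R]_k) : A \in unitmx -> scales_muV A.
Proof.
elim: k A => [|k IH] A uA.
  move=> F mF F0; rewrite det_mx00 normr1 invr1 mul1e.
  by apply: eq_integral => v _; congr F; rewrite [RHS]flatmx0 [LHS]flatmx0.
(* A nonzero corner splits [B] into a unitriangular factor and an upper block factor whose lower
   block is the Schur complement [D'], invertible because the determinant of [B] is [a] times that
   of [D']. *)
have pivot (B : 'M[R]_(1 + k)) : (B : 'M[R]_k.+1) \in unitmx ->
    (ulsubmx B 0 0 != 0)%R -> scales_muV (B : 'M[R]_k.+1).
  move=> uB; set a := ulsubmx B 0 0 => a0.
  set c := dlsubmx B; set b := ursubmx B; set D := drsubmx B.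
  have aE : ulsubmx B = a%:M by rewrite [LHS]mx11_scalar.
  pose D' := (D - a^-1 *: (c *m b))%R.
  have BE : B = block_mx (1%:M : 'M[R]_1) 0 (a^-1 *: c) 1%:M *m block_mx a%:M b 0 D'.
    rewrite -[LHS]submxK aE mulmx_block !mul1mx !mul0mx !addr0.
    rewrite mul_mx_scalar scalerA mulfV// scale1r -/c -/b -/D /D'.
    by rewrite -scalemxAl addrC subrK.
  have uD' : D' \in unitmx.
    move: uB; rewrite !unitmxE !unitfE BE det_mulmx (det_lblock (1%:M : 'M[R]_1)) !det1 mulr1 mul1r.
    by rewrite (det_ublock (a%:M : 'M[R]_1)) mulf_eq0 negb_or => /andP[].
  rewrite BE; apply: scales_muV_mul; first exact: scales_muV_lblock.
  by apply: scales_muV_ublock => //; exact: IH.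
have [a0|] := eqVneq (ulsubmx (A : 'M[R]_(1 + k)) 0 0) 0%R; last exact: pivot.
have [i ci] : exists i, (dlsubmx (A : 'M[R]_(1 + k)) i 0 != 0)%R.
  apply/existsP; apply: contraTT uA; rewrite negb_exists => /forallP c0.
  rewrite unitmxE unitfE negbK -[X in \det X](@submxK _ 1 k 1 k).
  rewrite (_ : dlsubmx _ = 0); last first.
    by apply/colP => j; rewrite [RHS]mxE; have /negPn/eqP := c0 j.
  by rewrite (det_ublock (ulsubmx (A : 'M[R]_(1 + k)))) det_mx11 a0 mul0r.
(* If the corner vanishes, some entry below it does not, as the first column would be zero
   otherwise; [S r] adds that row to the first one, which creates a pivot, and [S (- r)] undoes
   it. *)
pose r : 'rV[R]_k := delta_mx 0 i.
pose S (t : 'rV[R]_k) : 'M[R]_(1 + k) := block_mx (1%:M : 'M[R]_1) t 0 1%:M.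
have SK : S (- r)%R *m (S r *m (A : 'M[R]_(1 + k))) = A.
  rewrite mulmxA mulmx_block !mul1mx !mul0mx !mulmx0 !mulmx1 !addr0 !add0r subrr.
  by rewrite -(@scalar_mx_block _ 1 k 1%R) mul1mx.
rewrite -SK; apply: scales_muV_mul.
  by apply: scales_muV_ublock; [exact: oner_neq0 | exact: scales_muV1].
apply: pivot.
  by rewrite unitmx_mul uA andbT unitmxE (det_ublock (1%:M : 'M[R]_1)) !det1 mulr1 unitr1.
rewrite -[X in S r *m X](@submxK _ 1 k 1 k) mulmx_block block_mxKul mul1mx mxE a0 add0r.
rewrite /r -rowE mxE; exact: ci.
Qed.

Lemma ge0_integral_linear k (A : 'M[R]_k) (c : 'cV[R]_k) (F : 'cV[R]_k -> \bar R) :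
  A \in unitmx -> measurable_fun setT F -> (forall v, (0 <= F v)%E) ->
  (\int[muV R k]_v F (A *m v + c)%R = (`|\det A|^-1)%:E * \int[muV R k]_v F v)%E.
Proof.
move=> uA mF F0; rewrite (unitmx_scales_muV uA (F := fun v => F (v + c)%R))//.
  by rewrite ge0_integral_translation.
by apply: measurableT_comp => //; exact: measurable_translation.
Qed.

End linear_change.

(** * Positive definite matrices *)

Section posdef_matrices.
Variable R : realType.

Lemma sqnormE k (v : 'cV[R]_k) : sqnorm v = (v^T *m v) 0 0.
Proof. by rewrite mxE; apply: eq_bigr => i _; rewrite mxE expr2. Qed.

Lemma sqnorm_ge0 k (v : 'cV[R]_k) : 0 <= sqnorm v.
Proof. by apply: sumr_ge0 => i _; exact: sqr_ge0. Qed.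

Lemma sqnorm_eq0 k (v : 'cV[R]_k) : (sqnorm v == 0) = (v == 0).
Proof.
rewrite psumr_eq0; last by move=> i _; exact: sqr_ge0.
apply/allP/eqP => [v0|-> i _]; last by rewrite mxE expr0n eqxx.
apply/colP => i; apply/eqP; rewrite [X in _ == X]mxE -sqrf_eq0.
exact: (v0 i (mem_index_enum _)).
Qed.

Lemma sqnorm_gt0 k (v : 'cV[R]_k) : v != 0 -> 0 < sqnorm v.
Proof. by move=> v0; rewrite lt_def sqnorm_eq0 v0 sqnorm_ge0. Qed.

Lemma sqnormZ k (a : R) (v : 'cV[R]_k) : sqnorm (a *: v) = a ^+ 2 * sqnorm v.
Proof. by rewrite /sqnorm mulr_sumr; apply: eq_bigr => i _; rewrite mxE exprMn. Qed.

Lemma posdef_unitmx k (A : 'M[R]_k) : posdef A -> A \in unitmx.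
Proof.
move=> [AT Apos]; rewrite unitmxE unitfE; apply/det0P => -[v v0 vA].
have /Apos : v^T != 0 by rewrite -(inj_eq trmx_inj) trmxK trmx0.
by rewrite trmxK vA mul0mx mxE ltxx.
Qed.

Lemma posdef_congruence k (A M : 'M[R]_k) :
  posdef A -> M \in unitmx -> posdef (M^T *m A *m M).
Proof.
move=> [AT Apos] uM; split; first by rewrite !trmx_mul trmxK AT mulmxA.
move=> v v0; have /Apos : M *m v != 0.
  by apply: contra_neq v0 => Mv0; rewrite -(mulKmx uM v) Mv0 mulmx0.
by rewrite trmx_mul !mulmxA.
Qed.

Lemma posdef1 k : posdef (1%:M : 'M[R]_k).
Proof. by split; [rewrite trmx1 | move=> v v0; rewrite mulmx1 -sqnormE sqnorm_gt0]. Qed.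

Lemma posdef_invmx k (A : 'M[R]_k) : posdef A -> posdef (invmx A).
Proof.
move=> pA; have uA := posdef_unitmx pA.
have := @posdef_congruence k A (invmx A) pA.
by rewrite unitmx_inv uA => /(_ isT); rewrite -mulmxA mulmxV// mulmx1 trmx_inv pA.1.
Qed.

Lemma interpolation (F : fieldType) (s : seq F) (f : F -> F) :
  exists p : {poly F}, {in s, forall x, p.[x] = f x}.
Proof.
elim: s => [|a s [p pE]]; first by exists 0.
have [as_|as_] := boolP (a \in s).
  by exists p => x; rewrite inE => /predU1P[->|]; exact: pE.
pose Z := \prod_(y <- s) ('X - y%:P).
have Za : Z.[a] != 0 by rewrite -/(root Z a) root_prod_XsubC.
exists (p + ((f a - p.[a]) / Z.[a]) *: Z) => x.
rewrite inE hornerD hornerZ => /predU1P[->|xs]; first by rewrite divfK// addrC subrK.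
have : root Z x by rewrite root_prod_XsubC.
by move=> /eqP ->; rewrite mulr0 addr0 pE.
Qed.

Lemma horner_mx_sym (F : fieldType) k (A : 'M[F]_k.+1) (p : {poly F}) :
  A^T = A -> (horner_mx A p)^T = horner_mx A p.
Proof.
move=> AT; elim/poly_ind: p => [|p c IH]; first by rewrite rmorph0 trmx0.
rewrite rmorphD rmorphM /= horner_mx_X horner_mx_C linearD /= trmx_mul AT IH.
by rewrite tr_scalar_mx; congr (_ + _); exact/esym/comm_horner_mx.
Qed.

Import complex.
Local Open Scope complex_scope.

(** The spectral theorem is applied over [R[i]], where [A] becomes Hermitian; its eigenvalues are
    real, but the diagonalizing matrix [P] remains complex. *)
Lemma spectral_real_symmetric k (A : 'M[R]_k.+1) : A^T = A ->
  exists (P : 'M[R[i]]_k.+1) (d : 'rV[R]_k.+1), P \in unitmx /\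
    map_mx (real_complex R) A = invmx P *m diag_mx (map_mx (real_complex R) d) *m P.
Proof.
move=> AT; set Ac := map_mx _ A.
have Aherm : Ac \is hermsymmx.
  apply: realsym_hermsym.
    apply/is_hermitianmxP; rewrite expr0 scale1r.
    by apply/matrixP => i j; rewrite !mxE/= -{1}AT mxE.
  by apply/mxOverP => i j; rewrite mxE; apply/complex_realP; eexists.
have /orthomx_spectralP AE := hermitian_normalmx Aherm.
have /mxOverP dreal := hermitian_spectral_diag_real Aherm.
exists (spectralmx Ac), (\row_j Re (spectral_diag Ac 0 j)).
split; first exact: spectral_unit.
suff -> : map_mx (real_complex R) (\row_j Re (spectral_diag Ac 0 j)) = spectral_diag Ac.
  exact: AE.
by apply/rowP => j; rewrite !mxE RRe_real.
Qed.

Lemma posdef_eigenvalue_gt0 k (A : 'M[R]_k) a : posdef A -> eigenvalue A a -> 0 < a.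
Proof.
move=> [_ Apos] /eigenvalueP[v vA v0].
have vT0 : v^T != 0 by rewrite -(inj_eq trmx_inj) trmxK trmx0.
have := Apos _ vT0.
rewrite trmxK vA -scalemxAl mxE -[v in v *m _]trmxK -sqnormE.
by rewrite pmulr_lgt0// sqnorm_gt0.
Qed.

(* The square root is a polynomial in [A], interpolated at the eigenvalues,
   hence it is real although the diagonalization takes place over [R[i]]. *)
Lemma posdef_sqrt_exists k (A : 'M[R]_k) :
  posdef A -> exists S : 'M[R]_k, posdef S /\ S *m S = A.
Proof.
case: k A => [|k] A pA.
  exists 0; split; last by rewrite [LHS]flatmx0 [RHS]flatmx0.
  by split=> [|v]; [rewrite trmx0 | rewrite [v]flatmx0 eqxx].
have [P [d [uP AE]]] := spectral_real_symmetric pA.1.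
(* Row [j] of [P] is a left eigenvector over [R[i]]; that [d 0 j] is a root of the characteristic
   polynomial descends to [R], where positivity of the form decides the sign. *)
have d_gt0 j : 0 < d 0 j.
  apply: (posdef_eigenvalue_gt0 pA); rewrite eigenvalue_root_char.
  rewrite -(fmorph_root (real_complex R)) map_char_poly AE -eigenvalue_root_char.
  apply/eigenvalueP; exists (row j P).
    rewrite rowE !mulmxA mulmxK// -[delta_mx 0 j *m diag_mx _]rowE row_diag_mx.
    by rewrite -scalemxAl mxE.
  apply: contraTneq uP => P0; rewrite unitmxE unitfE negbK; apply/det0P.
  exists (delta_mx 0 j); last by rewrite -rowE.
  by apply/eqP => /rowP/(_ j)/eqP; rewrite !mxE !eqxx oner_eq0.
(* Fourth roots are interpolated rather than square roots: the symmetric matrix [T = p(A)] then has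
   fourth power [A], and the square root [T T = T^T 1 T] is positive definite, being congruent to
   the identity. *)
have [p pE] := interpolation [seq d 0 j | j <- enum 'I_k.+1] (Num.sqrt \o Num.sqrt).
set T := horner_mx A p.
have hornerAE (q : {poly R}) : (forall j, q.[d 0 j] = d 0 j) -> horner_mx A q = A.
  move=> qE; apply: (map_mx_inj (f := real_complex R)).
  have [V uV PV] : exists2 V, V \in unitmx & P = invmx V.
    by exists (invmx P); rewrite ?unitmx_inv ?invmxK.
  rewrite map_horner_mx AE PV invmxK horner_mx_uconj// horner_mx_diag.
  congr (_ *m diag_mx _ *m _); apply/rowP => j; rewrite !mxE.
  by rewrite horner_map/= qE.
have T4 : T *m T *m (T *m T) = A.
  rewrite -[RHS](hornerAE ((p * p) * (p * p))) ?rmorphM// => j.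
  rewrite !hornerM pE; last by apply/mapP; exists j => //; rewrite mem_enum.
  by rewrite /= -!expr2 !sqr_sqrtr// ?sqrtr_ge0// ltW.
have TT : T^T = T by exact: horner_mx_sym pA.1.
have uT : T \in unitmx.
  by have := posdef_unitmx pA; rewrite -T4 !unitmx_mul andbb andbb.
exists (T *m T); split=> //.
by have := posdef_congruence (posdef1 k.+1) uT; rewrite mulmx1 TT.
Qed.

Lemma mxsqrtP k (A : 'M[R]_k) :
  posdef A -> posdef (mxsqrt A) /\ mxsqrt A *m mxsqrt A = A.
Proof. by move=> pA; apply: (@getPex _ [set S | posdef S /\ S *m S = A]); exact: posdef_sqrt_exists. Qed.

Lemma posdef_det_gt0 k (A : 'M[R]_k) : posdef A -> 0 < \det A.
Proof.
move=> pA; have [pS <-] := mxsqrtP pA; rewrite det_mulmx -expr2.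
by rewrite exprn_even_gt0//= -unitfE -unitmxE posdef_unitmx.
Qed.

Lemma sqr_sum_mul_le k (a b : 'I_k -> R) :
  (\sum_i a i * b i) ^+ 2 <= (\sum_i a i ^+ 2) * (\sum_i b i ^+ 2).
Proof.
suff [] : [/\ 0 <= \sum_i a i ^+ 2, 0 <= \sum_i b i ^+ 2 &
  (\sum_i a i * b i) ^+ 2 <= (\sum_i a i ^+ 2) * (\sum_i b i ^+ 2)] by [].
elim/big_rec3 : _ => [|i s B A _ [A0 B0 sAB]]; first by split; rewrite ?expr0n ?mulr0.
split; [by rewrite addr_ge0 ?sqr_ge0 | by rewrite addr_ge0 ?sqr_ge0 |].
set x := a i; set y := b i.
have xB : 0 <= x ^+ 2 * B by rewrite mulr_ge0 ?sqr_ge0.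
have yA : 0 <= y ^+ 2 * A by rewrite mulr_ge0 ?sqr_ge0.
(* The cross term: by [sAB] the square of [x * y * s] is at most the product of [x ^+ 2 * B] and
   [y ^+ 2 * A], and twice a geometric mean is at most the sum. *)
suff : x * y * s *+ 2 <= x ^+ 2 * B + y ^+ 2 * A.
  rewrite sqrrD mulrDl !mulrDr exprMn [A * y ^+ 2]mulrC => xys.
  by rewrite -!addrA lerD2l addrA addrA; apply: lerD.
apply: le_trans (ler_norm _) _; rewrite -[leRHS]ger0_norm ?addr_ge0//.
rewrite -ler_sqr ?nnegrE// -!normrX !ger0_norm ?sqr_ge0//.
rewrite -mulr_natl !exprMn.
apply: (@le_trans _ _ (4 * (x ^+ 2 * B * (y ^+ 2 * A)))).
  have : 0 <= x ^+ 2 * y ^+ 2 * (A * B - s ^+ 2).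
    by apply: mulr_ge0; [rewrite mulr_ge0 ?sqr_ge0 | rewrite subr_ge0].
  by lra.
by have := sqr_ge0 (x ^+ 2 * B - y ^+ 2 * A); set u := _ * B; set v := _ * A; nra.
Qed.

Lemma sqnorm_mulmx_le m k (A : 'M[R]_(m, k)) v :
  sqnorm (A *m v) <= (\sum_i \sum_j A i j ^+ 2) * sqnorm v.
Proof. by rewrite mulr_suml; apply: ler_sum => i _; rewrite mxE; exact: sqr_sum_mul_le. Qed.

(** With [A = S S], the form is the squared norm of [S v], and [v] is recovered from [S v] by
    [invmx S], whose squared Frobenius norm bounds the loss. The added 1 keeps [C] positive in every
    dimension, 0 included. *)
Lemma posdef_coercive k (A : 'M[R]_k) : posdef A ->
  exists2 c : R, 0 < c & forall v, c * sqnorm v <= (v^T *m A *m v) 0 0.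
Proof.
move=> pA; have [pS SS] := mxsqrtP pA; set S := mxsqrt A in pS SS.
set C := 1 + \sum_i \sum_j invmx S i j ^+ 2.
have C0 : 0 < C.
  rewrite ltr_pwDl// sumr_ge0// => i _; rewrite sumr_ge0// => j _; exact: sqr_ge0.
exists C^-1; first by rewrite invr_gt0.
move=> v; rewrite mulrC ler_pdivrMr// mulrC.
have -> : (v^T *m A *m v) 0 0 = sqnorm (S *m v).
  by rewrite sqnormE trmx_mul pS.1 -SS !mulmxA.
have := sqnorm_mulmx_le (invmx S) (S *m v); rewrite mulKmx ?posdef_unitmx//.
by move=> /le_trans; apply; rewrite ler_wpM2r ?sqnorm_ge0// /C lerDr.
Qed.

End posdef_matrices.

(** * Gaussian densities *)

Section fubini_col_mx.
Variable R : realType.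

Lemma measurable_col_mx d (T : measurableType d) m n
    (f : T -> 'cV[R]_m) (g : T -> 'cV[R]_n) :
  measurable_fun setT f -> measurable_fun setT g ->
  measurable_fun setT (fun x => col_mx (f x) (g x)).
Proof.
move=> mf mg; apply: measurable_matrixP => i j; under eq_fun do rewrite mxE.
by case: (fintype.split i) => l; apply: (measurableT_comp (measurable_coord l j)).
Qed.

Lemma measurable_usubmx m n : measurable_fun setT (@usubmx R m n 1).
Proof.
apply: measurable_matrixP => i j; under eq_fun do rewrite mxE.
exact: measurable_coord.
Qed.

Lemma measurable_dsubmx m n : measurable_fun setT (@dsubmx R m n 1).
Proof.
apply: measurable_matrixP => i j; under eq_fun do rewrite mxE.
exact: measurable_coord.
Qed.

Lemma measurable_fun_col_mx m n (F : 'cV[R]_(m + n) -> \bar R) :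
  measurable_fun setT F ->
  measurable_fun setT (fun uv : 'cV[R]_m * 'cV[R]_n => F (col_mx uv.1 uv.2)).
Proof. by move=> mF; apply: measurableT_comp => //; apply: measurable_col_mx. Qed.

Lemma measurable_integral_col_mx m n (F : 'cV[R]_(m + n) -> \bar R) :
  measurable_fun setT F -> (forall v, (0 <= F v)%E) ->
  measurable_fun setT (fun u => \int[muV R n]_v F (col_mx u v))%E.
Proof.
move=> mF F0.
exact: (@measurable_fun_fubini_tonelli_F _ _ _ _ _ (muV R n)
  (fun uv : 'cV[R]_m * 'cV[R]_n => F (col_mx uv.1 uv.2))
  (measurable_fun_col_mx mF) (fun=> F0 _)).
Qed.

Lemma col_mx_consVl m n (x : R) (u : 'cV[R]_m) (v : 'cV[R]_n) :
  col_mx (consV (x, u)) v = consV (x, col_mx u v).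
Proof.
exact: (esym (etrans (@col_mxA _ 1 m n 1 (const_mx x) u v) (castmx_id _ _))).
Qed.

Lemma ge0_integral_col_mx m n (F : 'cV[R]_(m + n) -> \bar R) :
  measurable_fun setT F -> (forall v, (0 <= F v)%E) ->
  (\int[muV R (m + n)]_w F w =
   \int[muV R m]_u \int[muV R n]_v F (col_mx u v))%E.
Proof.
elim: m F => [|m IH] F mF F0.
  rewrite [RHS]integral_muV0; last exact: measurable_integral_col_mx.
  apply: eq_integral => v _; congr F; apply/colP => i.
  by rewrite -[LHS](@col_mxEd _ 0 n 1 0 v); congr (col_mx _ _ _ _); exact: val_inj.
rewrite (@ge0_integral_consV R (m + n))// [RHS]ge0_integral_consV; last first.
- by move=> v; exact: integral_ge0.
- exact: measurable_integral_col_mx.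
apply: eq_integral => x _; rewrite (IH (fun w => F (consV (x, w))))//.
  by apply: eq_integral => u _; apply: eq_integral => v _; rewrite col_mx_consVl.
exact: measurable_slice.
Qed.

End fubini_col_mx.

Section gaussian.
Variables (R : realType) (sigma : R).
Hypothesis sigma0 : 0 < sigma.

(* density of [N(0, sigma^2 M^-1)] *)
Definition gauss_pdf k (M : 'M[R]_k) (y : 'cV[R]_k) : R :=
  (2 * pi * sigma ^+ 2) `^ (- (k%:R / 2)) * Num.sqrt (\det M) *
  expR (- (y^T *m M *m y) 0 0 / (2 * sigma ^+ 2)).

Let c0 : 0 < 2 * pi * sigma ^+ 2.
Proof. by rewrite !mulr_gt0 ?pi_gt0 ?exprn_gt0. Qed.

Lemma gauss_pdf_ge0 k (M : 'M[R]_k) y : 0 <= gauss_pdf M y.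
Proof. by rewrite !mulr_ge0 ?powR_ge0 ?sqrtr_ge0 ?expR_ge0. Qed.

Lemma iso_normal_pdf_ge0 k (m y : 'cV[R]_k) : 0 <= iso_normal_pdf (sigma ^+ 2) m y.
Proof. by rewrite mulr_ge0 ?powR_ge0 ?expR_ge0. Qed.

Lemma iso_normal_pdfE k (y : 'cV[R]_k) :
  iso_normal_pdf (sigma ^+ 2) 0 y = gauss_pdf 1%:M y.
Proof. by rewrite /gauss_pdf det1 sqrtr1 mulr1 mulmx1 -sqnormE /iso_normal_pdf subr0. Qed.

Lemma measurable_quadratic_form k (M : 'M[R]_k) :
  measurable_fun setT (fun y : 'cV[R]_k => (y^T *m M *m y) 0 0).
Proof.
apply: continuous_measurable_matrix => y; apply: (@cvg_coord _ _ _ _ (nbhs y)).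
apply: (@cvg_mulmx _ _ (nbhs y) _ _ _ _ (fun y => y^T *m M) id) => //.
apply: (@cvg_mulmx _ _ (nbhs y) _ _ _ _ (fun y => y^T) (fun=> M)); last exact: cvg_cst.
exact: (@cvg_trmx _ _ (nbhs y) _ _ _ id).
Qed.

Lemma measurable_gauss_pdf k (M : 'M[R]_k) : measurable_fun setT (gauss_pdf M).
Proof.
apply: measurable_funM => //; apply: measurableT_comp => //.
apply: measurable_funM => //; apply: measurableT_comp => //.
exact: measurable_quadratic_form.
Qed.

Lemma measurable_iso_normal_pdf k :
  measurable_fun setT (@iso_normal_pdf R k (sigma ^+ 2) 0).
Proof.
by apply: eq_measurable_fun (measurable_gauss_pdf 1%:M) => y _; rewrite iso_normal_pdfE.
Qed.

Lemma powR_half_natrS k : (2 * pi * sigma ^+ 2) `^ (- (k.+1%:R / 2)) =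
  normal_peak sigma * (2 * pi * sigma ^+ 2) `^ (- (k%:R / 2)).
Proof.
have -> : - (k.+1%:R / 2) = - 2^-1 + - (k%:R / 2) :> R.
  by rewrite -natr1; field.
rewrite powRD; last by apply/implyP => _; rewrite gt_eqF.
rewrite powRN powR12_sqrt ?ltW// /normal_peak.
by have -> : sigma ^+ 2 * pi *+ 2 = 2 * pi * sigma ^+ 2 by rewrite -mulr_natl; ring.
Qed.

Lemma sqnorm_consV k (x : R) (v : 'cV[R]_k) :
  sqnorm (consV (x, v)) = x ^+ 2 + sqnorm v.
Proof.
rewrite /sqnorm big_ord_recl; congr (_ ^+ 2 + _).
  by have /(congr1 fst) := consVK (x, v).
apply: eq_bigr => i _; congr (_ ^+ 2).
have /(congr1 snd)/= /colP/(_ i) <- := consVK (x, v).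
by rewrite [RHS]mxE (_ : rshift 1 i = lift ord0 i)//; exact: val_inj.
Qed.

Lemma integral_iso_normal_pdf k :
  (\int[muV R k]_y (iso_normal_pdf (sigma ^+ 2) 0 y)%:E = 1)%E.
Proof.
have mi n : measurable_fun setT (fun y : 'cV[R]_n => (iso_normal_pdf (sigma ^+ 2) 0 y)%:E).
  by apply/measurable_EFinP; exact: measurable_iso_normal_pdf.
elim: k => [|k IH].
  rewrite integral_muV0// /iso_normal_pdf mul0r oppr0 powRr0 mul1r.
  by rewrite /sqnorm big_ord0 oppr0 mul0r expR0.
rewrite ge0_integral_consV//; last by move=> v; rewrite lee_fin iso_normal_pdf_ge0.
rewrite -(integral_normal_pdf 0 sigma); apply: eq_integral => x _.
transitivity (\int[muV R k]_v
    ((normal_pdf 0 sigma x)%:E * (iso_normal_pdf (sigma ^+ 2) 0 v)%:E))%E.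
  apply: eq_integral => v _; rewrite -EFinM; congr _%:E.
  rewrite normal_pdfE ?gt_eqF// /iso_normal_pdf !subr0 sqnorm_consV powR_half_natrS.
  have -> : expR (- (x ^+ 2 + sqnorm v) / (2 * sigma ^+ 2)) =
      normal_fun 0 sigma x * expR (- sqnorm v / (2 * sigma ^+ 2)).
    rewrite /normal_fun subr0 -expRD; congr expR; rewrite -mulr_natl; field.
    by rewrite gt_eqF.
  by rewrite mulrACA.
rewrite ge0_integralZl_EFin//; first by rewrite IH mule1.
- by move=> v _; rewrite lee_fin iso_normal_pdf_ge0.
- exact: mi.
- exact: normal_pdf_ge0.
Qed.

(** The substitution [y = S^-1 v], where [S S = M], turns the density into [\det S] times the
    isotropic one, and the linear substitution rule produces the same factor. *)
Lemma integral_gauss_pdf k (M : 'M[R]_k) : posdef M ->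
  (\int[muV R k]_y (gauss_pdf M y)%:E = 1)%E.
Proof.
move=> pM; have [pS SS] := mxsqrtP pM; set S := mxsqrt M in pS SS.
have uS := posdef_unitmx pS; have dS := posdef_det_gt0 pS.
have mg : measurable_fun setT (fun y => (gauss_pdf M y)%:E).
  by apply/measurable_EFinP; exact: measurable_gauss_pdf.
have := @unitmx_scales_muV R k (invmx S) _ _ mg.
rewrite unitmx_inv => /(_ uS (fun y => gauss_pdf_ge0 M y)).
rewrite det_inv normfV invrK gtr0_norm//.
have detM : Num.sqrt (\det M) = \det S.
  by rewrite -SS det_mulmx -expr2 sqrtr_sqr gtr0_norm.
under eq_integral => v _.
  rewrite (_ : gauss_pdf M (invmx S *m v) =
               \det S * iso_normal_pdf (sigma ^+ 2) 0 v); last first.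
    have -> : gauss_pdf M (invmx S *m v) = (2 * pi * sigma ^+ 2) `^ (- (k%:R / 2)) *
        \det S * expR (- sqnorm v / (2 * sigma ^+ 2)).
      rewrite /gauss_pdf detM trmx_mul trmx_inv pS.1 -SS !mulmxA mulmxKV//.
      by rewrite mulmxK// sqnormE.
    by rewrite /iso_normal_pdf subr0 [RHS]mulrA [\det S * _]mulrC.
  over.
under eq_integral do rewrite EFinM.
rewrite ge0_integralZl_EFin ?(ltW dS)//; last 2 first.
- by move=> v _; rewrite lee_fin iso_normal_pdf_ge0.
- by apply/measurable_EFinP; exact: measurable_iso_normal_pdf.
rewrite integral_iso_normal_pdf mule1 => dE.
have : ((\det S)^-1%:E * (\det S)%:E = (\det S)^-1%:E *
   ((\det S)%:E * \int[muV R k]_v (gauss_pdf M v)%:E))%E by rewrite -dE.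
by rewrite muleA -!EFinM mulVf ?gt_eqF// mul1e.
Qed.

Lemma mvnormal_pdfE k (M : 'M[R]_k) (t : 'cV[R]_k) : posdef M ->
  mvnormal_pdf (sigma ^+ 2 *: invmx M) t = gauss_pdf M t.
Proof.
move=> pM; have uM := posdef_unitmx pM; have dM := posdef_det_gt0 pM.
have s0 : sigma ^+ 2 != 0 by rewrite expf_neq0// gt_eqF.
rewrite /mvnormal_pdf.
have -> : invmx (sigma ^+ 2 *: invmx M) = (sigma ^+ 2)^-1 *: M.
  by rewrite invmxZ ?unitmxZ ?unitmx_inv ?unitfE// invmxK.
rewrite /gauss_pdf detZ det_inv; congr (_ * expR _); last first.
  by rewrite -scalemxAr -scalemxAl mxE; field; rewrite gt_eqF.
have -> : Num.sqrt ((sigma ^+ 2) ^+ k * (\det M)^-1) = sigma ^+ k / Num.sqrt (\det M).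
  rewrite -exprM mulnC exprM sqrtrM ?sqr_ge0// sqrtr_sqr sqrtrV ?(ltW dM)//.
  by rewrite ger0_norm// exprn_ge0// ltW.
have -> : (2 * pi * sigma ^+ 2) `^ (- (k%:R / 2)) =
    (2 * pi) `^ (- (k%:R / 2)) * (sigma ^+ k)^-1.
  have h1 : 0 <= 2 * pi :> R by rewrite mulr_ge0 ?pi_ge0.
  rewrite (powRM _ h1 (sqr_ge0 _)); congr (_ * _).
  rewrite -powR_mulrn ?ltW// -powRN -[sigma ^+ 2]powR_mulrn ?ltW// -powRrM.
  by congr (_ `^ _); field.
by rewrite invf_div mulrA mulrAC.
Qed.

End gaussian.


(** * Linear images of normal vectors *)

Section gauss_image.
Variables (R : realType) (sigma : R).
Hypothesis sigma0 : 0 < sigma.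

(* Rows spanning the kernel of [W^T] complete [W] to an invertible matrix. *)
Lemma kernel_completion m r (W : 'M[R]_(m, m + r)) : row_free W ->
  exists2 N : 'M[R]_(r, m + r), row_free N & N *m W^T = 0.
Proof.
move=> fW.
have rk : \rank (kermx W^T) = r.
  by rewrite mxrank_ker mxrank_tr; move: fW; rewrite /row_free => /eqP ->; rewrite addKn.
suff : exists2 N : 'M[R]_(\rank (kermx W^T), m + r), row_free N & N *m W^T = 0.
  by rewrite rk.
exists (row_base (kermx W^T)); first exact: row_base_free.
by apply/sub_kermxP; rewrite eq_row_base.
Qed.

Lemma row_free_gram_posdef m n (N : 'M[R]_(m, n)) :
  row_free N -> posdef (N *m N^T).
Proof.
move=> fN; split; first by rewrite trmx_mul trmxK.
move=> v v0; rewrite mulmxA -mulmxA -[v^T *m N]trmxK trmx_mul trmxK -sqnormE.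
apply: sqnorm_gt0; apply: contra_neq v0 => /(congr1 trmx).
rewrite trmx_mul trmxK trmx0 -[0 in RHS](mul0mx _ N) => /(row_free_inj fN).
by move=> /(congr1 trmx); rewrite trmxK trmx0.
Qed.

(** [W] is completed by rows [N] orthogonal to its own, so that [K K^T] is block diagonal and the
    isotropic density factors along [K u = (W u, N u)]; the coordinates [N u] then integrate to 1.
    The conclusion says that [W u] is normal with precision [M / sigma^2]. *)
Lemma ge0_integral_gauss_image m n (W : 'M[R]_(m, n)) (M : 'M[R]_m)
    (H : 'cV[R]_m -> R) :
  posdef M -> W *m W^T = invmx M -> measurable_fun setT H -> (forall y, 0 <= H y) ->
  (\int[muV R n]_u (H (W *m u) * iso_normal_pdf (sigma ^+ 2) 0 u)%:E =
   \int[muV R m]_y (H y * gauss_pdf sigma M y)%:E)%E.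
Proof.
move=> pM WW mH H0; have uM := posdef_unitmx pM.
have fW : row_free W.
  rewrite /row_free eqn_leq rank_leq_row -[X in (X <= _)%N](mxrank_unit (A := W *m W^T)).
    exact: mxrankM_maxl.
  by rewrite WW unitmx_inv.
have [r nE] : exists r, n = (m + r)%N.
  exists (n - m)%N; rewrite subnKC//.
  by move: fW; rewrite /row_free => /eqP <-; exact: rank_leq_col.
subst n.
have [N fN NW] := kernel_completion fW.
have pNN := row_free_gram_posdef fN.
set M2 := invmx (N *m N^T).
have pM2 : posdef M2 by exact: posdef_invmx.
have uNN := posdef_unitmx pNN.
pose K : 'M[R]_(m + r) := col_mx W N.
have KK : K *m K^T = block_mx (invmx M) 0 0 (invmx M2).
  rewrite /K tr_col_mx mul_col_row WW NW invmxK; congr block_mx.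
  by rewrite -[LHS]trmxK trmx_mul trmxK NW trmx0.
have detKK : (\det K) ^+ 2 = (\det M)^-1 * (\det M2)^-1.
  by rewrite expr2 -{2}(det_tr K) -det_mulmx KK det_ublock !det_inv.
have dM := posdef_det_gt0 pM; have dM2 := posdef_det_gt0 pM2.
have dK : `|\det K| = (Num.sqrt (\det M) * Num.sqrt (\det M2))^-1.
  by rewrite -sqrtr_sqr detKK -invfM sqrtrV ?mulr_ge0 ?ltW// sqrtrM// ltW.
have uK : K \in unitmx.
  rewrite unitmxE unitfE -normr_eq0 dK invr_eq0 mulf_neq0//;
    by rewrite gt_eqF// sqrtr_gt0.
have KKinv : invmx (K *m K^T) = block_mx M 0 0 M2.
  apply: (can_inj (mulKmx (_ : K *m K^T \in unitmx))).
    by rewrite unitmx_mul unitmx_tr uK.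
  rewrite mulmxV ?unitmx_mul ?unitmx_tr ?uK// KK mulmx_block.
  rewrite !mulmx0 !mul0mx !addr0 !add0r mulVmx// mulVmx ?(posdef_unitmx pM2)//.
  exact: scalar_mx_block.
(* Chosen so that [F] composed with [K] is the given integrand ([FK]); its factor, the absolute
   determinant of [K], cancels the one produced by the substitution. *)
pose F (w : 'cV[R]_(m + r)) : R := H (usubmx w) * (`|\det K| *
  (gauss_pdf sigma M (usubmx w) * gauss_pdf sigma M2 (dsubmx w))).
have F0 w : 0 <= F w.
  by rewrite /F mulr_ge0// mulr_ge0// mulr_ge0 ?gauss_pdf_ge0.
have mF : measurable_fun setT (EFin \o F).
  apply/measurable_EFinP; apply: measurable_funM.
    by apply: measurableT_comp => //; exact: measurable_usubmx.
  apply: measurable_funM => //; apply: measurable_funM.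
    by apply: measurableT_comp; [exact: measurable_gauss_pdf | exact: measurable_usubmx].
  by apply: measurableT_comp; [exact: measurable_gauss_pdf | exact: measurable_dsubmx].
have FK u : F (K *m u) = H (W *m u) * iso_normal_pdf (sigma ^+ 2) 0 u.
  have Ku : K *m u = col_mx (W *m u) (N *m u) by rewrite mul_col_mx.
  rewrite /F Ku !col_mxKu col_mxKd; congr (_ * _).
  (* [K^T] times the block diagonal matrix is [invmx K], so the two quadratic forms add up to
     [u^T u]. *)
  have Q : ((W *m u)^T *m M *m (W *m u)) 0 0 +
      ((N *m u)^T *m M2 *m (N *m u)) 0 0 = sqnorm u.
    transitivity (((K *m u)^T *m block_mx M 0 0 M2 *m (K *m u)) 0 0).
      rewrite Ku tr_col_mx mul_row_block !mulmx0 addr0 add0r.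
      by rewrite mul_row_col [RHS]mxE.
    have KD : K^T *m block_mx M 0 0 M2 = invmx K.
      rewrite -KKinv -[LHS](mulKmx uK) [X in _ *m X]mulmxA mulmxV ?mulmx1//.
      by rewrite unitmx_mul unitmx_tr uK.
    rewrite trmx_mul -[u^T *m _ *m _]mulmxA KD -mulmxA [invmx K *m _]mulmxA.
    by rewrite mulVmx// mul1mx -sqnormE.
  rewrite /gauss_pdf; set a := expR _; set b := expR _.
  have ab : a * b = expR (- sqnorm u / (2 * sigma ^+ 2)).
    by rewrite /a /b -expRD -Q; congr expR; field; rewrite gt_eqF.
  set pm := _ `^ _; set pr := (2 * _ * _) `^ (- (r%:R / 2)).
  have pp : pm * pr = (2 * pi * sigma ^+ 2) `^ (- ((m + r)%:R / 2)).
    rewrite /pm /pr -powRD; last first.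
      by apply/implyP => _; rewrite gt_eqF// !mulr_gt0 ?pi_gt0 ?exprn_gt0.
    by congr (_ `^ _); rewrite natrD; field.
  rewrite /iso_normal_pdf subr0 -ab -pp dK.
  have s1 : Num.sqrt (\det M) != 0 by rewrite gt_eqF// sqrtr_gt0.
  have s2 : Num.sqrt (\det M2) != 0 by rewrite gt_eqF// sqrtr_gt0.
  by field; rewrite s1 s2.
under eq_integral do rewrite -FK.
rewrite (unitmx_scales_muV uK mF); last by move=> w; rewrite lee_fin.
rewrite (ge0_integral_col_mx mF); last by move=> w; rewrite lee_fin.
have mHg : measurable_fun setT (fun y => H y * gauss_pdf sigma M y).
  by apply: measurable_funM => //; exact: measurable_gauss_pdf.
rewrite -ge0_integralZl_EFin ?invr_ge0//; last 2 first.
- by move=> u _; apply: integral_ge0 => v _; rewrite lee_fin.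
- by apply: measurable_integral_col_mx => // w; rewrite lee_fin.
apply: eq_integral => y _.
transitivity (((`|\det K|)^-1)%:E * \int[muV R r]_z
   ((H y * (`|\det K| * gauss_pdf sigma M y))%:E * (gauss_pdf sigma M2 z)%:E))%E.
  congr (_ * _)%E; apply: eq_integral => z _.
  by rewrite -EFinM /= /F col_mxKu col_mxKd !mulrA.
rewrite ge0_integralZl_EFin ?integral_gauss_pdf//; last 3 first.
- by move=> z _; rewrite lee_fin gauss_pdf_ge0.
- by apply/measurable_EFinP; exact: measurable_gauss_pdf.
- by rewrite mulr_ge0// mulr_ge0 ?gauss_pdf_ge0.
rewrite mule1 -EFinM; congr _%:E; field.
by rewrite normr_eq0 -unitfE -unitmxE.
Qed.

End gauss_image.

(** * Exact law of the averaged estimator *)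

Section signed_integrals.
Context d1 d2 (T1 : measurableType d1) (T2 : measurableType d2) (R : realType).

Lemma funepos_EFinM (T : Type) (H p : T -> R) : (forall x, 0 <= p x) ->
  ((fun x => (H x * p x)%:E)^\+ = (fun x => (Num.max (H x) 0 * p x)%:E))%E.
Proof.
move=> p0; apply/funext => x; rewrite funeposE -EFin_max; congr _%:E.
by rewrite -[X in Num.max _ X](mul0r (p x)) maxr_pMl.
Qed.

Lemma funeneg_EFinM (T : Type) (H p : T -> R) : (forall x, 0 <= p x) ->
  ((fun x => (H x * p x)%:E)^\- = (fun x => (Num.max (- H x) 0 * p x)%:E))%E.
Proof.
move=> p0; apply/funext => x; rewrite funenegE -EFinN -EFin_max; congr _%:E.
by rewrite -[X in Num.max _ X](mul0r (p x)) -mulNr maxr_pMl.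
Qed.

Lemma signed_integral_parts_eq
    (mu : {measure set T1 -> \bar R}) (nu : {measure set T2 -> \bar R})
    (H p : T1 -> R) (G q : T2 -> R) :
  (forall x, 0 <= p x) -> (forall y, 0 <= q y) ->
  (\int[mu]_x (Num.max (H x) 0 * p x)%:E = \int[nu]_y (Num.max (G y) 0 * q y)%:E)%E ->
  (\int[mu]_x (Num.max (- H x) 0 * p x)%:E = \int[nu]_y (Num.max (- G y) 0 * q y)%:E)%E ->
  (\int[mu]_x (H x * p x)%:E = \int[nu]_y (G y * q y)%:E)%E.
Proof.
move=> p0 q0 Ep En; rewrite integralE [RHS]integralE.
by rewrite !funepos_EFinM// !funeneg_EFinM// Ep En.
Qed.

(** Extends an equality of laws from nonnegative test functions to signed ones: the positive and the
    negative parts match separately, be they finite or not. *)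
Lemma signed_integral_eq d (V : measurableType d)
    (mu : {measure set T1 -> \bar R}) (nu : {measure set T2 -> \bar R})
    (S : T1 -> V) (T : T2 -> V) (p : T1 -> R) (q : T2 -> R) :
  (forall x, 0 <= p x) -> (forall y, 0 <= q y) ->
  (forall H : V -> R, measurable_fun setT H -> (forall v, 0 <= H v) ->
    (\int[mu]_x (H (S x) * p x)%:E = \int[nu]_y (H (T y) * q y)%:E)%E) ->
  forall H : V -> R, measurable_fun setT H ->
    (\int[mu]_x (H (S x) * p x)%:E = \int[nu]_y (H (T y) * q y)%:E)%E.
Proof.
move=> p0 q0 E H mH; apply: signed_integral_parts_eq => //.
  apply: (E (fun v => Num.max (H v) 0)); first exact: measurable_maxr.
  by move=> v; rewrite le_max lexx orbT.
apply: (E (fun v => Num.max (- H v) 0)); last by move=> v; rewrite le_max lexx orbT.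
by apply: measurable_maxr => //; exact: measurableT_comp.
Qed.

Lemma bounded_mul_integrable (mu : {measure set T1 -> \bar R}) (H p : T1 -> R) :
  measurable_fun setT H -> (exists M, forall x, `|H x| <= M) ->
  (forall x, 0 <= p x) -> measurable_fun setT p ->
  (\int[mu]_x (p x)%:E < +oo)%E ->
  mu.-integrable setT (fun x => (H x * p x)%:E).
Proof.
move=> mH [M HM] p0 mp py; apply/integrableP; split.
  by apply/measurable_EFinP; exact: measurable_funM.
apply: (@le_lt_trans _ _ (\int[mu]_x ((`|M|)%:E * (p x)%:E))%E).
  apply: ge0_le_integral => //.
  - by apply: measurableT_comp => //; apply/measurable_EFinP; exact: measurable_funM.
  - by apply/measurable_EFinP; exact: measurable_funM.
  - move=> x _; rewrite -EFinM lee_fin normrM (ger0_norm (p0 x)) ler_wpM2r//.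
    exact: le_trans (HM x) (ler_norm M).
rewrite ge0_integralZl_EFin//; last 2 first.
- by move=> x _; rewrite lee_fin.
- exact/measurable_EFinP.
by rewrite lte_mul_pinfty.
Qed.

End signed_integrals.

(** * The averaged error as a function of Gram matrix, drift and unrestricted error *)

Section averaging.
Variables (R : realType) (k1 k2 : nat) (alpha sigma : R).
Implicit Types (A : 'M[R]_(k1 + k2)) (b eta : 'cV[R]_k2) (y : 'cV[R]_(k1 + k2)).

Definition schur A : 'M[R]_k2 :=
  drsubmx A - dlsubmx A *m invmx (ulsubmx A) *m ursubmx A.

(** The matrix [Binf] of the theorem, for an arbitrary Gram matrix: applied to the second block of
    the unrestricted estimate, it gives the change caused by the restriction
    ([beta_restricted_sub]). *)
Definition restriction_mx A : 'M[R]_(k1 + k2, k2) :=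
  col_mx (invmx (ulsubmx A) *m ursubmx A) (- 1%:M).

(** [lambda_hat] in terms of [eta], which stands for [sqrt n] times the second block of [betaU]: the
    squared distance of the two fits is the form of the Schur complement at [eta], by
    [restriction_form]. *)
Definition weight A eta : R := (1 + expR (- (2 * alpha * k2%:R)) *
  expR (alpha * (eta^T *m schur A *m eta) 0 0 / sigma ^+ 2))^-1.

(* [y] is the scaled estimation error of the unrestricted estimator; with
   [b = sqrt n * beta_2], [averaged A b y] is that of the averaged one. *)
Definition averaged A b y : 'cV[R]_(k1 + k2) :=
  y + weight A (dsubmx y + b) *: (restriction_mx A *m (dsubmx y + b)).

Lemma posdef_ulsubmx A : posdef A -> posdef (ulsubmx A).
Proof.
move=> [AT Apos]; split; first by rewrite trmx_ulsub AT.
move=> v v0; have /Apos : col_mx v (0 : 'cV[R]_k2) != 0 by rewrite col_mx_eq0 (negbTE v0).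
rewrite -{1}[A]submxK tr_col_mx mul_row_block trmx0 !mul0mx !addr0.
by rewrite mul_row_col mulmx0 addr0.
Qed.

Lemma mulmx_restriction A : ulsubmx A \in unitmx ->
  A *m restriction_mx A = col_mx 0 (- schur A).
Proof.
move=> uA; rewrite -{1}[A]submxK mul_block_col !mulmxN !mulmx1 mulKVmx// subrr.
by rewrite mulmxA /schur opprB.
Qed.

Lemma restriction_form A : A^T = A -> ulsubmx A \in unitmx ->
  (restriction_mx A)^T *m A *m restriction_mx A = schur A.
Proof.
move=> AT uA; rewrite -mulmxA mulmx_restriction// tr_col_mx mul_row_col mulmx0 add0r.
have -> : (- 1%:M)^T = - 1%:M :> 'M[R]_k2 by rewrite linearN /= trmx1.
by rewrite mulNmx mul1mx opprK.
Qed.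

(** By [restriction_form] the Schur complement is the form of [A] pulled back along
    [restriction_mx A], which is injective because of its block [- 1%:M]. *)
Lemma posdef_schur A : posdef A -> posdef (schur A).
Proof.
move=> pA; have uA := posdef_unitmx (posdef_ulsubmx pA).
have BAB := restriction_form pA.1 uA.
split; first by rewrite -BAB !trmx_mul trmxK pA.1 mulmxA.
move=> v v0; rewrite -BAB.
have : restriction_mx A *m v != 0.
  by rewrite mul_col_mx col_mx_eq0 mulNmx mul1mx oppr_eq0 (negbTE v0) andbF.
by move=> /pA.2; rewrite trmx_mul !mulmxA.
Qed.

Lemma weight_ge0 A eta : 0 <= weight A eta.
Proof. by rewrite invr_ge0 addr_ge0// mulr_ge0 ?expR_ge0. Qed.

Section limits.
Context (I : Type) (F : set_system I) {FF : Filter F}.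

Lemma cvg_ulsubmx (f : I -> 'M[R]_(k1 + k2)) A :
  f @ F --> A -> (fun x => ulsubmx (f x)) @ F --> ulsubmx A.
Proof.
move=> fA; apply: cvg_matrixP => i j; under eq_fun do rewrite !mxE.
by rewrite !mxE; exact: cvg_coord.
Qed.

Lemma cvg_ursubmx (f : I -> 'M[R]_(k1 + k2)) A :
  f @ F --> A -> (fun x => ursubmx (f x)) @ F --> ursubmx A.
Proof.
move=> fA; apply: cvg_matrixP => i j; under eq_fun do rewrite !mxE.
by rewrite !mxE; exact: cvg_coord.
Qed.

Lemma cvg_dlsubmx (f : I -> 'M[R]_(k1 + k2)) A :
  f @ F --> A -> (fun x => dlsubmx (f x)) @ F --> dlsubmx A.
Proof.
move=> fA; apply: cvg_matrixP => i j; under eq_fun do rewrite !mxE.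
by rewrite !mxE; exact: cvg_coord.
Qed.

Lemma cvg_drsubmx (f : I -> 'M[R]_(k1 + k2)) A :
  f @ F --> A -> (fun x => drsubmx (f x)) @ F --> drsubmx A.
Proof.
move=> fA; apply: cvg_matrixP => i j; under eq_fun do rewrite !mxE.
by rewrite !mxE; exact: cvg_coord.
Qed.

Lemma cvg_schur (f : I -> 'M[R]_(k1 + k2)) A : ulsubmx A \in unitmx ->
  f @ F --> A -> (fun x => schur (f x)) @ F --> schur A.
Proof.
move=> uA fA; apply: cvgB; first exact: cvg_drsubmx.
apply: cvg_mulmx; last exact: cvg_ursubmx.
apply: cvg_mulmx; first exact: cvg_dlsubmx.
by apply: cvg_invmx => //; exact: cvg_ulsubmx.
Qed.

Lemma cvg_restriction (f : I -> 'M[R]_(k1 + k2)) A : ulsubmx A \in unitmx ->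
  f @ F --> A -> (fun x => restriction_mx (f x)) @ F --> restriction_mx A.
Proof.
move=> uA fA; apply: cvg_col_mx; last exact: cvg_cst.
apply: cvg_mulmx; last exact: cvg_ursubmx.
by apply: cvg_invmx => //; exact: cvg_ulsubmx.
Qed.

Lemma cvg_quadratic_form k (f : I -> 'M[R]_k) (g : I -> 'cV[R]_k) (A : 'M[R]_k)
    (v : 'cV[R]_k) : f @ F --> A -> g @ F --> v ->
  (fun x => ((g x)^T *m f x *m g x) 0 0) @ F --> (v^T *m A *m v) 0 0.
Proof.
move=> fA gv; apply: cvg_coord; apply: cvg_mulmx => //.
by apply: cvg_mulmx => //; exact: cvg_trmx.
Qed.

Lemma cvg_averaged (f : I -> 'M[R]_(k1 + k2)) (g : I -> 'cV[R]_k2)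
    (z : I -> 'cV[R]_(k1 + k2)) A b y : ulsubmx A \in unitmx ->
  f @ F --> A -> g @ F --> b -> z @ F --> y ->
  (fun x => averaged (f x) (g x) (z x)) @ F --> averaged A b y.
Proof.
move=> uA fA gb zy.
have eb : (fun x => dsubmx (z x) + g x) @ F --> dsubmx y + b.
  by apply: cvgD => //; exact: cvg_dsubmx.
apply: cvgD => //; apply: cvgZ; last by apply: cvg_mulmx => //; exact: cvg_restriction.
apply: cvgV; first by rewrite gt_eqF// ltr_wpDr ?mulr_ge0 ?expR_ge0.
apply: cvgD; first exact: cvg_cst.
apply: cvgMr; apply: continuous_cvg; first exact: continuous_expR.
apply: cvgMl; apply: cvgMr.
by apply: cvg_quadratic_form => //; exact: cvg_schur.
Qed.

End limits.

Lemma measurable_averaged A b : ulsubmx A \in unitmx ->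
  measurable_fun setT (averaged A b).
Proof.
move=> uA; apply: continuous_measurable_matrix2 => y.
by apply: (@cvg_averaged _ (nbhs y) _ (fun=> A) (fun=> b) id) => //; exact: cvg_cst.
Qed.

End averaging.

Section law.
Variables (R : realType) (k1 k2 n : nat) (alpha sigma : R).
Hypotheses (sigma0 : 0 < sigma) (k_gt0 : (0 < k1 + k2)%N).
Variables (X : 'M[R]_(n, k1 + k2)) (beta : 'cV[R]_(k1 + k2)).
Hypothesis Xrank : \rank X = (k1 + k2)%N.

Let A0 := X^T *m X.

Definition gram : 'M[R]_(k1 + k2) := n%:R^-1 *: A0.

Let n_gt0 : 0 < n%:R :> R.
Proof. by rewrite ltr0n (leq_trans k_gt0)// -Xrank rank_leq_row. Qed.

Let pA0 : posdef A0.
Proof.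
have := @row_free_gram_posdef R _ _ X^T; rewrite trmxK; apply.
by rewrite /row_free mxrank_tr Xrank.
Qed.

Lemma posdefZ k (c : R) (A : 'M[R]_k) : 0 < c -> posdef A -> posdef (c *: A).
Proof.
move=> c0 [AT Apos]; split; first by rewrite linearZ /= AT.
move=> v /Apos Av; have -> : v^T *m (c *: A) *m v = c *: (v^T *m A *m v).
  by rewrite -scalemxAr -scalemxAl.
by rewrite [X in _ < X]mxE mulr_gt0.
Qed.

Lemma posdef_gram : posdef gram.
Proof. by apply: posdefZ => //; rewrite invr_gt0. Qed.

Let W := Num.sqrt n%:R *: (invmx A0 *m X^T).

Let sq : Num.sqrt n%:R * Num.sqrt n%:R = n%:R :> R.
Proof. by rewrite -expr2 sqr_sqrtr// ltW. Qed.

Let WW : W *m W^T = invmx gram.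
Proof.
have uA0 := posdef_unitmx pA0.
rewrite /W linearZ /= -scalemxAl -scalemxAr scalerA sq.
rewrite trmx_mul trmxK trmx_inv pA0.1 mulmxA -[invmx A0 *m X^T *m X]mulmxA.
rewrite mulVmx// mul1mx invmxZ ?invrK//.
by rewrite unitmxZ ?unitfE ?invr_eq0 ?gt_eqF.
Qed.

Let u11 : ulsubmx A0 \in unitmx.
Proof. exact/posdef_unitmx/posdef_ulsubmx. Qed.

Let restriction_gram : restriction_mx gram = restriction_mx A0.
Proof.
rewrite /restriction_mx /gram; congr col_mx.
have -> : ulsubmx (n%:R^-1 *: A0) = n%:R^-1 *: ulsubmx A0.
  by apply/matrixP => i j; rewrite !mxE.
have -> : ursubmx (n%:R^-1 *: A0) = n%:R^-1 *: ursubmx A0.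
  by apply/matrixP => i j; rewrite !mxE.
rewrite invmxZ ?unitmxZ ?unitfE ?invr_eq0 ?gt_eqF// invrK.
by rewrite -scalemxAl -scalemxAr scalerA mulfV ?gt_eqF// scale1r.
Qed.

(** The unrestricted normal equations say that [X^T Y] is [A0] times [betaU]; the first block of
    this vector is the right-hand side of the restricted normal equations, which are solved by
    inverting the upper left block. *)
Lemma beta_restricted_sub Y :
  betaR X Y - betaU X Y = restriction_mx A0 *m dsubmx (betaU X Y).
Proof.
have uA0 := posdef_unitmx pA0.
have XY : X^T *m Y = A0 *m betaU X Y by rewrite /betaU -mulmxA mulKVmx.
have X1X1 : (X1 X)^T *m X1 X = ulsubmx A0.
  rewrite /X1 /A0 -{3 4}[X]hsubmxK tr_row_mx mul_col_row.
  by rewrite block_mxKul.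
have X1Y : (X1 X)^T *m Y = usubmx (X^T *m Y).
  by rewrite -{2}[X]hsubmxK tr_row_mx mul_col_mx col_mxKu.
rewrite /betaR X1X1 -mulmxA X1Y XY.
rewrite -{1 2}[betaU X Y]vsubmxK -{2}[A0]submxK mul_block_col col_mxKu mulmxDr mulKmx//.
rewrite opp_col_mx add_col_mx /restriction_mx mul_col_mx mulNmx mul1mx add0r.
by rewrite addrC addKr mulmxA.
Qed.

(** The averaged estimator is [betaU] plus [lambda_hat] times [betaR - betaU]. The second block of
    [sqrt n *: betaU] is that of the scaled error shifted by the drift, whence the argument of
    [weight] in [averaged]. *)
Lemma beta_tildeE Y : Num.sqrt n%:R *: (beta_tilde alpha sigma X Y - beta) =
  averaged alpha sigma gram (Num.sqrt n%:R *: dsubmx beta) (W *m (Y - X *m beta)).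
Proof.
have uA0 := posdef_unitmx pA0.
have WY : W *m (Y - X *m beta) = Num.sqrt n%:R *: (betaU X Y - beta).
  rewrite /W -scalemxAl mulmxBr; congr (_ *: (_ - _)).
  by rewrite mulmxA -[_ *m X^T *m X]mulmxA mulVmx// mul1mx.
have eta : dsubmx (W *m (Y - X *m beta)) + Num.sqrt n%:R *: dsubmx beta =
    Num.sqrt n%:R *: dsubmx (betaU X Y).
  by rewrite WY linearZ /= linearB /= -scalerDr subrK.
rewrite /averaged eta restriction_gram -scalemxAr -beta_restricted_sub.
have -> : weight alpha sigma gram (Num.sqrt n%:R *: dsubmx (betaU X Y)) =
    lambda_hat alpha sigma X Y.
  rewrite /weight /lambda_hat; set v := dsubmx _.
  suff -> : ((Num.sqrt n%:R *: v)^T *m schur gram *m (Num.sqrt n%:R *: v)) 0 0 =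
      sqnorm (X *m betaR X Y - X *m betaU X Y) by [].
  rewrite -mulmxBr beta_restricted_sub -/v sqnormE.
  rewrite -(restriction_form posdef_gram.1) ?restriction_gram; last first.
    exact: (posdef_unitmx (posdef_ulsubmx posdef_gram)).
  set B := restriction_mx A0.
  have -> : (Num.sqrt n%:R *: v)^T *m (B^T *m gram *m B) *m (Num.sqrt n%:R *: v) =
      v^T *m (B^T *m A0 *m B) *m v.
    have q (T : 'M[R]_k2) : (Num.sqrt n%:R *: v)^T *m T *m (Num.sqrt n%:R *: v) =
        n%:R *: (v^T *m T *m v).
      by rewrite -scalemxAr linearZ /= -!scalemxAl scalerA sq.
    rewrite q /gram -scalemxAr -!scalemxAl -scalemxAr -scalemxAl scalerA.
    by rewrite mulfV ?gt_eqF// scale1r.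
  by rewrite /A0 !trmx_mul !mulmxA.
rewrite WY scalerA mulrC -scalerA -scalerDr; congr (_ *: _).
rewrite /beta_tilde scalerBl scale1r scalerBr.
have arrange (a b c d : 'cV[R]_(k1 + k2)) : a + (b - c) - d = b - d + (a - c).
  by apply/matrixP => i j; rewrite !mxE; ring.
exact: arrange.
Qed.

(** Moves the expectation from the sample space, whose dimension grows with [n], to the fixed
    parameter space, where dominated convergence can operate. *)
Lemma law_statE f : continuous f -> (exists M, forall x, `|f x| <= M) ->
  law_stat alpha sigma X beta f =
  fine (\int[muV R (k1 + k2)]_y
    (f (averaged alpha sigma gram (Num.sqrt n%:R *: dsubmx beta) y) *
     gauss_pdf sigma gram y)%:E).
Proof.
move=> cf [M fM]; set b := _ *: dsubmx beta.
pose H (y : 'cV[R]_(k1 + k2)) : R := f (averaged alpha sigma gram b y).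
have mH : measurable_fun setT H.
  apply: measurableT_comp; first exact: continuous_measurable_matrix.
  exact: (measurable_averaged _ _ _ (posdef_unitmx (posdef_ulsubmx posdef_gram))).
have isoE Y : iso_normal_pdf (sigma ^+ 2) (X *m beta) Y =
    iso_normal_pdf (sigma ^+ 2) 0 (Y - X *m beta).
  by rewrite /iso_normal_pdf subr0.
have mT : measurable_fun setT (fun Y : 'cV[R]_n => Y - X *m beta).
  exact: measurable_translation.
have mW : measurable_fun setT (fun Y : 'cV[R]_n => W *m (Y - X *m beta)).
  by apply: measurableT_comp => //; exact: measurable_mulmx.
have mi : measurable_fun setT (fun Y : 'cV[R]_n => iso_normal_pdf (sigma ^+ 2) 0 (Y - X *m beta)).
  by apply: measurableT_comp => //; exact: measurable_iso_normal_pdf.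
have E (G : 'cV[R]_(k1 + k2) -> R) : measurable_fun setT G -> (forall v, 0 <= G v) ->
    (\int[muV R n]_Y (G (W *m (Y - X *m beta)) *
       iso_normal_pdf (sigma ^+ 2) 0 (Y - X *m beta))%:E =
     \int[muV R (k1 + k2)]_y (G y * gauss_pdf sigma gram y)%:E)%E.
  move=> mG G0; rewrite -(ge0_integral_gauss_image sigma0 posdef_gram WW mG G0).
  apply: (ge0_integral_translation (- (X *m beta)) (F := fun u =>
    (G (W *m u) * iso_normal_pdf (sigma ^+ 2) 0 u)%:E)).
    apply/measurable_EFinP; apply: measurable_funM; last exact: measurable_iso_normal_pdf.
    by apply: measurableT_comp => //; exact: measurable_mulmx.
  by move=> v; rewrite lee_fin mulr_ge0// iso_normal_pdf_ge0.
rewrite /law_stat; under [X in iint X]eq_fun => Y do rewrite beta_tildeE isoE.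
rewrite iintE.
  congr fine; apply: (@signed_integral_eq _ _ _ _ R _ _ (muV R n) (muV R (k1 + k2))
    (fun Y => W *m (Y - X *m beta)) id
    (fun Y => iso_normal_pdf (sigma ^+ 2) 0 (Y - X *m beta)) (gauss_pdf sigma gram)
    _ _ E H mH).
    by move=> Y; exact: iso_normal_pdf_ge0.
  by move=> y; exact: gauss_pdf_ge0.
apply: (@bounded_mul_integrable _ _ R (muV R n) (fun Y => H (W *m (Y - X *m beta)))
  (fun Y => iso_normal_pdf (sigma ^+ 2) 0 (Y - X *m beta))) => //.
- exact: measurableT_comp.
- by exists M => Y; exact: fM.
- by move=> Y; exact: iso_normal_pdf_ge0.
rewrite (ge0_integral_translation (- (X *m beta)) (F := fun u =>
    (iso_normal_pdf (sigma ^+ 2) 0 u)%:E)).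
- by rewrite integral_iso_normal_pdf// ltry.
- by apply/measurable_EFinP; exact: measurable_iso_normal_pdf.
- by move=> v; rewrite lee_fin iso_normal_pdf_ge0.
Qed.

End law.

(** * Dominated convergence of the laws *)

Lemma cvg_sqr (R : realType) (I : Type) (F : set_system I) {FF : Filter F}
    (f : I -> R) (l : R) : f @ F --> l -> (fun x => f x ^+ 2) @ F --> l ^+ 2.
Proof. by move=> fl; under eq_fun do rewrite expr2; rewrite expr2; exact: cvgM. Qed.

Section asymptotics.
Variables (R : realType) (sigma : R).
Hypothesis sigma0 : 0 < sigma.

(** The Frobenius norm of [A_ n - A] bounds the change of the form, and eventually costs at most
    half of the coercivity constant of [A]. *)
Lemma near_coercive k (A_ : nat -> 'M[R]_k) (A : 'M[R]_k) :
  posdef A -> A_ @ \oo --> A ->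
  exists2 c : R, 0 < c &
    \forall n \near \oo, forall v, c * sqnorm v <= (v^T *m A_ n *m v) 0 0.
Proof.
move=> pA A_A; have [c c0 cA] := posdef_coercive pA.
exists (c / 2); first by rewrite divr_gt0.
pose D n := \sum_i \sum_j (A_ n - A) i j ^+ 2.
have D0 : D @ \oo --> 0.
  rewrite [X in _ --> X](_ : 0 = \sum_(i < k) \sum_(j < k) (A - A) i j ^+ 2).
    apply: cvg_sum => i _; apply: cvg_sum => j _.
    apply: cvg_sqr; apply: (cvg_coord (f := fun n => A_ n - A)).
    by apply: cvgB => //; exact: cvg_cst.
  by rewrite big1// => i _; rewrite big1// => j _; rewrite subrr mxE expr0n.
have c2 : 0 < (c / 2) ^+ 2 by rewrite exprn_gt0// divr_gt0.
move/cvgrPdist_le : D0 => /(_ _ c2); apply: filterS => n; rewrite sub0r normrN => Dn v.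
have H : (v^T *m (A_ n - A) *m v) 0 0 ^+ 2 <= (c / 2 * sqnorm v) ^+ 2.
  rewrite -mulmxA mxE; under eq_bigr do rewrite mxE.
  apply: (le_trans (sqr_sum_mul_le _ _)); rewrite -/(sqnorm v) -/(sqnorm (_ *m v)).
  rewrite exprMn [leRHS]mulrC expr2 -mulrA ler_wpM2l ?sqnorm_ge0// mulrC.
  apply: (le_trans (sqnorm_mulmx_le _ _)); rewrite ler_wpM2r ?sqnorm_ge0//.
  exact: le_trans (ler_norm _) Dn.
have : `|(v^T *m (A_ n - A) *m v) 0 0| <= c / 2 * sqnorm v.
  rewrite -[leRHS]ger0_norm ?mulr_ge0 ?sqnorm_ge0 ?divr_ge0 ?(ltW c0)//.
  by rewrite -ler_sqr ?nnegrE// !real_normK ?num_real.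
rewrite mulmxBr mulmxBl mxE [X in _ + X]mxE ler_norml => /andP[].
by have := cA v; set x := (v^T *m A *m v) 0 0; set y := (v^T *m _ *m v) 0 0; lra.
Qed.

(** [B] is the multiple [c] of the identity given by uniform coercivity, which controls the
    exponents; [K] exchanges the normalizing factor of [B] for a bound on those of the [A_ n], whose
    determinants are eventually at most [\det A + 1]. *)
Lemma gauss_pdf_near_dominated k (A_ : nat -> 'M[R]_k) (A : 'M[R]_k) :
  posdef A -> A_ @ \oo --> A ->
  exists (B : 'M[R]_k) (K : R), [/\ posdef B, 0 <= K &
    \forall n \near \oo, forall y, gauss_pdf sigma (A_ n) y <= K * gauss_pdf sigma B y].
Proof.
move=> pA A_A; have [c c0 cA] := near_coercive pA A_A.
have pB : posdef (c *: 1%:M : 'M[R]_k) by apply: posdefZ => //; exact: posdef1.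
set B := c *: 1%:M in pB *; have dB := posdef_det_gt0 pB.
exists B, (Num.sqrt (\det A + 1) / Num.sqrt (\det B)); split=> //.
have dA : \forall n \near \oo, \det (A_ n) <= \det A + 1.
  have detA : (fun n => \det (A_ n)) @ \oo --> \det A by exact: cvg_det.
  move/cvgrPdist_le : detA => /(_ 1 ltr01); apply: filterS => n.
  by rewrite ler_norml; lra.
near=> n => y; rewrite /gauss_pdf.
rewrite [leRHS](_ : _ = (2 * pi * sigma ^+ 2) `^ (- (k%:R / 2)) *
    Num.sqrt (\det A + 1) * expR (- (y^T *m B *m y) 0 0 / (2 * sigma ^+ 2))); last first.
  by field; rewrite gt_eqF// sqrtr_gt0.
apply: ler_pM; rewrite ?mulr_ge0 ?powR_ge0 ?expR_ge0//.
  by rewrite ler_wpM2l ?powR_ge0// ler_wsqrtr//; near: n.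
rewrite ler_expR ler_pM2r ?invr_gt0 ?mulr_gt0 ?exprn_gt0// lerN2.
have -> : (y^T *m B *m y) 0 0 = c * sqnorm y.
  by rewrite /B -scalemxAr mulmx1 -scalemxAl mxE sqnormE.
by move: y; near: n.
Unshelve. all: end_near.
Qed.

Lemma cvg_integral_gauss_pdf k (A_ : nat -> 'M[R]_k) (A : 'M[R]_k)
    (g_ : nat -> 'cV[R]_k -> R) (g : 'cV[R]_k -> R) (M : R) :
  posdef A -> A_ @ \oo --> A ->
  (\forall n \near \oo, measurable_fun setT (g_ n)) ->
  (forall n y, `|g_ n y| <= M) -> (forall y, `|g y| <= M) ->
  (forall y, (fun n => g_ n y) @ \oo --> g y) ->
  (fun n => fine (\int[muV R k]_y (g_ n y * gauss_pdf sigma (A_ n) y)%:E)) @ \oo -->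
  fine (\int[muV R k]_y (g y * gauss_pdf sigma A y)%:E).
Proof.
move=> pA A_A mg g_M gM g_g.
have [B [K [pB K0 dom]]] := gauss_pdf_near_dominated pA A_A.
have [N _ HN] : \forall n \near \oo, measurable_fun setT (g_ n) /\
    forall y, gauss_pdf sigma (A_ n) y <= K * gauss_pdf sigma B y.
  by near=> n; split; near: n.
have M0 : 0 <= M by apply: le_trans (gM 0).
have mB : measurable_fun setT (gauss_pdf sigma B) by exact: measurable_gauss_pdf.
have gp_cvg y : (fun n => gauss_pdf sigma (A_ n) y) @ \oo --> gauss_pdf sigma A y.
  apply: cvgM.
    apply: cvgMr; apply: continuous_cvg; first exact: sqrt_continuous.
    exact: cvg_det.
  apply: continuous_cvg; first exact: continuous_expR.
  apply: cvgMl; apply: cvgN.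
  by apply: cvg_quadratic_form => //; exact: cvg_cst.
(* Domination and measurability hold from the index [N] on, whereas the dominated convergence
   theorem wants them for all indices; hence the shift. *)
set u := (fun n => fine _); rewrite -(cvg_shiftn N u) /u.
apply: fine_cvg; rewrite fineK; last first.
  apply: integrable_fin_num => //.
  apply: (bounded_mul_integrable (H := g)).
  - have gN y : (fun n => g_ (n + N)%N y) @ \oo --> g y.
      by rewrite (cvg_shiftn N (fun n => g_ n y)); exact: g_g.
    apply: (@measurable_fun_cvg _ _ _ _ (fun n => g_ (n + N)%N)) => // n.
    by have [] := HN (n + N)%N (leq_addl _ _).
  - by exists M.
  - by move=> y; exact: gauss_pdf_ge0.
  - exact: measurable_gauss_pdf.
  - by rewrite integral_gauss_pdf// ltry.
apply: (@dominated_cvg _ _ _ (muV R k) setT measurableT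
  (fun n y => (g_ (n + N)%N y * gauss_pdf sigma (A_ (n + N)%N) y)%:E) _
  (fun y => (M * K * gauss_pdf sigma B y)%:E)).
- move=> n; apply/measurable_EFinP; apply: measurable_funM.
    by have [] := HN (n + N)%N (leq_addl _ _).
  exact: measurable_gauss_pdf.
- move=> y _; apply: cvg_EFin; first by near=> n.
  rewrite (cvg_shiftn N (fun n => g_ n y * gauss_pdf sigma (A_ n) y)).
  by apply: cvgM; [exact: g_g | exact: gp_cvg].
- by [].
- apply: (bounded_mul_integrable (H := fun=> M * K)) => //.
  + by exists `|M * K|.
  + by move=> y; exact: gauss_pdf_ge0.
  + by rewrite integral_gauss_pdf// ltry.
- move=> n y _; rewrite lee_fin normrM (ger0_norm (gauss_pdf_ge0 _ _ _)) -mulrA.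
  apply: ler_pM => //; first exact: gauss_pdf_ge0.
  by have [_] := HN (n + N)%N (leq_addl _ _); apply.
Unshelve. all: end_near.
Qed.

Section averaging_limits.
Variables (k1 k2 : nat) (alpha : R).
Hypothesis alpha0 : 0 < alpha.

(** From [1 + q <= expR q]. Decay like the inverse square of the norm is enough, since the weight
    multiplies a vector that grows linearly in [eta]. *)
Lemma weight_le (A : 'M[R]_(k1 + k2)) (eta : 'cV[R]_k2) (c : R) : 0 < c ->
  c * sqnorm eta <= (eta^T *m schur A *m eta) 0 0 -> 0 < sqnorm eta ->
  weight alpha sigma A eta <=
    expR (2 * alpha * k2%:R) * (alpha * c / sigma ^+ 2 * sqnorm eta)^-1.
Proof.
move=> c0 ceta eta0; set q := _ * sqnorm eta.
have q0 : 0 < q by rewrite !mulr_gt0// invr_gt0 exprn_gt0.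
rewrite -[expR (2 * _ * _)]invrK -expRN -invfM lef_pV2 ?posrE; last 2 first.
- by rewrite ltr_wpDr// mulr_ge0 ?expR_ge0.
- by rewrite mulr_gt0// expR_gt0.
apply: (@le_trans _ _ (expR (- (2 * alpha * k2%:R)) *
    expR (alpha * (eta^T *m schur A *m eta) 0 0 / sigma ^+ 2))); last by rewrite lerDr.
rewrite ler_wpM2l ?expR_ge0//.
apply: (@le_trans _ _ (expR q)).
  by apply: le_trans (expR_ge1Dx q); rewrite lerDr.
rewrite ler_expR /q [leRHS]mulrAC -!mulrA ler_pM2l// mulrCA ler_pM2l ?invr_gt0 ?exprn_gt0//.
Qed.

(** The correction is a weight of order [|eta|^-2] at most times a vector of order [|eta|], so its
    square is bounded by a constant over [sqnorm eta]. *)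
Lemma cvg_averaged_far (A_ : nat -> 'M[R]_(k1 + k2)) (A : 'M[R]_(k1 + k2))
    (b_ : nat -> 'cV[R]_k2) (y : 'cV[R]_(k1 + k2)) :
  posdef A -> A_ @ \oo --> A -> (fun n => sqnorm (b_ n)) @ \oo --> +oo ->
  (fun n => averaged alpha sigma (A_ n) (b_ n) y) @ \oo --> y.
Proof.
move=> pA A_A boo; have uA := posdef_unitmx (posdef_ulsubmx pA).
have [c c0 cS] := near_coercive (posdef_schur pA) (cvg_schur uA A_A).
set eta := fun n => dsubmx y + b_ n.
have etaoo : (fun n => sqnorm (eta n)) @ \oo --> +oo.
  apply/cvgryPge => a; move/cvgryPge : boo => /(_ (2 * a + 2 * sqnorm (dsubmx y))).
  apply: filterS => n; suff : sqnorm (b_ n) <= 2 * sqnorm (eta n) + 2 * sqnorm (dsubmx y).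
    by lra.
  rewrite /sqnorm !mulr_sumr -big_split/=; apply: ler_sum => i _.
  rewrite [eta n i 0]mxE; set u := dsubmx y i 0; set v := b_ n i 0.
  (* Coordinatewise [eta = u + v], and the difference of the two sides is exactly this square. *)
  by have := sqr_ge0 (v + 2 * u); nra.
pose C n := \sum_i \sum_j restriction_mx (A_ n) i j ^+ 2.
pose C0 := \sum_i \sum_j restriction_mx A i j ^+ 2.
have CC : C @ \oo --> C0.
  apply: cvg_sum => i _; apply: cvg_sum => j _.
  by apply: cvg_sqr; apply: cvg_coord; exact: cvg_restriction.
rewrite -[X in _ --> X]addr0; apply: cvgD; first exact: cvg_cst.
apply: cvg_matrixP => i j; rewrite [j]ord1 [X in _ --> X]mxE.
apply/cvgrPdist_le => e e0.
set a := expR (2 * alpha * k2%:R); set t := alpha * c / sigma ^+ 2.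
have a0 : 0 < a by exact: expR_gt0.
have t0 : 0 < t by rewrite divr_gt0 ?mulr_gt0 ?exprn_gt0.
have C1 : 0 <= C0 + 1.
  by rewrite addr_ge0// sumr_ge0// => u _; rewrite sumr_ge0// => v _; exact: sqr_ge0.
near=> n.
have q0 : 0 < sqnorm (eta n).
  by apply: (@lt_le_trans _ _ 1) => //; near: n; move/cvgryPge : etaoo; exact.
rewrite sub0r normrN -ler_sqr ?nnegrE ?(ltW e0)// real_normK ?num_real//.
rewrite mxE exprMn -/(eta n).
apply: (@le_trans _ _ ((a * (t * sqnorm (eta n))^-1) ^+ 2 * ((C0 + 1) * sqnorm (eta n)))).
  apply: ler_pM; rewrite ?sqr_ge0//.
    have r0 : 0 <= a * (t * sqnorm (eta n))^-1.
      by rewrite mulr_ge0 ?(ltW a0)// invr_ge0 mulr_ge0 ?(ltW t0) ?(ltW q0).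
    rewrite ler_sqr ?nnegrE ?weight_ge0//.
    by apply: weight_le => //; move: (eta n); near: n.
  apply: (@le_trans _ _ (sqnorm (restriction_mx (A_ n) *m eta n))).
    by rewrite /sqnorm (bigD1 i)//= lerDl sumr_ge0// => u _; exact: sqr_ge0.
  apply: (le_trans (sqnorm_mulmx_le _ _)); rewrite ler_wpM2r ?sqnorm_ge0//.
  near: n; move/cvgrPdist_le : CC => /(_ 1 ltr01); apply: filterS => n.
  by rewrite ler_norml /C; lra.
have -> : (a * (t * sqnorm (eta n))^-1) ^+ 2 * ((C0 + 1) * sqnorm (eta n)) =
    a ^+ 2 * (C0 + 1) / t ^+ 2 / sqnorm (eta n).
  by field; rewrite !gt_eqF.
rewrite ler_pdivrMr// -ler_pdivrMl ?exprn_gt0//.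
by near: n; move/cvgryPge : etaoo; exact.
Unshelve. all: end_near.
Qed.

Variables (X : forall n : nat, 'M[R]_(n, k1 + k2)) (Q : 'M[R]_(k1 + k2)).
Hypotheses (k_gt0 : (0 < k1 + k2)%N)
  (Xrank : forall n : nat, (k1 + k2 <= n)%N -> \rank (X n) = (k1 + k2)%N)
  (XQ : (fun n => gram (X n)) @ \oo --> Q) (Qpos : posdef Q).
Variable beta : nat -> 'cV[R]_(k1 + k2).

(** Serves both regimes: [T] is the identity in one and [averaged Q gamma] in the other. The
    finitely many [n] below [k1 + k2], where [X n] cannot have full column rank, are discarded by an
    eventual equality. *)
Lemma law_stat_cvg (T : 'cV[R]_(k1 + k2) -> 'cV[R]_(k1 + k2)) f :
  (forall y, (fun n => averaged alpha sigma (gram (X n))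
     (Num.sqrt n%:R *: dsubmx (beta n)) y) @ \oo --> T y) ->
  continuous f -> (exists M, forall x, `|f x| <= M) ->
  (fun n => law_stat alpha sigma (X n) (beta n) f) @ \oo -->
  fine (\int[muV R (k1 + k2)]_y (f (T y) * gauss_pdf sigma Q y)%:E).
Proof.
move=> avT cf [M fM].
have big : \forall n \near \oo, (k1 + k2 <= n)%N by exact: nbhs_infty_ge.
apply: (@cvg_trans _ ((fun n => fine (\int[muV R (k1 + k2)]_y
   (f (averaged alpha sigma (gram (X n)) (Num.sqrt n%:R *: dsubmx (beta n)) y) *
     gauss_pdf sigma (gram (X n)) y)%:E)) @ \oo)).
  apply: near_eq_cvg; near=> n; apply/esym.
  apply: law_statE => //; [|by exists M]; apply: Xrank; by near: n.
apply: (@cvg_integral_gauss_pdf _ (fun n => gram (X n)) Q (fun n y =>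
  f (averaged alpha sigma (gram (X n)) (Num.sqrt n%:R *: dsubmx (beta n)) y))
  (fun y => f (T y)) M) => //.
  near=> n; apply: measurableT_comp; first exact: continuous_measurable_matrix.
  have pg : posdef (gram (X n)) by apply: posdef_gram => //; apply: Xrank; near: n.
  exact: (measurable_averaged _ _ _ (posdef_unitmx (posdef_ulsubmx pg))).
by move=> y; apply: continuous_cvg; [exact: cf | exact: avT].
Unshelve. all: end_near.
Qed.

End averaging_limits.

End asymptotics.

(** * Polar coordinates *)

Lemma ge0_measurable_inv d (T : measurableType d) (R : realType) (f : T -> R) :
  measurable_fun setT f -> (forall x, 0 <= f x) ->
  measurable_fun setT (fun x => (f x)^-1).
Proof.
move=> mf f0; apply: (eq_measurable_fun (fun x => f x `^ (-1))).
  by move=> x _; rewrite powR_inv1.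
exact: (@measurableT_comp _ _ _ _ _ _ (@powR R ^~ (-1)) _ f (@measurable_powR R (-1)) mf).
Qed.

Section line_substitution.
Variable R : realType.
Local Notation mu := (@lebesgue_measure R).

Lemma bigcup_itv_exhaust (u v : nat -> R) :
  (forall x, exists n, u n <= x <= v n) ->
  \bigcup_n `[u n, v n]%classic = setT.
Proof.
by move=> uv; rewrite -subTset => x _; have [n ux] := uv x; exists n; rewrite //= in_itv.
Qed.

(** The substitution rule on the compact intervals [-n, n], followed by monotone convergence; the
    hypothesis on the values at -n and n makes the image intervals exhaust the line. *)
Lemma continuous_line_substitution (F f G : R -> R) :
  {homo F : x y / x < y} -> (forall x : R, is_derive (x : R^o) 1 (F : R^o -> R^o) (f x)) -> continuous f ->
  (forall x, 0 <= f x) ->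
  (forall x, exists n : nat, F (- n%:R) <= x <= F n%:R) ->
  continuous G -> (forall x, 0 <= G x) ->
  (\int[mu]_x (G x)%:E = \int[mu]_x (G (F x) * f x)%:E)%E.
Proof.
move=> incF dF cf f0 unbF cG G0.
have incF' : {homo F : x y / x <= y}.
  by move=> x y; rewrite le_eqVlt => /predU1P[->//|/incF/ltW].
have cF : continuous F.
  move=> x; apply: differentiable_continuous; apply/derivable1_diffP.
  by have [] := dF x.
have dFE : derive1 F = f by apply/funext => x; rewrite derive1E; exact: derive_val.
have cGF : continuous (fun x => G (F x) * f x).
  move=> x; apply: cvgM; last exact: cf.
  by apply: continuous_cvg; [exact: cG | exact: cF].
have unb (x : R) : exists n : nat, - n%:R <= x <= n%:R.
  exists (Num.bound `|x|).
  by rewrite -ler_norml ltW// archi_boundP.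
pose A n := `[F (- n%:R), F n%:R]%classic.
pose B n := `[- n%:R, n%:R : R]%classic.
have homA : {homo A : n m / (n <= m)%N >-> (n <= m)%O}.
  move=> n m nm; apply/subsetPset => x; rewrite /A/= !in_itv/= => /andP[x1 x2].
  by rewrite (le_trans _ x1) ?(le_trans x2)//; apply: incF'; rewrite ?lerN2 ler_nat.
have homB : {homo B : n m / (n <= m)%N >-> (n <= m)%O}.
  move=> n m nm; apply/subsetPset => x; rewrite /B/= !in_itv/= => /andP[x1 x2].
  by rewrite (le_trans _ x1) ?(le_trans x2)// ?lerN2 ler_nat.
have lA : (fun n => \int[mu]_(x in A n) (G x)%:E)%E @ \oo --> (\int[mu]_x (G x)%:E)%E.
  rewrite -(bigcup_itv_exhaust unbF).
  apply: ge0_nondecreasing_set_cvg_integral => // [n|n|n x _].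
  - exact: measurable_itv.
  - by apply/measurable_funTS/measurable_EFinP; exact: continuous_measurable_fun.
  - by rewrite lee_fin.
have lB : (fun n => \int[mu]_(x in B n) (G (F x) * f x)%:E)%E @ \oo -->
    (\int[mu]_x (G (F x) * f x)%:E)%E.
  rewrite -(bigcup_itv_exhaust unb).
  apply: ge0_nondecreasing_set_cvg_integral => // [n|n|n x _].
  - exact: measurable_itv.
  - by apply/measurable_funTS/measurable_EFinP; exact: continuous_measurable_fun.
  - by rewrite lee_fin mulr_ge0.
suff AB : (fun n => \int[mu]_(x in A n) (G x)%:E)%E =
    (fun n => \int[mu]_(x in B n) (G (F x) * f x)%:E)%E.
  by rewrite AB in lA; exact: (cvg_unique _ lA lB).
apply/funext => n; rewrite /A (@integration_by_substitution_increasing _ F G).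
- by apply: eq_integral => x _; rewrite dFE.
- by rewrite ge0_cp.
- by move=> x y _ _; exact: incF.
- by move=> x _; rewrite dFE; exact: cf.
- by rewrite dFE; apply/cvg_ex; eexists; apply: cvg_at_right_filter; exact: cf.
- by rewrite dFE; apply/cvg_ex; eexists; apply: cvg_at_left_filter; exact: cf.
- split; first by move=> x _; have [] := dF x.
    by apply: cvg_at_right_filter; exact: cF.
  by apply: cvg_at_left_filter; exact: cF.
- exact: continuous_subspaceT.
Qed.

End line_substitution.

Section polar.
Variables (R : realType) (m : nat).
Local Notation mu := (@lebesgue_measure R).
Local Notation V := 'cV[R]_m.+1.

(** What [cone_weight] below becomes at [w = s v]: its condition [s^2 < |s v|^2] says [|v| > 1]
    whatever the nonzero [s], and the denominator comes from the length [2 |w|] of the interval of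
    admissible scales. *)
Definition polar_weight (v : V) : R := (1 < sqnorm v)%R%:R / (2 * vnorm v).

(* for [w != 0], [s |-> cone_weight s w] is a probability density; it is
   homogeneous of degree -1 in [(s, w)], so that the substitution [w = s v]
   turns it into [polar_weight v / |s|] *)
Definition cone_weight (s : R) (w : V) : R :=
  ((s != 0) && (s ^+ 2 < sqnorm w))%R%:R / (2 * vnorm w).

Lemma measurable_sqnorm k : measurable_fun setT (@sqnorm R k).
Proof. by apply: continuous_measurable_matrix => v; exact: (@cvg_sqnorm _ _ (nbhs v) _ _ id). Qed.

Lemma measurable_vnorm k : measurable_fun setT (@vnorm R k).
Proof.
apply: measurableT_comp; last exact: measurable_sqnorm.
by apply: continuous_measurable_fun; exact: sqrt_continuous.
Qed.

Lemma vnorm_ge0 k (v : 'cV[R]_k) : 0 <= vnorm v.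
Proof. exact: sqrtr_ge0. Qed.

Lemma vnormZ k (s : R) (v : 'cV[R]_k) : vnorm (s *: v) = `|s| * vnorm v.
Proof. by rewrite /vnorm sqnormZ sqrtrM ?sqr_ge0// sqrtr_sqr. Qed.

Lemma measurable_natr_bool d (T : measurableType d) (f : T -> bool) :
  measurable_fun setT f -> measurable_fun setT (fun x => (f x)%:R : R).
Proof.
move=> mf; have : measurable_fun setT (fun b : bool => b%:R : R) by [].
by move=> mb; exact: measurableT_comp mb mf.
Qed.

Lemma measurable_polar_weight : measurable_fun setT polar_weight.
Proof.
apply: measurable_funM.
  apply: measurable_natr_bool; apply: measurable_fun_ltr => //.
  exact: measurable_sqnorm.
apply: ge0_measurable_inv; last by move=> v; rewrite mulr_ge0 ?vnorm_ge0.
by apply: measurable_funM => //; exact: measurable_vnorm.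
Qed.

Lemma measurable_cone_weight :
  measurable_fun setT (fun sw : R * V => cone_weight sw.1 sw.2).
Proof.
have ms : measurable_fun setT (fun sw : R * V => sqnorm sw.2).
  by apply: measurableT_comp => //; exact: measurable_sqnorm.
have mn : measurable_fun setT (fun sw : R * V => vnorm sw.2).
  by apply: measurableT_comp => //; exact: measurable_vnorm.
apply: measurable_funM; last first.
  apply: ge0_measurable_inv; last by move=> v; rewrite mulr_ge0 ?vnorm_ge0.
  exact: measurable_funM.
apply: measurable_natr_bool; apply: measurable_and.
  by apply: measurable_neg; apply: measurable_fun_eqr.
by apply: measurable_fun_ltr => //; apply: measurable_funX.
Qed.

Lemma cone_weight_ge0 s w : 0 <= cone_weight s w.
Proof. by rewrite divr_ge0 ?mulr_ge0 ?vnorm_ge0. Qed.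

Lemma polar_weight_ge0 v : 0 <= polar_weight v.
Proof. by rewrite divr_ge0 ?mulr_ge0 ?vnorm_ge0. Qed.

Lemma cone_weight_scale s v : s != 0 ->
  cone_weight s (s *: v) * `|s| = polar_weight v.
Proof.
move=> s0; rewrite /cone_weight /polar_weight s0 /= sqnormZ vnormZ.
have s2 : 0 < s ^+ 2 by rewrite exprn_even_gt0.
rewrite -[X in X < _]mulr1 ltr_pM2l//.
have [v0|v0] := eqVneq (vnorm v) 0; first by rewrite v0 !mulr0 invr0 !mulr0 mul0r.
by field; rewrite v0 normr_eq0.
Qed.

Lemma integral_cone_weight w : w != 0 -> (\int[mu]_s (cone_weight s w)%:E = 1)%E.
Proof.
move=> w0; have n0 : 0 < vnorm w by rewrite sqrtr_gt0 sqnorm_gt0.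
have sqn : sqnorm w = vnorm w ^+ 2 by rewrite sqr_sqrtr// sqnorm_ge0.
rewrite (_ : (fun s => _) = fun s =>
    ((2 * vnorm w)^-1%:E * (\1_(`]- vnorm w, vnorm w[ `\ 0) s)%:E)%E); last first.
  apply/funext => s; rewrite -EFinM; congr _%:E.
  rewrite /cone_weight mulrC; congr (_ * _); rewrite indicE; congr (_%:R).
  rewrite in_setD mem_setE in_itv/= in_set1 andbC sqn; congr (_ && _).
  by rewrite -ltr_norml -[RHS]ltr_sqr ?nnegrE ?(ltW n0)// real_normK ?num_real.
have mA : measurable (`]- vnorm w, vnorm w[ `\ 0 : set (measurableTypeR R)).
  exact: measurableD.
rewrite ge0_integralZl_EFin//; last 2 first.
- exact/measurable_EFinP.
- by rewrite invr_ge0 mulr_ge0 ?vnorm_ge0.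
rewrite integral_indic// setIT measureD//; last first.
  by rewrite /= lebesgue_measure_itv/= lte_fin gtrN// ltry.
rewrite [X in (_ * (_ - X))%E](_ : _ = 0%E); last first.
  apply: (@subset_measure0 _ _ _ mu _ [set 0]) => //.
    exact: measurableI.
  exact: lebesgue_measure_set1.
rewrite /= lebesgue_measure_itv/= lte_fin gtrN// sube0 -EFinB -EFinM; congr _%:E.
by field; rewrite gt_eqF.
Qed.

Lemma measurable_set0V k : measurable [set 0 : 'cV[R]_k].
Proof.
rewrite (_ : [set 0] = (@sqnorm R k) @^-1` [set 0]).
  by rewrite -[X in measurable X]setTI; apply: measurable_sqnorm.
apply/seteqP; split=> w/=; first by move=> ->; apply/eqP; rewrite sqnorm_eq0.
by move=> /eqP; rewrite sqnorm_eq0 => /eqP.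
Qed.

Lemma ae_neq0 : {ae muV R m.+1, forall w : V, w != 0}.
Proof.
have m0 : measurable [set 0 : V] := @measurable_set0V _.
exists [set 0]; split => //; last by move=> w/= /negP; rewrite negbK => /eqP.
have c0 : consV (0, 0) = 0 :> V.
  by rewrite /consV/= (_ : const_mx 0 = 0)//; exact: (@col_mx0 R 1 m 1).
rewrite /= /cons_measure /pushforward.
have -> : (@consV R m) @^-1` [set 0] = [set 0] `*` [set 0].
  apply/seteqP; split=> [[x v]/= E|[x v]/= [-> ->]//].
  by have /(congr1 (@unconsV R m)) := E; rewrite -c0 !consVK => -[-> ->].
rewrite product_measure1E//.
  by rewrite /= lebesgue_measure_set1 mul0e.
exact: measurable_set0V.
Qed.

(* Polar coordinates without spheres: the direction is carried by all [v] with
   [|v| > 1]. *)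
Lemma ge0_integral_polar (K : V -> R) : measurable_fun setT K -> (forall v, 0 <= K v) ->
  (\int[muV R m.+1]_w (K w)%:E = \int[muV R m.+1]_v
    ((polar_weight v)%:E * \int[mu]_s (K (s *: v) * `|s| ^+ m)%:E))%E.
Proof.
move=> mK K0.
have mKc : measurable_fun setT (fun sw : R * V => (K sw.2 * cone_weight sw.1 sw.2)%:E).
  apply/measurable_EFinP; apply: measurable_funM; last exact: measurable_cone_weight.
  exact: measurableT_comp.
have mZ : measurable_fun setT (fun sv : R * V => sv.1 *: sv.2).
  apply: measurable_matrixP => i j; under eq_fun do rewrite mxE.
  by apply: measurable_funM => //; apply: (measurableT_comp (measurable_coord i j)).
have mKs : measurable_fun setT (fun sv : R * V => K (sv.1 *: sv.2) * `|sv.1| ^+ m).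
  apply: measurable_funM; first exact: measurableT_comp.
  apply: measurable_funX; apply: measurableT_comp => //; exact: measurableT_comp.
have mKp : measurable_fun setT (fun sv : R * V =>
    (K (sv.1 *: sv.2) * `|sv.1| ^+ m * polar_weight sv.2)%:E).
  apply/measurable_EFinP; apply: measurable_funM => //.
  by apply: measurableT_comp => //; exact: measurable_polar_weight.
have Kc0 sw : (0 <= (K sw.2 * cone_weight sw.1 sw.2)%:E)%E.
  by rewrite lee_fin mulr_ge0 ?cone_weight_ge0.
have Kp0 (sv : R * V) :
    (0 <= (K (sv.1 *: sv.2) * `|sv.1| ^+ m * polar_weight sv.2)%:E)%E.
  by rewrite lee_fin mulr_ge0 ?polar_weight_ge0// mulr_ge0.
(* The density in [s] has mass 1 for every [w] other than 0, a negligible exception. *)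
transitivity (\int[muV R m.+1]_w \int[mu]_s (K w * cone_weight s w)%:E)%E.
  apply: ae_eq_integral => //; first exact/measurable_EFinP.
    exact: (@measurable_fun_fubini_tonelli_G _ _ _ _ _ mu _ mKc Kc0).
  have := ae_neq0; apply: filterS => w w0 _.
  under eq_integral do rewrite EFinM.
  rewrite ge0_integralZl_EFin ?integral_cone_weight ?mule1//.
    by move=> s _; rewrite lee_fin cone_weight_ge0.
  apply/measurable_EFinP.
  exact: (measurableT_comp measurable_cone_weight (measurable_pair2 w)).
rewrite -(@fubini_tonelli _ _ _ _ _ mu (muV R m.+1) _ mKc Kc0).
transitivity (\int[mu]_s \int[muV R m.+1]_v
    (K (s *: v) * `|s| ^+ m * polar_weight v)%:E)%E.
  apply: ae_eq_integral => //.
  - exact: (@measurable_fun_fubini_tonelli_F _ _ _ _ _ (muV R m.+1) _ mKc Kc0).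
  - exact: (@measurable_fun_fubini_tonelli_F _ _ _ _ _ (muV R m.+1) _ mKp Kp0).
  exists [set 0]; split => //; first exact: lebesgue_measure_set1.
  move=> s /= ns; apply: contrapT => /eqP s0; apply: ns => _.
  (* For fixed nonzero [s], the substitution [w = s v] has determinant [s ^+ m.+1]; one factor |s|
     turns [cone_weight] into [polar_weight], the others remain. *)
  pose A : 'M[R]_m.+1 := s%:M.
  have dA : \det A = s ^+ m.+1 by rewrite det_scalar.
  have uA : A \in unitmx by rewrite unitmxE dA unitfE expf_neq0.
  have mKs' : measurable_fun setT (fun w : V => (K w * cone_weight s w)%:E).
    exact: (measurableT_comp mKc (measurable_pair1 s)).
  have := unitmx_scales_muV uA mKs' (fun w => Kc0 (s, w)).
  move=> /(congr1 (fun x => (`|\det A|%:E * x)%E)).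
  rewrite muleA -EFinM mulfV ?mul1e; last by rewrite normr_eq0 dA expf_neq0.
  move=> <-; rewrite -ge0_integralZl_EFin//; last first.
  - exact: (measurableT_comp mKs' (measurable_mulmx A)).
  - by move=> v _; exact: (Kc0 (s, _)).
  apply: eq_integral => v _; rewrite -EFinM; congr _%:E.
  by rewrite dA mul_scalar_mx -(cone_weight_scale v s0) normrX exprSr; ring.
rewrite (@fubini_tonelli _ _ _ _ _ mu (muV R m.+1) _ mKp Kp0).
apply: eq_integral => v _; rewrite -ge0_integralZl_EFin ?polar_weight_ge0//.
- by apply: eq_integral => s _; rewrite -EFinM mulrC.
- by move=> s _; rewrite lee_fin mulr_ge0.
- by apply/measurable_EFinP; exact: (measurableT_comp mKs (measurable_pair2 v)).
Qed.

End polar.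

(** * Radial shrinkage *)

Section shrinkage.
Variables (R : realType) (alpha sigma : R) (k2 : nat).
Hypotheses (alpha0 : 0 < alpha) (sigma0 : 0 < sigma).

Let beta := alpha / sigma ^+ 2.
Let beta0 : 0 < beta. Proof. by rewrite divr_gt0// exprn_gt0. Qed.
Let a := expR (2 * alpha * k2%:R).
Let a0 : 0 < a. Proof. exact: expR_gt0. Qed.

(** One minus the weight of the restricted estimator, as a function of a squared norm (see
    [averaged_frame]); [xi * shrink (xi ^+ 2)] is the function [h]. *)
Definition shrink (q : R) : R := (1 + a * expR (- (beta * q)))^-1.

Let den_gt0 q : 0 < 1 + a * expR (- (beta * q)).
Proof. by rewrite ltr_wpDr// mulr_ge0 ?expR_ge0 ?ltW. Qed.

Lemma shrink_gt0 q : 0 < shrink q.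
Proof. by rewrite invr_gt0. Qed.

Lemma shrink_lt1 q : shrink q < 1.
Proof. by rewrite invf_lt1// ltrDl mulr_gt0// expR_gt0. Qed.

Lemma shrink_le q r : q <= r -> shrink q <= shrink r.
Proof.
move=> qr; rewrite lef_pV2 ?posrE// lerD2l ler_pM2l// ler_expR lerN2.
by rewrite ler_pM2l.
Qed.

Lemma onem_shrinkE q : 1 - shrink q = a * expR (- (beta * q)) * shrink q.
Proof.
have := den_gt0 q; rewrite /shrink; set e := a * _ => e0.
by field; rewrite gt_eqF.
Qed.

Lemma onem_shrink q : 1 - shrink q = (1 + a^-1 * expR (beta * q))^-1.
Proof.
have e0 : expR (beta * q) != 0 by rewrite gt_eqF// expR_gt0.
have d0 : 1 + a^-1 * expR (beta * q) != 0.
  by rewrite gt_eqF// ltr_wpDr// mulr_ge0 ?expR_ge0// invr_ge0 ltW.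
apply: (mulfI d0); rewrite mulfV// onem_shrinkE.
have -> : (1 + a^-1 * expR (beta * q)) * (a * expR (- (beta * q)) * shrink q) =
    (1 + a * expR (- (beta * q))) * shrink q.
  by rewrite expRN; field; rewrite e0 gt_eqF.
by rewrite mulfV// gt_eqF.
Qed.

(** The radial map on the line through a vector [v] of squared norm [q]: it sends [r *: v] to
    [line_shrink q r *: v]. *)
Definition line_shrink (q r : R) : R := r * shrink (r ^+ 2 * q).
Definition line_shrink_deriv (q r : R) : R :=
  shrink (r ^+ 2 * q) * (1 + 2 * beta * (r ^+ 2 * q) * (1 - shrink (r ^+ 2 * q))).

Lemma continuous_shrink : continuous shrink.
Proof.
move=> q; apply: cvgV; first by rewrite gt_eqF.
apply: cvgD; first exact: cvg_cst.
apply: cvgMr; apply: continuous_cvg; first exact: continuous_expR.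
by apply: cvgN; apply: cvgMr; exact: cvg_id.
Qed.

(** The logistic identity: [shrink] has derivative [beta * shrink * (1 - shrink)]. *)
Lemma is_derive_line_shrink (q r : R) :
  is_derive (r : R^o) 1 (line_shrink q : R^o -> R^o) (line_shrink_deriv q r).
Proof.
pose D (x : R) := 1 + a * expR (- (beta * (x ^+ 2 * q))).
have de : is_derive (r : R^o) 1 (D : R^o -> R^o)
   (a * (expR (- (beta * (r ^+ 2 * q))) * (- (beta * (2 * r * q))))).
  apply: is_derive_eq.
  by rewrite /GRing.scale/=; ring.
have D0 : D r != 0 by rewrite gt_eqF// den_gt0.
have dV := is_deriveV D0 de.
have dM := is_deriveM (is_derive_id (r : R^o) 1) dV.
apply: (is_derive_eq dM).
rewrite /line_shrink_deriv onem_shrinkE /shrink -/(D r) /GRing.scale/=.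
by field.
Qed.

Lemma line_shrink_lt q : 0 <= q -> {homo line_shrink q : x y / x < y}.
Proof.
move=> q0.
have pos x y : 0 <= x -> x < y -> line_shrink q x < line_shrink q y.
  move=> x0 xy; apply: (@le_lt_trans _ _ (x * shrink (y ^+ 2 * q))).
    have y0 : 0 < y := le_lt_trans x0 xy.
    by rewrite ler_wpM2l// shrink_le// ler_wpM2r// ler_sqr ?nnegrE ?(ltW y0) ?(ltW xy).
  by rewrite ltr_pM2r// shrink_gt0.
have odd x : line_shrink q (- x) = - line_shrink q x by rewrite /line_shrink sqrrN mulNr.
move=> x y xy; have [x0|x0] := leP 0 x; first exact: pos.
have [y0|y0] := leP 0 y.
  apply: (@lt_le_trans _ _ 0); last by rewrite mulr_ge0// ltW// shrink_gt0.
  by rewrite nmulr_rlt0// shrink_gt0.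
by rewrite -ltrN2 -!odd; apply: pos; rewrite ?oppr_ge0 ?ltrN2// ltW.
Qed.

Lemma line_shrink_ge q (r : R) : 0 <= q -> 0 <= r -> shrink 0 * r <= line_shrink q r.
Proof. by move=> q0 r0; rewrite mulrC ler_wpM2l// shrink_le// mulr_ge0// sqr_ge0. Qed.

Lemma line_shrink_unbounded q x : 0 <= q ->
  exists n : nat, line_shrink q (- n%:R) <= x <= line_shrink q n%:R.
Proof.
move=> q0; exists (Num.bound (`|x| / shrink 0)).
set n := Num.bound _.
have nx : `|x| <= line_shrink q n%:R.
  apply: le_trans (line_shrink_ge q0 (ler0n _ _)).
  rewrite mulrC -ler_pdivrMr ?shrink_gt0// ltW// archi_boundP//.
  by rewrite divr_ge0// ltW// shrink_gt0.
rewrite (_ : line_shrink q (- _) = - line_shrink q n%:R).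
  by rewrite -ler_norml.
by rewrite /line_shrink sqrrN mulNr.
Qed.

Lemma shrink_jacobian_ge0 q : 0 <= q -> 0 <= 1 + 2 * beta * q * (1 - shrink q).
Proof.
move=> q0; rewrite addr_ge0// mulr_ge0 ?subr_ge0 ?(ltW (shrink_lt1 _))//.
exact: mulr_ge0 (mulr_ge0 (ler0n _ 2) (ltW beta0)) q0.
Qed.

Lemma continuous_line_shrink_deriv q : continuous (line_shrink_deriv q).
Proof.
move=> r; have cq : (fun x : R => x ^+ 2 * q) @ r --> r ^+ 2 * q.
  by apply: cvgMl; apply: cvg_sqr; exact: cvg_id.
have cs : (fun x : R => shrink (x ^+ 2 * q)) @ r --> shrink (r ^+ 2 * q).
  by apply: continuous_cvg => //; exact: continuous_shrink.
apply: cvgM => //; apply: cvgD; first exact: cvg_cst.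
apply: cvgM; first exact: cvgMr.
by apply: cvgB => //; exact: cvg_cst.
Qed.

Definition radial_shrink m (v : 'cV[R]_m) : 'cV[R]_m := shrink (sqnorm v) *: v.

(** The Jacobian determinant of [radial_shrink]: each of the [m - 1] directions orthogonal to [v] is
    scaled by [shrink], and the direction of [v] by the derivative of [line_shrink] at 1. *)
Definition radial_jacobian m (v : 'cV[R]_m) : R :=
  shrink (sqnorm v) ^+ m * (1 + 2 * beta * sqnorm v * (1 - shrink (sqnorm v))).

Section filters.
Variables (I : Type) (F : set_system I) (FF : Filter F) (m : nat).
Variables (f : I -> 'cV[R]_m) (l : 'cV[R]_m).
Hypothesis fl : f @ F --> l.

Lemma cvg_shrink_sqnorm : (fun x => shrink (sqnorm (f x))) @ F --> shrink (sqnorm l).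
Proof.
apply: (@continuous_cvg _ _ _ F FF (fun x => sqnorm (f x)) shrink).
  exact: continuous_shrink.
exact: cvg_sqnorm.
Qed.

Lemma cvg_radial_shrink : (fun x => radial_shrink (f x)) @ F --> radial_shrink l.
Proof. by apply: cvgZ => //; exact: cvg_shrink_sqnorm. Qed.

Lemma cvg_radial_jacobian : (fun x => radial_jacobian (f x)) @ F --> radial_jacobian l.
Proof.
apply: cvgM.
  apply: (@continuous_cvg _ _ _ F FF (fun x => shrink (sqnorm (f x))) (fun y : R => y ^+ m)).
    exact: exprn_continuous.
  exact: cvg_shrink_sqnorm.
apply: cvgD; first exact: cvg_cst.
apply: cvgM; first by apply: cvgMr; exact: cvg_sqnorm.
by apply: cvgB; [exact: cvg_cst | exact: cvg_shrink_sqnorm].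
Qed.

Lemma cvg_vnorm : (fun x => vnorm (f x)) @ F --> vnorm l.
Proof.
apply: (@continuous_cvg _ _ _ F FF (fun x => sqnorm (f x)) (@Num.sqrt R)).
  exact: sqrt_continuous.
exact: cvg_sqnorm.
Qed.

End filters.

Lemma continuous_radial_shrink m : continuous (@radial_shrink m).
Proof. by move=> v; exact: (@cvg_radial_shrink _ (nbhs v) _ _ id). Qed.

Lemma continuous_radial_jacobian m : continuous (@radial_jacobian m).
Proof. by move=> v; exact: (@cvg_radial_jacobian _ (nbhs v) _ _ id). Qed.

Lemma radial_jacobian_gt0 m (v : 'cV[R]_m) : 0 < radial_jacobian v.
Proof.
rewrite mulr_gt0// ?exprn_gt0 ?shrink_gt0// ltr_wpDr// mulr_ge0//.
  exact: mulr_ge0 (mulr_ge0 (ler0n _ 2) (ltW beta0)) (sqnorm_ge0 v).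
by rewrite subr_ge0 ltW// shrink_lt1.
Qed.

(** In polar coordinates both sides become integrals along the line spanned by [v], related by
    [s = line_shrink (sqnorm v) r]; the factor [|s|^m] supplies the tangential part of the
    Jacobian. *)
Lemma ge0_integral_radial_shrink m (K : 'cV[R]_m.+1 -> R) :
  continuous K -> (forall v, 0 <= K v) ->
  (\int[muV R m.+1]_w (K w)%:E =
   \int[muV R m.+1]_v (K (radial_shrink v) * radial_jacobian v)%:E)%E.
Proof.
move=> cK K0.
have mK : measurable_fun setT K by exact: continuous_measurable_matrix.
have mKJ : measurable_fun setT (fun v : 'cV[R]_m.+1 => K (radial_shrink v) * radial_jacobian v).
  apply: measurable_funM.
    apply: measurableT_comp => //; apply: continuous_measurable_matrix2.
    exact: continuous_radial_shrink.
  by apply: continuous_measurable_matrix; exact: continuous_radial_jacobian.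
rewrite (ge0_integral_polar mK K0) (ge0_integral_polar mKJ); last first.
  by move=> v; rewrite mulr_ge0// ltW// radial_jacobian_gt0.
apply: eq_integral => v _; congr (_ * _)%E; have q0 := sqnorm_ge0 v.
transitivity (\int[@lebesgue_measure R]_r (K (line_shrink (sqnorm v) r *: v) *
    `|line_shrink (sqnorm v) r| ^+ m * line_shrink_deriv (sqnorm v) r)%:E)%E; last first.
  apply: eq_integral => r _; congr _%:E.
  rewrite /radial_shrink /radial_jacobian sqnormZ scalerA [shrink _ * r]mulrC.
  rewrite -[r * shrink _]/(line_shrink (sqnorm v) r) -!(mulrA (K _)); congr (_ * _).
  rewrite /line_shrink /line_shrink_deriv normrM exprMn (ger0_norm (ltW (shrink_gt0 _))).
  move: (shrink _) (1 + _) (`|r| ^+ m) => x y z.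
  by rewrite (exprS x m); ring.
apply: (@continuous_line_substitution _ (line_shrink (sqnorm v))
  (line_shrink_deriv (sqnorm v)) (fun s => K (s *: v) * `|s| ^+ m)).
- exact: line_shrink_lt.
- exact: is_derive_line_shrink.
- exact: continuous_line_shrink_deriv.
- move=> r; rewrite mulr_ge0 ?(ltW (shrink_gt0 _))// shrink_jacobian_ge0//.
  by rewrite mulr_ge0// sqr_ge0.
- by move=> x; exact: line_shrink_unbounded.
- move=> s; apply: (@cvgM _ _ (nbhs s)).
    apply: (@continuous_cvg _ _ _ (nbhs s) _ (fun s : R => s *: v) K); first exact: cK.
    by apply: (@cvgZ _ _ _ (nbhs s)); [exact: cvg_id | exact: cvg_cst].
  apply: (@continuous_cvg _ _ _ (nbhs s) _ (fun s : R => `|s|) (fun x => x ^+ m)).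
    exact: exprn_continuous.
  exact: norm_continuous.
- by move=> s; rewrite mulr_ge0.
Qed.

Lemma h_funE xi : h_fun alpha sigma k2 xi = line_shrink 1 xi.
Proof.
rewrite /h_fun /line_shrink /shrink mulr1 mulrC; congr (_ * (1 + _ * expR _)^-1).
by rewrite /beta invf_div mulNr mulrC.
Qed.

Lemma h_fun_lt : {homo h_fun alpha sigma k2 : x y / x < y}.
Proof. by move=> x y xy; rewrite !h_funE; apply: line_shrink_lt. Qed.

(** [g_fun] is a choice among preimages under [h], so existence is what has to be shown; it comes
    from the intermediate value theorem, as [h] is unbounded. *)
Lemma g_funP y : 0 <= y ->
  0 <= g_fun alpha sigma k2 y /\ h_fun alpha sigma k2 (g_fun alpha sigma k2 y) = y.
Proof.
move=> y0; apply: (@getPex _ [set xi : R | 0 <= xi /\ h_fun alpha sigma k2 xi = y]).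
have [n /andP[_ yn]] := line_shrink_unbounded y (@ler01 R).
have : exists2 c, c \in `[0, n%:R] & line_shrink 1 c = y.
  apply: IVT => //.
    apply: continuous_subspaceT => x; apply: differentiable_continuous.
    by apply/derivable1_diffP; have [] := is_derive_line_shrink 1 x.
  have f0 : line_shrink 1 0 = 0 by rewrite /line_shrink mul0r.
  by rewrite f0 ge_min y0 le_max yn orbT.
by move=> [c]; rewrite in_itv/= => /andP[c0 _] cy; exists c; rewrite h_funE.
Qed.

Lemma g_funK xi : 0 <= xi -> g_fun alpha sigma k2 (h_fun alpha sigma k2 xi) = xi.
Proof.
move=> xi0; have h0 : 0 <= h_fun alpha sigma k2 xi.
  by rewrite h_funE /line_shrink mulr_ge0// ltW// shrink_gt0.
have [_ E] := g_funP h0; apply/eqP; case: ltgtP => // /h_fun_lt.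
  by rewrite E ltxx.
by rewrite E ltxx.
Qed.

(** [shrink] is nondecreasing, so [shrink 0] bounds the difference quotients of [h] from below. This
    makes the inverse [g] Lipschitz, hence the limit density continuous. *)
Lemma h_fun_expand x y : 0 <= x -> x <= y ->
  shrink 0 * (y - x) <= h_fun alpha sigma k2 y - h_fun alpha sigma k2 x.
Proof.
move=> x0 xy; rewrite !h_funE /line_shrink !mulr1.
have s1 : shrink 0 <= shrink (x ^+ 2) by apply: shrink_le; exact: sqr_ge0.
have s2 : shrink (x ^+ 2) <= shrink (y ^+ 2).
  by apply: shrink_le; rewrite ler_sqr ?nnegrE// (le_trans x0).
have y0 : 0 <= y by exact: le_trans xy.
apply: (@le_trans _ _ (shrink (x ^+ 2) * (y - x))).
  by rewrite ler_wpM2r// subr_ge0.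
rewrite mulrBr mulrC lerD// ?[- _]mulrC; last by rewrite mulrC.
by rewrite ler_wpM2l.
Qed.

Lemma g_fun_lipschitz x y : 0 <= x -> 0 <= y ->
  shrink 0 * `|g_fun alpha sigma k2 x - g_fun alpha sigma k2 y| <= `|x - y|.
Proof.
wlog xy : x y / g_fun alpha sigma k2 y <= g_fun alpha sigma k2 x.
  move=> H x0 y0; have [xy|/ltW xy] := leP (g_fun alpha sigma k2 y) (g_fun alpha sigma k2 x).
    exact: H.
  by rewrite distrC [leRHS]distrC; exact: H.
move=> /g_funP[gx xE] /g_funP[gy yE]; rewrite ger0_norm ?subr_ge0//.
have := h_fun_expand gy xy; rewrite xE yE => /le_trans; apply; exact: ler_norm.
Qed.

Lemma cvg_g_fun_vnorm (I : Type) (F : set_system I) (FF : Filter F) m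
    (f : I -> 'cV[R]_m) (l : 'cV[R]_m) : f @ F --> l ->
  (fun x => g_fun alpha sigma k2 (vnorm (f x))) @ F --> g_fun alpha sigma k2 (vnorm l).
Proof.
move=> fl; apply/cvgrPdist_le => e e0.
have se : 0 < shrink 0 * e by rewrite mulr_gt0// shrink_gt0.
have /cvgrPdist_le/(_ _ se) := cvg_vnorm FF fl; apply: filterS => z wz.
rewrite -(ler_pM2l (shrink_gt0 0)); apply: le_trans wz.
by apply: g_fun_lipschitz; exact: vnorm_ge0.
Qed.

(** The vector [G w / |w|] of the theorem ([radial_expandE]), written without division by [|w|] so
    that continuity at [w = 0] is no special case. *)
Definition radial_expand m (w : 'cV[R]_m) : 'cV[R]_m :=
  (shrink (g_fun alpha sigma k2 (vnorm w) ^+ 2))^-1 *: w.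

Lemma cvg_radial_expand (I : Type) (F : set_system I) (FF : Filter F) m
    (f : I -> 'cV[R]_m) (l : 'cV[R]_m) :
  f @ F --> l -> (fun x => radial_expand (f x)) @ F --> radial_expand l.
Proof.
move=> fl; apply: cvgZ => //; apply: cvgV; first by rewrite gt_eqF// shrink_gt0.
apply: (@continuous_cvg _ _ _ F FF
  (fun x => g_fun alpha sigma k2 (vnorm (f x)) ^+ 2) shrink).
  exact: continuous_shrink.
by apply: cvg_sqr; exact: cvg_g_fun_vnorm.
Qed.

Lemma sqr_vnorm m (v : 'cV[R]_m) : vnorm v ^+ 2 = sqnorm v.
Proof. by rewrite sqr_sqrtr// sqnorm_ge0. Qed.

Lemma vnorm_radial_shrink m (v : 'cV[R]_m) :
  vnorm (radial_shrink v) = h_fun alpha sigma k2 (vnorm v).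
Proof.
rewrite h_funE /line_shrink mulr1 sqr_vnorm /radial_shrink vnormZ mulrC.
by rewrite ger0_norm// ltW// shrink_gt0.
Qed.

Lemma g_fun_radial_shrink m (v : 'cV[R]_m) :
  g_fun alpha sigma k2 (vnorm (radial_shrink v)) = vnorm v.
Proof. by rewrite vnorm_radial_shrink g_funK// vnorm_ge0. Qed.

Lemma radial_shrinkK m : cancel (@radial_shrink m) (@radial_expand m).
Proof.
move=> v; rewrite /radial_expand g_fun_radial_shrink sqr_vnorm scalerA mulVf ?scale1r//.
by rewrite gt_eqF// shrink_gt0.
Qed.

(** Because [|w| = h(G) = G shrink(G^2)], the quotient [G / |w|] is the inverse of [shrink(G^2)]. *)
Lemma radial_expandE m (w : 'cV[R]_m) : radial_expand w =
  if w == 0 then 0 else (g_fun alpha sigma k2 (vnorm w) / vnorm w) *: w.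
Proof.
case: eqP => [->|/eqP w0]; first by rewrite /radial_expand scaler0.
have n0 : vnorm w != 0 by rewrite gt_eqF// sqrtr_gt0 sqnorm_gt0.
have [_] := g_funP (vnorm_ge0 w); rewrite h_funE /line_shrink mulr1 => E.
rewrite /radial_expand; congr (_ *: _); rewrite -{3}E.
have g0 : g_fun alpha sigma k2 (vnorm w) != 0.
  by apply: contraNneq n0 => g0; rewrite -E g0 mul0r.
by rewrite invfM mulVKf.
Qed.

End shrinkage.

(** * Limit law and its density *)

Section frame.
Variables (R : realType) (k1 k2 : nat) (Q : 'M[R]_(k1 + k2)).
Hypothesis Qpos : posdef Q.

Let p11 : posdef (ulsubmx Q) := posdef_ulsubmx Qpos.
Let pS : posdef (schur Q) := posdef_schur Qpos.

Lemma mxisqrtP k (A : 'M[R]_k) : posdef A ->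
  [/\ (mxisqrt A)^T = mxisqrt A, mxisqrt A *m mxsqrt A = 1%:M,
      mxsqrt A *m mxisqrt A = 1%:M & mxisqrt A *m A *m mxisqrt A = 1%:M].
Proof.
move=> pA; have [pr rr] := mxsqrtP pA; have ur := posdef_unitmx pr.
rewrite /mxisqrt; split; rewrite ?mulVmx ?mulmxV ?trmx_inv ?pr.1//.
by rewrite -{2}rr mulmxA mulVmx// mul1mx mulmxV.
Qed.

(** The matrix with column blocks [Cinf] and [Dinf]. *)
Definition frame : 'M[R]_(k1 + k2) :=
  row_mx (col_mx (mxisqrt (ulsubmx Q)) 0)
         (- (restriction_mx Q *m mxisqrt (schur Q))).

(** [Q] maps the second column block to [col_mx 0 (mxsqrt (schur Q))], which is orthogonal to the
    first one because the lower block of the latter is 0. *)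
Lemma frame_form : frame^T *m Q *m frame = 1%:M.
Proof.
have [s1 i1 i1' f1] := mxisqrtP p11; have [s2 i2 i2' f2] := mxisqrtP pS.
have u11 := posdef_unitmx p11.
have QD : Q *m - (restriction_mx Q *m mxisqrt (schur Q)) = col_mx 0 (mxsqrt (schur Q)).
  rewrite mulmxN mulmxA (mulmx_restriction u11) mul_col_mx mul0mx mulNmx opp_col_mx.
  by rewrite oppr0 opprK -{1}(mxsqrtP pS).2 -mulmxA i2' mulmx1.
have DQ : (- (restriction_mx Q *m mxisqrt (schur Q)))^T *m Q = row_mx 0 (mxsqrt (schur Q)).
  by apply: trmx_inj; rewrite trmx_mul trmxK Qpos.1 QD tr_row_mx trmx0 (mxsqrtP pS).1.1.
rewrite /frame tr_row_mx mul_col_mx mul_col_row DQ.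
have QC (A : 'M[R]_k1) : (col_mx A (0 : 'M[R]_(k2, k1)))^T *m Q *m col_mx A 0 =
    A^T *m ulsubmx Q *m A.
  rewrite -{1}[Q]submxK tr_col_mx trmx0 mul_row_block !mul0mx !addr0.
  by rewrite mul_row_col mulmx0 addr0.
rewrite QC s1 f1; set C := col_mx _ _; set D := - _.
have -> : C^T *m Q *m D = 0.
  by rewrite -mulmxA QD tr_col_mx trmx0 mul_row_col mulmx0 mul0mx addr0.
have -> : row_mx 0 (mxsqrt (schur Q)) *m C = 0.
  by rewrite mul_row_col mul0mx mulmx0 addr0.
have -> : row_mx 0 (mxsqrt (schur Q)) *m D = 1%:M.
  rewrite mulmxN mulmxA mul_row_col mul0mx add0r mulmxN mulmx1 mulNmx opprK.
  exact: i2'.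
by rewrite -scalar_mx_block.
Qed.

Lemma frame_unitmx : frame \in unitmx.
Proof. by have /mulmx1_unit[] := frame_form. Qed.

Lemma frame_gram : frame *m frame^T = invmx Q.
Proof.
have uW := frame_unitmx; have uQ := posdef_unitmx Qpos.
have E : frame^T *m Q = invmx frame.
  by rewrite -[LHS]mulmx1 -(mulmxV uW) mulmxA frame_form mul1mx.
by rewrite -[LHS]mulmx1 -(mulmxV uQ) mulmxA -(mulmxA frame) E mulmxV// mul1mx.
Qed.

Lemma frame_det : `|\det frame|^-1 = Num.sqrt (\det Q).
Proof.
have := congr1 determinant frame_form; rewrite !det_mulmx det_tr det1 => E.
have d0 : \det frame != 0 by rewrite -unitfE -unitmxE frame_unitmx.
have -> : \det Q = (`|\det frame|^-1) ^+ 2.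
  rewrite exprVn real_normK ?num_real//; apply: (mulfI (mulf_neq0 d0 d0)).
  by rewrite mulrAC E expr2 mulfV// mulf_neq0.
by rewrite sqrtr_sqr normfV normr_id.
Qed.

Lemma mul_frame (z : 'cV[R]_(k1 + k2)) : frame *m z =
  col_mx (mxisqrt (ulsubmx Q) *m usubmx z) 0
  - restriction_mx Q *m (mxisqrt (schur Q) *m dsubmx z).
Proof.
by rewrite -{1}[z]vsubmxK mul_row_col mul_col_mx mul0mx mulNmx mulmxA.
Qed.

Lemma dsubmx_frame (z : 'cV[R]_(k1 + k2)) : dsubmx (frame *m z) = mxisqrt (schur Q) *m dsubmx z.
Proof.
rewrite mul_frame mul_col_mx opp_col_mx add_col_mx col_mxKd mulNmx mul1mx opprK.
by rewrite add0r.
Qed.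

Variables (alpha sigma : R) (gamma : 'cV[R]_k2).
Hypotheses (alpha0 : 0 < alpha) (sigma0 : 0 < sigma).

(** Write [B] for the restriction matrix, [S] for the Schur complement and [s] for the value of
    [shrink]. The second column block of the frame is [- B S^(-1/2)], and
    [S^(-1/2) v = S^(-1/2) z2 + gamma]. Adding [1 - s] times [B S^(-1/2) v] therefore replaces [z2]
    by [s v] and leaves the shift [B gamma]. *)
Lemma averaged_frame z1 z2 :
  averaged alpha sigma Q gamma (frame *m col_mx z1 z2) =
  frame *m col_mx z1 (radial_shrink alpha sigma k2 (z2 + mxsqrt (schur Q) *m gamma)) +
  restriction_mx Q *m gamma.
Proof.
have [s2 i2 i2' f2] := mxisqrtP pS.
rewrite /averaged dsubmx_frame col_mxKd !mul_frame !col_mxKu !col_mxKd.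
set v := z2 + mxsqrt (schur Q) *m gamma.
have eta : mxisqrt (schur Q) *m z2 + gamma = mxisqrt (schur Q) *m v.
  by rewrite mulmxDr mulmxA i2 mul1mx.
have -> : weight alpha sigma Q (mxisqrt (schur Q) *m z2 + gamma) =
    1 - shrink alpha sigma k2 (sqnorm v).
  rewrite onem_shrink// /weight eta trmx_mul s2.
  have -> : v^T *m mxisqrt (schur Q) *m schur Q *m (mxisqrt (schur Q) *m v) =
      v^T *m (mxisqrt (schur Q) *m schur Q *m mxisqrt (schur Q)) *m v by rewrite !mulmxA.
  by rewrite f2 mulmx1 -sqnormE expRN [alpha * _ / _]mulrAC.
rewrite /radial_shrink -!scalemxAr -eta mulmxDr.
set x := restriction_mx Q *m (_ *m z2); set y := restriction_mx Q *m gamma.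
move: (shrink _ _ _ _) (col_mx _ _) x y => s c x y.
by apply/colP => i; rewrite !mxE; ring.
Qed.

End frame.

Lemma iint_col_mx (R : realType) m n (F : 'cV[R]_(m + n) -> R) :
  iint F = iint (fun u : 'cV[R]_m => iint (fun v : 'cV[R]_n => F (col_mx u v))).
Proof.
elim: m F => [|m IH] F.
  rewrite /=; congr iint; apply/funext => v; congr F.
  by apply/colP => i; rewrite mxE; case: splitP => [[]//|j /= ij]; congr (v _ _); exact: val_inj.
rewrite /=; congr Rintegral; apply/funext => x; rewrite IH.
by congr iint; apply/funext => u; congr iint; apply/funext => v;
  congr F; apply/esym; exact: (@col_mx_consVl R m n x u v).
Qed.

Lemma sqnorm_col_mx (R : realType) m n (u : 'cV[R]_m) (v : 'cV[R]_n) :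
  sqnorm (col_mx u v) = sqnorm u + sqnorm v.
Proof. by rewrite !sqnormE tr_col_mx mul_row_col mxE. Qed.

Lemma powR_half_natrD (R : realType) (m n : nat) (sigma : R) : 0 < sigma ->
  (2 * pi * sigma ^+ 2) `^ (- ((m + n)%N%:R / 2)) =
  (2 * pi * sigma ^+ 2) `^ (- (m%:R / 2)) * (2 * pi * sigma ^+ 2) `^ (- (n%:R / 2)).
Proof.
move=> s0; rewrite natrD [(_ + _) / 2]mulrDl opprD.
have c0 : 2 * pi * sigma ^+ 2 != 0 by rewrite !mulf_neq0 ?gt_eqF ?pi_gt0 ?exprn_gt0.
by rewrite powRD ?c0 ?implybT.
Qed.

Lemma iso_normal_pdf_col_mx (R : realType) m n (sigma : R) (u : 'cV[R]_m) (v : 'cV[R]_n) :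
  0 < sigma ->
  iso_normal_pdf (sigma ^+ 2) 0 (col_mx u v) =
  iso_normal_pdf (sigma ^+ 2) 0 u * iso_normal_pdf (sigma ^+ 2) 0 v.
Proof.
move=> s0; rewrite /iso_normal_pdf !subr0 sqnorm_col_mx powR_half_natrD//; set d := (2 * sigma ^+ 2)^-1.
have -> : - (sqnorm u + sqnorm v) * d = - sqnorm u * d + - sqnorm v * d by ring.
by rewrite expRD mulrACA.
Qed.

Section limit_law.
Variables (R : realType) (k1 k2 : nat) (alpha sigma : R) (Q : 'M[R]_(k1 + k2)).
Variable gamma : 'cV[R]_k2.
Hypotheses (alpha0 : 0 < alpha) (sigma0 : 0 < sigma) (Qpos : posdef Q).

Let c := restriction_mx Q *m gamma.
Let mu := mxsqrt (schur Q) *m gamma.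
Let iso k := @iso_normal_pdf R k (sigma ^+ 2) 0.
Let expand := @radial_expand R alpha sigma k2 k2.

(* Joint density of a centred normal vector and the radial shrinkage of an
   independent normal vector centred at [mu]. *)
Definition shrunk_pdf (z : 'cV[R]_(k1 + k2)) : R :=
  iso (usubmx z) * (iso (expand (dsubmx z) - mu) / radial_jacobian alpha sigma k2 (expand (dsubmx z))).

Lemma shrunk_pdf_ge0 z : 0 <= shrunk_pdf z.
Proof.
rewrite mulr_ge0 ?iso_normal_pdf_ge0// divr_ge0 ?iso_normal_pdf_ge0//.
by rewrite ltW// radial_jacobian_gt0.
Qed.

Lemma cvg_iso_normal_pdf (I : Type) (F : set_system I) (FF : Filter F) k
    (f : I -> 'cV[R]_k) (l : 'cV[R]_k) :
  f @ F --> l -> (fun x => iso (f x)) @ F --> iso l.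
Proof.
move=> fl; apply: cvgMr.
apply: (@continuous_cvg _ _ _ F FF (fun x => - sqnorm (f x - 0) / (2 * sigma ^+ 2)) (@expR R)).
  exact: continuous_expR.
apply: cvgMl; apply: cvgN; apply: cvg_sqnorm.
by apply: cvgB => //; exact: cvg_cst.
Qed.

Lemma cvg_shrunk_factor (I : Type) (F : set_system I) (FF : Filter F)
    (f : I -> 'cV[R]_k2) (l : 'cV[R]_k2) : f @ F --> l ->
  (fun x => iso (expand (f x) - mu) / radial_jacobian alpha sigma k2 (expand (f x))) @ F -->
  iso (expand l - mu) / radial_jacobian alpha sigma k2 (expand l).
Proof.
move=> fl; have el : (fun x => expand (f x)) @ F --> expand l by exact: cvg_radial_expand.
apply: cvgM.
  by apply: cvg_iso_normal_pdf; apply: cvgB => //; exact: cvg_cst.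
apply: cvgV; first by rewrite gt_eqF// radial_jacobian_gt0.
exact: cvg_radial_jacobian.
Qed.

Lemma continuous_shrunk_pdf : continuous shrunk_pdf.
Proof.
move=> z; apply: (@cvgM _ _ (nbhs z)).
  by apply: (@cvg_iso_normal_pdf _ (nbhs z)); apply: (@cvg_usubmx _ _ (nbhs z)); exact: cvg_id.
by apply: (@cvg_shrunk_factor _ (nbhs z)); apply: (@cvg_dsubmx _ _ (nbhs z)); exact: cvg_id.
Qed.

Definition limit_stat (z : 'cV[R]_(k1 + k2)) : 'cV[R]_(k1 + k2) :=
  frame Q *m col_mx (usubmx z) (radial_shrink alpha sigma k2 (dsubmx z + mu)) + c.

Lemma measurable_shrunk_pdf : measurable_fun setT shrunk_pdf.
Proof. exact: continuous_measurable_matrix continuous_shrunk_pdf. Qed.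

Lemma measurable_limit_stat : measurable_fun setT limit_stat.
Proof.
apply: continuous_measurable_matrix2 => z.
apply: (@cvgD _ _ _ (nbhs z)); last exact: cvg_cst.
apply: (@cvg_mulmx _ _ (nbhs z)); first exact: cvg_cst.
apply: (@cvg_col_mx _ _ (nbhs z)).
  by apply: (@cvg_usubmx _ _ (nbhs z)); exact: cvg_id.
apply: (@cvg_radial_shrink R alpha sigma k2 _ (nbhs z)).
apply: (@cvgD _ _ _ (nbhs z)); last exact: cvg_cst.
by apply: (@cvg_dsubmx _ _ (nbhs z)); exact: cvg_id.
Qed.

Lemma integral_limit_stat (H : 'cV[R]_(k1 + k2) -> R) : measurable_fun setT H ->
  (\int[muV R (k1 + k2)]_y (H (averaged alpha sigma Q gamma y) * gauss_pdf sigma Q y)%:E =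
   \int[muV R (k1 + k2)]_z (H (limit_stat z) * iso z)%:E)%E.
Proof.
move=> mH; apply/esym.
have E (z : 'cV[R]_(k1 + k2)) :
    limit_stat z = averaged alpha sigma Q gamma (frame Q *m z).
  by rewrite -{2}[z]vsubmxK averaged_frame.
under eq_integral do rewrite E.
apply: (@signed_integral_eq _ _ _ _ R _ _ (muV R (k1 + k2)) (muV R (k1 + k2))
  (fun z => frame Q *m z) id (@iso _) (gauss_pdf sigma Q) _ _ _
  (fun y => H (averaged alpha sigma Q gamma y))).
- by move=> z; exact: iso_normal_pdf_ge0.
- by move=> z; exact: gauss_pdf_ge0.
- move=> G mG G0; apply: ge0_integral_gauss_image => //; exact: frame_gram.
- apply: measurableT_comp => //.
  exact: (measurable_averaged _ _ _ (posdef_unitmx (posdef_ulsubmx Qpos))).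
Qed.

(** The affine map contributes [Num.sqrt (\det Q)]; for fixed [z1] the radial substitution absorbs
    the Jacobian, and a translation by [mu] recentres the second normal vector. *)
Lemma ge0_integral_shrunk_pdf (k2_gt0 : (0 < k2)%N) (h : 'cV[R]_(k1 + k2) -> R) :
  continuous h -> (forall t, 0 <= h t) ->
  (\int[muV R (k1 + k2)]_t (h t * (Num.sqrt (\det Q) *
      shrunk_pdf (invmx (frame Q) *m (t - c))))%:E =
   \int[muV R (k1 + k2)]_z (h (limit_stat z) * iso z)%:E)%E.
Proof.
move=> ch h0; have mh : measurable_fun setT h := continuous_measurable_matrix ch.
have uW := frame_unitmx Qpos.
pose F t := (h t * shrunk_pdf (invmx (frame Q) *m (t - c)))%:E.
have mF : measurable_fun setT F.
  apply/measurable_EFinP; apply: measurable_funM => //.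
  apply: (measurableT_comp measurable_shrunk_pdf).
  apply: (measurableT_comp (measurable_mulmx _)); exact: measurable_translation.
have F0 t : (0 <= F t)%E by rewrite lee_fin mulr_ge0// shrunk_pdf_ge0.
transitivity (\int[muV R (k1 + k2)]_z (h (frame Q *m z + c) * shrunk_pdf z)%:E)%E.
  transitivity (\int[muV R (k1 + k2)]_z F (frame Q *m z + c)%R)%E; last first.
    by apply: eq_integral => z _; rewrite /F addrK mulKmx.
  rewrite ge0_integral_linear// frame_det// -ge0_integralZl_EFin ?sqrtr_ge0//.
  by apply: eq_integral => t _; rewrite /F -EFinM; congr _%:E; ring.
have mHz : measurable_fun setT (fun z => h (frame Q *m z + c) * shrunk_pdf z).
  apply: measurable_funM; last exact: measurable_shrunk_pdf.
  apply: (measurableT_comp mh); apply: measurable_addmx; last exact: measurable_cst.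
  exact: measurable_mulmx.
have mLz : measurable_fun setT (fun z => h (limit_stat z) * iso z).
  apply: measurable_funM; last exact: measurable_iso_normal_pdf.
  exact: (measurableT_comp mh measurable_limit_stat).
rewrite ge0_integral_col_mx; last 2 first.
- exact/measurable_EFinP.
- by move=> z; rewrite lee_fin mulr_ge0// shrunk_pdf_ge0.
rewrite [RHS]ge0_integral_col_mx; last 2 first.
- exact/measurable_EFinP.
- by move=> z; rewrite lee_fin mulr_ge0// iso_normal_pdf_ge0.
apply: eq_integral => z1 _.
pose K w := h (frame Q *m col_mx z1 w + c) * (iso z1 *
   (iso (expand w - mu) / radial_jacobian alpha sigma k2 (expand w))).
have K0 w : 0 <= K w.
  rewrite mulr_ge0// mulr_ge0 ?iso_normal_pdf_ge0// divr_ge0 ?iso_normal_pdf_ge0//.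
  by rewrite ltW// radial_jacobian_gt0.
have cK : continuous K.
  move=> w; apply: (@cvgM _ _ (nbhs w)).
    apply: (@continuous_cvg _ _ _ (nbhs w) _ (fun w => frame Q *m col_mx z1 w + c) h).
      exact: ch.
    apply: (@cvgD _ _ _ (nbhs w)); last exact: cvg_cst.
    apply: (@cvg_mulmx _ _ (nbhs w)); first exact: cvg_cst.
    by apply: (@cvg_col_mx _ _ (nbhs w)); [exact: cvg_cst | exact: cvg_id].
  apply: (@cvgMr _ _ (nbhs w)).
  by apply: (@cvg_shrunk_factor _ (nbhs w)); exact: cvg_id.
transitivity (\int[muV R k2]_w (K w)%:E)%E.
  by apply: eq_integral => w _; rewrite /shrunk_pdf col_mxKu col_mxKd.
pose G v := (h (frame Q *m col_mx z1 (radial_shrink alpha sigma k2 v) + c) *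
   (iso z1 * iso (v - mu)))%:E.
transitivity (\int[muV R k2]_v G v)%E.
  have E : (\int[muV R k2]_w (K w)%:E = \int[muV R k2]_v
      (K (radial_shrink alpha sigma k2 v) * radial_jacobian alpha sigma k2 v)%:E)%E.
    have := @ge0_integral_radial_shrink R alpha sigma k2 alpha0 sigma0 k2.-1.
    by rewrite (prednK k2_gt0) => ->.
  rewrite E; apply: eq_integral => v _; rewrite /K /expand radial_shrinkK// /G.
  congr _%:E; field; by rewrite gt_eqF// radial_jacobian_gt0.
rewrite -(ge0_integral_translation mu); last 2 first.
- apply/measurable_EFinP; apply: measurable_funM.
    apply: (measurableT_comp mh); apply: measurable_addmx; last exact: measurable_cst.
    apply: (measurableT_comp (measurable_mulmx _)).
    apply: measurable_col_mx; first exact: measurable_cst.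
    by apply: continuous_measurable_matrix2; exact: continuous_radial_shrink.
  apply: measurable_funM; first exact: measurable_cst.
  apply: continuous_measurable_matrix => v; apply: (@cvg_iso_normal_pdf _ (nbhs v)).
  by apply: (@cvgB _ _ _ (nbhs v)); [exact: cvg_id | exact: cvg_cst].
- by move=> v; rewrite lee_fin mulr_ge0// mulr_ge0 ?iso_normal_pdf_ge0.
apply: eq_integral => z2 _; rewrite /G /limit_stat col_mxKu col_mxKd addrK.
by rewrite /iso iso_normal_pdf_col_mx.
Qed.

End limit_law.

(** * Explicit form of the limit density *)

Section limit_pdf.
Variables (R : realType) (k1 k2 : nat) (alpha sigma : R) (Q : 'M[R]_(k1 + k2)).
Variable gamma : 'cV[R]_k2.
Hypotheses (alpha0 : 0 < alpha) (sigma0 : 0 < sigma) (Qpos : posdef Q).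

Let p11 : posdef (ulsubmx Q) := posdef_ulsubmx Qpos.
Let pS : posdef (schur Q) := posdef_schur Qpos.

(** Inverts the affine map in the second block: the vector [w] in the formula for the density is the
    second frame coordinate of [t]. *)
Lemma frame_dsubmx_coordinate (z : 'cV[R]_(k1 + k2)) :
  invmx (mxisqrt (schur Q)) *m
    (dsubmx (frame Q *m z + restriction_mx Q *m gamma) + gamma) = dsubmx z.
Proof.
have [_ _ i2 _] := mxisqrtP pS.
rewrite {1}/mxisqrt invmxK [dsubmx (_ + _)]linearD/= dsubmx_frame mul_col_mx col_mxKd mulNmx mul1mx.
by rewrite subrK mulmxA i2 mul1mx.
Qed.

(** The combination vanishes on the range of [restriction_mx Q], because
    [Q11^(1/2) Q11^(-1) = Q11^(-1/2)], and thus sees the first column block of the frame only. *)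
Lemma frame_usubmx_coordinate (z : 'cV[R]_(k1 + k2)) :
  let t := frame Q *m z + restriction_mx Q *m gamma in
  mxsqrt (ulsubmx Q) *m usubmx t + mxisqrt (ulsubmx Q) *m ursubmx Q *m dsubmx t = usubmx z.
Proof.
have [_ i1 i1' _] := mxisqrtP p11.
have inv11 : mxsqrt (ulsubmx Q) *m invmx (ulsubmx Q) = mxisqrt (ulsubmx Q).
  apply: (can_inj (mulmxK (posdef_unitmx p11))); rewrite mulmxKV ?posdef_unitmx//.
  by rewrite -{3}(mxsqrtP p11).2 mulmxA i1 mul1mx.
rewrite /= !linearD/= dsubmx_frame mul_frame linearB/= !mul_col_mx !col_mxKu col_mxKd.
rewrite mulNmx mul1mx !mulmxDr !mulmxN !mulmxA i1' mul1mx inv11.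
by rewrite addrACA subrK addrN addr0.
Qed.

Lemma sqnorm_radial_expand m (w : 'cV[R]_m) :
  sqnorm (radial_expand alpha sigma k2 w) = g_fun alpha sigma k2 (vnorm w) ^+ 2.
Proof.
have [_] := g_funP k2 alpha0 sigma0 (vnorm_ge0 w).
rewrite h_funE /line_shrink mulr1 /radial_expand sqnormZ -sqr_vnorm => {2}<-.
by rewrite exprMn mulrCA -exprMn mulVf ?expr1n ?mulr1// gt_eqF// shrink_gt0.
Qed.

(** The two factors without a Gaussian exponential are the reciprocal of [radial_jacobian] at the
    expanded vector: the base of the power is the inverse of [shrink (G ^+ 2)], and the inner
    reciprocal is [1 - shrink (G ^+ 2)] by [onem_shrink]. *)
Lemma shrunk_pdfE (z : 'cV[R]_(k1 + k2)) :
  let w := dsubmx z in let G := g_fun alpha sigma k2 (vnorm w) in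
  let Gw := if w == 0 then 0 else (G / vnorm w) *: w in
  shrunk_pdf alpha sigma Q gamma z =
    (2 * pi * sigma ^+ 2) `^ (- ((k1 + k2)%N%:R / 2))
    * expR (- sqnorm (usubmx z) / (2 * sigma ^+ 2))
    * (1 + expR (- (alpha / sigma ^+ 2 * G ^+ 2) + 2 * alpha * k2%:R)) ^+ k2
    * (1 + 2 * alpha / sigma ^+ 2 * G ^+ 2
           * (1 + expR (alpha / sigma ^+ 2 * G ^+ 2 - 2 * alpha * k2%:R))^-1)^-1
    * expR (- sqnorm (Gw - mxsqrt (schur Q) *m gamma) / (2 * sigma ^+ 2)).
Proof.
move=> w G Gw; have -> : Gw = radial_expand alpha sigma k2 w by rewrite radial_expandE.
rewrite /shrunk_pdf -/w /iso_normal_pdf !subr0 powR_half_natrD//.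
rewrite /radial_jacobian sqnorm_radial_expand -/G onem_shrink//.
have -> : 1 + expR (- (alpha / sigma ^+ 2 * G ^+ 2) + 2 * alpha * k2%:R) =
    (shrink alpha sigma k2 (G ^+ 2))^-1 by rewrite invrK expRD [_ * expR (2 * _ * _)]mulrC.
have -> : expR (alpha / sigma ^+ 2 * G ^+ 2 - 2 * alpha * k2%:R) =
    (expR (2 * alpha * k2%:R))^-1 * expR (alpha / sigma ^+ 2 * G ^+ 2).
  by rewrite expRD expRN mulrC.
rewrite [2 * (alpha / _)]mulrA.
set p1 := _ `^ (- (k1%:R / 2)); set p2 := _ `^ (- (k2%:R / 2)).
set e1 := expR (- sqnorm (usubmx z) / _); set e2 := expR (- sqnorm (radial_expand _ _ _ _ - _) / _).
set s := shrink _ _ _ _; set j := 1 + 2 * alpha / _ * _ / _.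
move: p1 p2 e1 e2 s j => p1 p2 e1 e2 s j; rewrite invfM exprVn.
by move: (s ^- k2) j^-1 => x y; ring.
Qed.
Lemma limit_statE (z1 : 'cV[R]_k1) (z2 : 'cV[R]_k2) :
  limit_stat alpha sigma Q gamma (col_mx z1 z2) =
  restriction_mx Q *m gamma + col_mx (mxisqrt (ulsubmx Q)) 0 *m z1 +
  (1 + expR (2 * alpha * k2%:R) *
     expR (- (alpha * sqnorm (z2 + mxsqrt (schur Q) *m gamma)) / sigma ^+ 2))^-1
  *: (col_mx (- (invmx (ulsubmx Q) *m ursubmx Q *m mxisqrt (schur Q))) (mxisqrt (schur Q))
        *m z2 - restriction_mx Q *m gamma).
Proof.
have [_ i2 _ _] := mxisqrtP pS.
rewrite /limit_stat mul_frame !col_mxKu !col_mxKd [LHS]addrC addrA.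
rewrite [col_mx (mxisqrt (ulsubmx Q)) 0 *m z1]mul_col_mx mul0mx.
congr (_ + _); rewrite /radial_shrink -!scalemxAr -scalerN; congr (_ *: _).
  by rewrite /shrink mulNr [_ * _ / _]mulrAC.
rewrite mulmxDr mulmxA i2 mul1mx mulmxDr opprD; congr (_ - _).
by rewrite mulmxA /restriction_mx mul_col_mx mulNmx mul1mx -mulNmx opp_col_mx opprK.
Qed.

Lemma iint_mul_pdf k (H p : 'cV[R]_k -> R) :
  measurable_fun setT H -> (exists M, forall t, `|H t| <= M) ->
  (forall t, 0 <= p t) -> measurable_fun setT p ->
  (\int[muV R k]_t (p t)%:E < +oo)%E ->
  iint (fun t => H t * p t) = fine (\int[muV R k]_t (H t * p t)%:E).
Proof. by move=> mH bH p0 mp ip; rewrite iintE//; exact: bounded_mul_integrable. Qed.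

Lemma iint_limit_stat (f : 'cV[R]_(k1 + k2) -> R) :
  measurable_fun setT f -> (exists M, forall t, `|f t| <= M) ->
  iint (fun z1 => iint (fun z2 => f (limit_stat alpha sigma Q gamma (col_mx z1 z2)) *
     iso_normal_pdf (sigma ^+ 2) 0 z1 * iso_normal_pdf (sigma ^+ 2) 0 z2)) =
  fine (\int[muV R (k1 + k2)]_z
    (f (limit_stat alpha sigma Q gamma z) * iso_normal_pdf (sigma ^+ 2) 0 z)%:E).
Proof.
move=> mf [M fM]; rewrite -iint_mul_pdf; last 5 first.
- exact: (measurableT_comp mf (measurable_limit_stat _ _ _ _)).
- by exists M.
- by move=> t; exact: iso_normal_pdf_ge0.
- exact: measurable_iso_normal_pdf.
- by rewrite integral_iso_normal_pdf// ltry.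
rewrite iint_col_mx; congr iint; apply/funext => z1; congr iint; apply/funext => z2.
by rewrite iso_normal_pdf_col_mx// mulrA.
Qed.

Lemma cvg_maxr0 (I : Type) (F : set_system I) (FF : Filter F) (f : I -> R) (l : R) :
  f @ F --> l -> (fun x => Num.max (f x) 0) @ F --> Num.max l 0.
Proof.
move=> fl; under eq_fun do rewrite maxr_absE addr0 subr0.
by rewrite maxr_absE addr0 subr0; apply: cvgMl; apply: cvgD => //; exact: cvg_norm.
Qed.

Lemma iint_shrunk_pdf (k2_gt0 : (0 < k2)%N) (h : 'cV[R]_(k1 + k2) -> R) :
  continuous h -> (exists M, forall t, `|h t| <= M) ->
  iint (fun t => h t * (Num.sqrt (\det Q) *
    shrunk_pdf alpha sigma Q gamma (invmx (frame Q) *m (t - restriction_mx Q *m gamma)))) =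
  fine (\int[muV R (k1 + k2)]_z
    (h (limit_stat alpha sigma Q gamma z) * iso_normal_pdf (sigma ^+ 2) 0 z)%:E).
Proof.
move=> ch bh; pose c := restriction_mx Q *m gamma.
pose p t := Num.sqrt (\det Q) * shrunk_pdf alpha sigma Q gamma (invmx (frame Q) *m (t - c)).
have p0 t : 0 <= p t by rewrite mulr_ge0 ?sqrtr_ge0// shrunk_pdf_ge0.
have mp : measurable_fun setT p.
  apply: measurable_funM; first exact: measurable_cst.
  apply: (measurableT_comp (measurable_shrunk_pdf _ _ _ _)) => //.
  apply: (measurableT_comp (measurable_mulmx _)); exact: measurable_translation.
have E := @ge0_integral_shrunk_pdf R k1 k2 alpha sigma Q gamma alpha0 sigma0 Qpos k2_gt0.
rewrite (@iint_mul_pdf _ h p) => //; last 2 first.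
- exact: continuous_measurable_matrix.
(* The test function 1 shows that the candidate density has total mass 1, hence is integrable. *)
- have c1 : continuous (fun _ : 'cV[R]_(k1 + k2) => 1 : R) by exact: cst_continuous.
  have E1 := E _ c1 (fun=> ler01).
  rewrite (_ : integral _ _ _ = 1%E) ?ltry// -(integral_iso_normal_pdf sigma0 (k1 + k2)).
  transitivity (\int[muV R (k1 + k2)]_z (1 * iso_normal_pdf (sigma ^+ 2) 0 z)%:E)%E.
    by rewrite -E1; apply: eq_integral => t _; rewrite mul1r.
  by apply: eq_integral => z _; rewrite mul1r.
(* [E] covers continuous test functions only, which rules out [signed_integral_eq]; the positive and
   negative parts of [h] are still continuous by [cvg_maxr0], and are treated one by one. *)
congr fine; apply: (@signed_integral_parts_eq _ _ _ _ R _ _ h p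
    (fun z => h (limit_stat alpha sigma Q gamma z))) => //.
- by move=> z; exact: iso_normal_pdf_ge0.
- apply: (E (fun t => Num.max (h t) 0)); last by move=> t; rewrite le_max lexx orbT.
  by move=> t; apply: (@cvg_maxr0 _ (nbhs t)); exact: ch.
- apply: (E (fun t => Num.max (- h t) 0)); last by move=> t; rewrite le_max lexx orbT.
  by move=> t; apply: (@cvg_maxr0 _ (nbhs t)); apply: (@cvgN _ _ _ (nbhs t)); exact: ch.
Qed.

End limit_pdf.

Unset Implicit Arguments.
Theorem theorem7 (R : realType) (k1 k2 : nat) (hk1 : (0 < k1)%N) (hk2 : (0 < k2)%N)
  (alpha sigma : R) (halpha : 0 < alpha) (hsigma : 0 < sigma)
  (X : forall n : nat, 'M[R]_(n, k1 + k2))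
  (hX : forall n : nat, (k1 + k2 <= n)%N -> \rank (X n) = (k1 + k2)%N)
  (Q : 'M[R]_(k1 + k2))
  (hQ : (fun n : nat => (n%:R)^-1 *: ((X n)^T *m X n)) @ \oo --> Q)
  (hQpd : posdef Q) :
  let Q11 := ulsubmx Q in let Q12 := ursubmx Q in
  let Q21 := dlsubmx Q in let Q22 := drsubmx Q in
  let S := Q22 - Q21 *m invmx Q11 *m Q12 in
  let Binf : 'M[R]_(k1 + k2, k2) := col_mx (invmx Q11 *m Q12) (- 1%:M) in
  let Cinf : 'M[R]_(k1 + k2, k1) := col_mx (mxisqrt Q11) 0 in
  let Dinf2 := mxisqrt S in
  let Dinf : 'M[R]_(k1 + k2, k2) := col_mx (- (invmx Q11 *m Q12 *m Dinf2)) Dinf2 in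
  (* part (1) *)
  (forall beta : nat -> 'cV[R]_(k1 + k2),
     (fun n : nat => Num.sqrt (n%:R) * vnorm (dsubmx (beta n))) @ \oo --> +oo ->
     weak_cvg (fun n => law_stat alpha sigma (X n) (beta n))
       (fun f => iint (fun t => f t * mvnormal_pdf (sigma ^+ 2 *: invmx Q) t)))
  /\
  (* part (2) *)
  (forall (beta : nat -> 'cV[R]_(k1 + k2)) (gamma : 'cV[R]_k2),
     (fun n : nat => Num.sqrt (n%:R) *: dsubmx (beta n)) @ \oo --> gamma ->
     let L (z1 : 'cV[R]_k1) (z2 : 'cV[R]_k2) : 'cV[R]_(k1 + k2) :=
       Binf *m gamma + Cinf *m z1 +
       (1 + expR (2 * alpha * k2%:R) *
            expR (- (alpha * sqnorm (z2 + mxsqrt S *m gamma)) / sigma ^+ 2))^-1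
         *: (Dinf *m z2 - Binf *m gamma) in
     let Elim (f : 'cV[R]_(k1 + k2) -> R) : R :=
       iint (fun z1 : 'cV[R]_k1 => iint (fun z2 : 'cV[R]_k2 =>
         f (L z1 z2) * iso_normal_pdf (sigma ^+ 2) 0 z1
                     * iso_normal_pdf (sigma ^+ 2) 0 z2)) in
     let finf (t : 'cV[R]_(k1 + k2)) : R :=
       let t1 := usubmx t in let t2 := dsubmx t in
       let w := invmx Dinf2 *m (t2 + gamma) in
       let G := g_fun alpha sigma k2 (vnorm w) in
       let Gw : 'cV[R]_k2 := if w == 0 then 0 else (G / vnorm w) *: w in
       (2 * pi * sigma ^+ 2) `^ (- ((k1 + k2)%N%:R / 2)) * Num.sqrt (\det Q)
       * expR (- sqnorm (mxsqrt Q11 *m t1 + mxisqrt Q11 *m Q12 *m t2)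
               / (2 * sigma ^+ 2))
       * (1 + expR (- (alpha / sigma ^+ 2 * G ^+ 2) + 2 * alpha * k2%:R)) ^+ k2
       * (1 + 2 * alpha / sigma ^+ 2 * G ^+ 2
              * (1 + expR (alpha / sigma ^+ 2 * G ^+ 2 - 2 * alpha * k2%:R))^-1)^-1
       * expR (- sqnorm (Gw - invmx Dinf2 *m gamma) / (2 * sigma ^+ 2)) in
     weak_cvg (fun n => law_stat alpha sigma (X n) (beta n)) Elim
     /\
     (forall h : 'cV[R]_(k1 + k2) -> R, continuous h ->
        (exists M : R, forall x, `|h x| <= M) ->
        Elim h = iint (fun t => h t * finf t))).
Proof.
move=> Q11 Q12 Q21 Q22 S Binf Cinf Dinf2 Dinf.
have k_gt0 : (0 < k1 + k2)%N by rewrite addn_gt0 hk1.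
have hc := @law_stat_cvg R sigma hsigma k1 k2 alpha X Q k_gt0 hX hQ hQpd.
split=> [beta bo f cf bf|beta gamma hg L Elim finf].
  have mf : measurable_fun setT f := continuous_measurable_matrix cf.
  have -> : (fun t => f t * mvnormal_pdf (sigma ^+ 2 *: invmx Q) t) =
      (fun t => f t * gauss_pdf sigma Q t).
    by apply/funext => t; rewrite mvnormal_pdfE.
  rewrite iint_mul_pdf; last 5 first.
  - exact: mf.
  - exact: bf.
  - by move=> t; exact: gauss_pdf_ge0.
  - exact: measurable_gauss_pdf.
  - by rewrite integral_gauss_pdf// ltry.
  apply: (hc beta id) => // y; apply: (cvg_averaged_far hsigma halpha hQpd hQ).
  (* A norm that is at least 1 is bounded by its square, so the squared norms of the drift diverge
     as well. *)
  apply/cvgryPge => A; move/cvgryPge : bo => /(_ (Num.max 1 A)); apply: filterS => n.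
  rewrite ge_max => /andP[b1 bA].
  rewrite sqnormZ -sqr_vnorm -exprMn; apply: (le_trans bA).
  by rewrite expr2 ler_peMl// (le_trans ler01 b1).
have ElimE h : continuous h -> (exists M, forall t, `|h t| <= M) ->
    Elim h = fine (\int[muV R (k1 + k2)]_z
      (h (limit_stat alpha sigma Q gamma z) * iso_normal_pdf (sigma ^+ 2) 0 z)%:E)%E.
  move=> ch bh; rewrite -iint_limit_stat//; last exact: continuous_measurable_matrix.
  congr iint; apply/funext => z1; congr iint; apply/funext => z2.
  by rewrite limit_statE.
split=> [f cf bf|h ch bh].
  rewrite ElimE// -integral_limit_stat//; last exact: continuous_measurable_matrix.
  apply: (hc beta) => // y; apply: cvg_averaged; [|exact: hQ|exact: hg|exact: cvg_cst].
  exact: posdef_unitmx (posdef_ulsubmx hQpd).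
rewrite ElimE// -iint_shrunk_pdf//; congr iint; apply/funext => t; congr (_ * _).
(* In the frame coordinates [z] of [t] the two densities can be compared factor by factor. *)
set z := invmx (frame Q) *m (t - restriction_mx Q *m gamma).
have tz : t = frame Q *m z + restriction_mx Q *m gamma.
  by rewrite mulKVmx ?subrK// frame_unitmx.
clearbody z; subst t; rewrite shrunk_pdfE// /finf.
rewrite (_ : invmx Dinf2 *m (dsubmx _ + gamma) = dsubmx z); last first.
  exact: frame_dsubmx_coordinate.
rewrite (_ : mxsqrt Q11 *m _ + _ = usubmx z); last exact: frame_usubmx_coordinate.
rewrite (_ : invmx Dinf2 = mxsqrt (schur Q)); last exact: invmxK.
by rewrite !mulrA [Num.sqrt _ * _]mulrC.
Qed.
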